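(* Let $\mathcal{A}$ be an arrangement in $V=\mathbb{K}^\ell$, $H\in\mathcal{A}$ and $\mathcal{A}':=\mathcal{A}\setminus\{H\}$. Assume that $\chi(\mathcal{A};t)=\prod_{i=1}^\ell(t-d_i)$ with real numbers $d_1,\ldots,d_\ell$, and that $d:=|\mathcal{A}'|-|\mathcal{A}^H|>d_i$ for all $i$. Then $\mathcal{A}$ is free if and only if $\mathcal{A}'$ is strictly plus-one generated with $\mathrm{POexp}(\mathcal{A}')=(d_1,\ldots,d_\ell)$. In this case, $\exp(\mathcal{A})=\mathrm{POexp}(\mathcal{A}')$ and the level of $\mathcal{A}'$ is $d$.
   Context: Let $\mathbb{K}$ be a field, $V=\mathbb{K}^\ell$, $S=\mathrm{Sym}^*(V^* )=\mathbb{K}[x_1,\ldots,x_\ell]$ and $\mathrm{Der}\,S=\bigoplus_{i=1}^\ell S\partial_{x_i}$. An arrangement $\mathcal{A}$ in $V$ is a finite set of linear hyperplanes in $V$; arrangements are assumed essential ($\bigcap_{H\in\mathcal{A}}H=\{0\}$) unless otherwise specified. For $H\in\mathcal{A}$ fix $\alpha_H\in V^*$ with $\ker\alpha_H=H$, and let $\mathcal{A}^H:=\{L\cap H\mid L\in\mathcal{A}\setminus\{H\}\}$ be the restriction, an arrangement in $H$. $D(\mathcal{A}):=\{\theta\in\mathrm{Der}\,S\mid\theta(\alpha_H)\in S\alpha_H\ (\forall H\in\mathcal{A})\}$, graded by polynomial degree: $\sum f_i\partial_{x_i}$ is homogeneous of degree $d$ if all $f_i\in S_d$. $\mathcal{A}$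 is free with exponents $\exp(\mathcal{A})=(d_1,\ldots,d_\ell)$ if $D(\mathcal{A})=\bigoplus_{i=1}^\ell S\theta_i$ with $\theta_i$ homogeneous of degree $d_i$; order of exponents is immaterial. $\theta_E=\sum_i x_i\partial_{x_i}$ is the Euler derivation. $\mathcal{A}$ is plus-one generated with exponents $\mathrm{POexp}(\mathcal{A})=(d_1,\ldots,d_\ell)$ and level $d$ if $D(\mathcal{A})$ has a minimal (graded) free resolution $$0\to S[-d-1]\xrightarrow{(\alpha,f_1,\ldots,f_\ell)}S[-d]\oplus\Big(\bigoplus_{i=1}^\ell S[-d_i]\Big)\to D(\mathcal{A})\to0,$$ i.e. there is a minimal set of homogeneous generators $\theta_1=\theta_E,\theta_2,\ldots,\theta_\ell,\varphi$ with $\deg\theta_i=d_i$ (so one of the exponents is $1$, attached to $\theta_E$), $\deg\varphi=d$, and a single relation (up to multiples) $\sum f_i\theta_i+\alpha\varphi=0$, $f_i\in S$, $\alpha\in V^*$. It is strictly plus-one generated if such a resolution can be chosen with $\alpha\ne0$. The intersection lattice $L(\mathcal{A})$ is the set of all intersections of subsets of $\mathcal{A}$ (including $V$); $\mu(V)=1$, $\mu(X)=-\sum_{Y\in L(\mathcal{A}),\,X\subsetneq Y\subset V}\mu(Y)$, and $\chi(\mathcal{A};t)=\sum_{X\in L(\mathcal{A})}\mu(X)t^{\dim X}$. *)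

(* Defs.v *)
From HB Require Import structures.
From mathcomp Require Import all_boot all_order all_algebra.
From mathcomp Require Import finmap.
From mathcomp.multinomials Require Import mpoly.

Set Implicit Arguments.
Unset Strict Implicit.
Unset Printing Implicit Defensive.

Import GRing.Theory.
Local Open Scope ring_scope.

(* V = K^l is 'rV[K]_l, with the x_i = 'X_i : {mpoly K[l]} as coordinates. *)
Notation subspaces K l := {fset {vspace 'rV[K]_l}}.

Section Combinatorics.
Context {K : fieldType} {l : nat}.
Implicit Types (A : subspaces K l) (H X Y : {vspace 'rV[K]_l}).

(* Stated with a successor, so that nothing is a hyperplane when l = 0. *)
Definition arrangement A : Prop := forall H, H \in A -> (\dim H).+1 = l.

Definition essential A : Prop := (\bigcap_(H <- A) H)%VS = 0%VS.

Definition restriction A H : subspaces K l :=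
  [fset (L :&: H)%VS | L in (A `\ H)%fset]%fset.

(* The empty subset of A contributes the whole space fullv. *)
Definition intersection_lattice A : subspaces K l :=
  [fset (\bigcap_(H <- (B : subspaces K l)) H)%VS | B in fpowerset A]%fset.

Definition propersubv X Y : bool := (X <= Y)%VS && (X != Y).

(* The Moebius recursion, with fuel; see mobius_full and mobius_rec. *)
Fixpoint mobius_fuel A (n : nat) X : int :=
  if n is n'.+1 then
    if X == fullv then 1
    else - \sum_(Y <- intersection_lattice A | propersubv X Y) mobius_fuel A n' Y
  else 0.

Definition mobius A X : int := mobius_fuel A l.+1 X.

Definition arr_char_poly A : {poly int} :=
  \sum_(X <- intersection_lattice A) (mobius A X)%:P * 'X^(\dim X).

Lemma mobius_full A : mobius A fullv = 1.
Proof. by rewrite /mobius /= eqxx. Qed.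

Lemma propersubv_dim X Y : propersubv X Y -> (\dim X < \dim Y <= l)%N.
Proof.
case/andP=> sXY; rewrite eqEdim sXY /= -ltnNge => -> /=.
by rewrite (leq_trans (dimvS (subvf Y))) // dimvf /dim /= mul1n.
Qed.

Lemma mobius_fuelE A n m X :
  (l - \dim X < n)%N -> (l - \dim X < m)%N ->
  mobius_fuel A n X = mobius_fuel A m X.
Proof.
elim: n m X => [//|n IH] [//|m] X /= ltn ltm; case: eqP => // _.
congr (- _); apply: eq_bigr => Y /propersubv_dim/andP[ltXY leY].
have lt1 : (l - \dim Y < l - \dim X)%N.
  by apply: ltn_sub2l => //; apply: leq_trans leY.
by apply: IH; apply: leq_trans lt1 _; rewrite -ltnS.
Qed.

Lemma mobius_rec A X : X != fullv ->
  mobius A X = - \sum_(Y <- intersection_lattice A | propersubv X Y) mobius A Y.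
Proof.
move=> XnV; rewrite {1}/mobius /= (negPf XnV); congr (- _).
apply: eq_bigr => Y /propersubv_dim/andP[ltXY leY].
apply: mobius_fuelE; last by rewrite ltnS leq_subr.
by rewrite -subSn // leq_subLR -[X in (X <= _)%N]add1n leq_add2r (leq_trans _ ltXY).
Qed.

End Combinatorics.

Section Derivations.
Context {K : fieldType} {l : nat}.
Local Notation S := {mpoly K[l]}.

(* theta = \sum_i theta_i d/dx_i is its row of coefficients. *)
Definition derivation := 'rV[S]_l.

Implicit Types (A : subspaces K l) (H : {vspace 'rV[K]_l}).
Implicit Types (theta phi delta : derivation) (alpha f : S).

Definition der_app theta f : S := \sum_(i < l) theta 0 i * f^`M(i).

Definition der_homog (d : nat) theta : Prop := forall i, theta 0 i \is d.-homog.

Definition euler : derivation := \row_i 'X_i.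

(* alpha \in V^* and ker alpha = H. *)
Definition defining_form alpha H : Prop :=
  alpha \is 1.-homog /\
  forall v : 'rV[K]_l, (v \in H) = (alpha.@[fun i => v 0 i] == 0).

(* A defining form is unique up to a nonzero scalar, so the quantification over
   all of them amounts to fixing one for each hyperplane. *)
Definition log_der A theta : Prop :=
  forall H, H \in A -> forall alpha, defining_form alpha H ->
  exists g : S, der_app theta alpha = g * alpha.

Definition free_with_exponents A (e : l.-tuple nat) : Prop :=
  exists theta : 'I_l -> derivation,
  [/\ forall i, log_der A (theta i),
      forall i, der_homog (tnth e i) (theta i),
      forall delta, log_der A delta ->
        exists c : 'I_l -> S, delta = \sum_i c i *: theta i
    & forall c : 'I_l -> S, \sum_i c i *: theta i = 0 -> forall i, c i = 0].

Definition is_free A : Prop := exists e, free_with_exponents A e.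

(* The minimal free resolution
     0 -> S[-d-1] -> S[-d] (+) (\bigoplus_i S[-e_i]) -> D(A) -> 0
   with second map (g, c) |-> g phi + \sum_i c_i theta_i and first map
   1 |-> (alpha, f): alpha is linear and f_i is homogeneous of degree
   d + 1 - e_i (hence 0 when this is negative). Minimality means that the
   entries alpha, f_i of the first map lie in the irrelevant ideal; for alpha
   this is automatic. *)
Record pog_resolution A (e : l.-tuple nat) (d : nat)
    (theta : 'I_l -> derivation) phi alpha (f : 'I_l -> S) : Prop :=
  PogResolution {
    pog_theta_log : forall i, log_der A (theta i);
    pog_theta_homog : forall i, der_homog (tnth e i) (theta i);
    pog_phi_log : log_der A phi;
    pog_phi_homog : der_homog d phi;
    pog_euler : exists i, theta i = euler;
    pog_alpha_homog : alpha \is 1.-homog;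
    pog_f_homog : forall i m, m \in msupp (f i) -> (mdeg m + tnth e i)%N = d.+1;
    pog_minimal : forall i, (f i)@_0%MM = 0;
    pog_generate : forall delta, log_der A delta ->
      exists (g : S) (c : 'I_l -> S), delta = g *: phi + \sum_i c i *: theta i;
    pog_exact : forall (g : S) (c : 'I_l -> S),
      g *: phi + \sum_i c i *: theta i = 0 <->
      exists h : S, g = h * alpha /\ forall i, c i = h * f i;
    pog_injective : alpha != 0 \/ exists i, f i != 0
  }.

Definition plus_one_generated A (e : l.-tuple nat) (d : nat) : Prop :=
  exists (theta : 'I_l -> derivation) phi alpha (f : 'I_l -> S),
    pog_resolution A e d theta phi alpha f.

Definition strictly_plus_one_generated A (e : l.-tuple nat) (d : nat) : Prop :=
  exists (theta : 'I_l -> derivation) phi alpha (f : 'I_l -> S),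
    pog_resolution A e d theta phi alpha f /\ alpha != 0.

End Derivations.

(* Main.v *)
(* Write alpha for the form of H and A' for the deletion. Terao's polynomial B, of
   degree d = |A'| - |A^H|, satisfies theta(alpha) \in (alpha, B) for theta in
   D(A'), so elements of D(A') of degree below d lie in D(A). If A is free, the
   value B is attained by some phi of degree d; then D(A') is generated by phi and
   a basis of D(A), the only relation being the expansion of alpha phi in D(A).
   Conversely, if D(A') is strictly plus-one generated, its generators of degrees
   d_i < d lie in D(A) and are independent, and \sum d_i = |A|, so Saito's
   criterion makes them a basis.
   The exponents of a free arrangement are matched with the roots of chi (Terao's
   factorization) by counting points: over F_q the Frobenius and Euler derivations
   give a system of equations of degrees q - e_i whose zeros, all simple, are the
   points of the complement, so that chi(q) = \prod (q - e_i); a general K is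
   specialized to arbitrarily large finite fields. *)
From HB Require Import structures.
Require Import Defs.
From mathcomp Require Import all_boot all_order all_algebra all_fingroup all_solvable all_field.
From mathcomp Require Import finmap reals ring zify.
From mathcomp Require boolp.
From mathcomp.multinomials Require Import mpoly.
Set Implicit Arguments.
Unset Strict Implicit.
Unset Printing Implicit Defensive.
Import Order.TTheory GRing.Theory Num.Theory.
Local Open Scope ring_scope.

(** * Linear forms as primes *)

(** The bound [d] > d_i acts three times: it puts low degree elements of D(A') into D(A), it makes
    the relation minimal, the coefficients having positive degree d + 1 - d_i, and it separates the
    generator of degree [d] from the others when two resolutions are compared. That comparison is
    needed because the last claim concerns any plus-one generated resolution of A', possibly with
    [alpha] = 0. Two arguments stand in for Hilbert series. Divisibility of determinants shows that
    a generating family of l elements of D(A) has determinant a constant times Q, and the exact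
    Bezout number comes from comparing the growth of two counts of exponent vectors. Whitney's
    formula reduces chi to ranks of subfamilies of normals, so that the passage to finite fields has
    to preserve only finitely many polynomial identities, once ranks and inequalities are certified
    by such identities. The equation \sum d_i = |A| is read off the coefficient of t^(l-1) in
    chi. *)

Definition divides (R : comNzRingType) (a f : R) : Prop := exists g, f = g * a.

Section Divides.
Context {R : comNzRingType}.
Implicit Types a f g : R.

Lemma divides0 a : divides a 0.
Proof. by exists 0; rewrite mul0r. Qed.

Lemma dividesxx a : divides a a.
Proof. by exists 1; rewrite mul1r. Qed.

Lemma dividesD a f g : divides a f -> divides a g -> divides a (f + g).
Proof. by move=> [x ->] [y ->]; exists (x + y); rewrite mulrDl. Qed.

Lemma dividesMl a f g : divides a f -> divides a (g * f).
Proof. by move=> [x ->]; exists (g * x); rewrite mulrA. Qed.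

Lemma dividesMr a f g : divides a f -> divides a (f * g).
Proof. by rewrite mulrC; apply: dividesMl. Qed.

Lemma dividesN a f : divides a f -> divides a (- f).
Proof. by move=> [x ->]; exists (- x); rewrite mulNr. Qed.

Lemma dividesB a f g : divides a f -> divides a g -> divides a (f - g).
Proof. by move=> df /dividesN; apply: dividesD. Qed.

Lemma divides_trans a f g : divides a f -> divides f g -> divides a g.
Proof. by move=> [x ->] [y ->]; exists (y * x); rewrite mulrA. Qed.

End Divides.

Section LinearForms.
Context {K : fieldType} {l : nat}.
Local Notation S := {mpoly K[l]}.
Implicit Types (u v : 'cV[K]_l) (w : 'rV[K]_l) (f g : S).

Definition lf u : S := \sum_j u j 0 *: 'X_j.

Definition pairing w u : K := (w *m u) 0 0.

Lemma lf_is_linear : linear lf.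
Proof.
move=> c u v; rewrite /lf scaler_sumr -big_split /=.
by apply: eq_bigr => j _; rewrite !mxE scalerDl scalerA.
Qed.
HB.instance Definition _ :=
  GRing.isLinear.Build K 'cV[K]_l S _ lf lf_is_linear.

Lemma pairing_is_linear w : scalar (pairing w).
Proof. by move=> c u v; rewrite /pairing mulmxDr -scalemxAr !mxE. Qed.
HB.instance Definition _ w :=
  GRing.isLinear.Build K 'cV[K]_l K _ (pairing w) (pairing_is_linear w).

Lemma lf_coef u j : (lf u)@_U_(j) = u j 0.
Proof.
rewrite /lf raddf_sum (bigD1 j) //= mcoeffZ mcoeffXU eqxx mulr1 big1 ?addr0 //.
by move=> i ni; rewrite mcoeffZ mcoeffXU (negPf ni) mulr0.
Qed.

Lemma lf_inj : injective lf.
Proof.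
move=> u v e; apply/matrixP => i j; rewrite !ord1.
by rewrite -!lf_coef e.
Qed.

Lemma lf_eq0 u : (lf u == 0) = (u == 0).
Proof. by rewrite -(inj_eq lf_inj) raddf0. Qed.

Lemma lf_homog u : lf u \is 1.-homog.
Proof. by apply: rpred_sum => j _; apply: rpredZ; rewrite dhomogX /= mdeg1. Qed.

Lemma homog1_lf f : f \is 1.-homog -> f = lf (\col_j f@_U_(j)).
Proof.
move=> hf; apply/mpolyP => m; case: (boolP (mdeg m == 1%N)) => [/mdeg1P|hm].
  by case=> j /eqP ->; rewrite lf_coef mxE.
by rewrite !(@dhomog_nemf_coeff _ _ mdeg 1%N) ?lf_homog.
Qed.

Lemma lf_eval u w : (lf u).@[fun i => w 0 i] = pairing w u.
Proof.
rewrite /lf raddf_sum /pairing mxE; apply: eq_bigr => j _ /=.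
by rewrite mevalZ mevalXU mulrC.
Qed.

Lemma lf_deriv u i : (lf u)^`M(i) = (u i 0)%:MP.
Proof.
rewrite /lf raddf_sum (bigD1 i) //= big1 ?addr0 => [|j nj].
  rewrite mderivZ mderivX mnm1E eqxx scale1r.
  have -> : (U_(i) - U_(i) = 0 :> 'X_{1..l})%MM.
    by apply/mnmP => k; rewrite mnmBE subnn mnm0E.
  by rewrite mpolyX0 -mul_mpolyC mulr1.
by rewrite mderivZ mderivX mnm1E (negPf nj) scale0r scaler0.
Qed.

Lemma pairing_exists u : u != 0 -> exists w, pairing w u = 1.
Proof.
move=> un0; have [j nj] : exists j, u j 0 != 0.
  apply/existsP; apply: contraNT un0; rewrite negb_exists => /forallP h.
  by apply/eqP/matrixP=> i j; rewrite ord1 mxE; apply/eqP; move: (h i); rewrite negbK.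
exists ((u j 0)^-1 *: delta_mx 0 j); rewrite /pairing -scalemxAl mxE -rowE mxE.
by rewrite mulVf.
Qed.

Section Projection.
Variables (w : 'rV[K]_l) (u : 'cV[K]_l).

(* The substitution x |-> x - u(x) w, a retraction of V onto ker u when u(w) = 1. *)
Definition proj f : S := f \mPo [tuple 'X_j - w 0 j *: lf u | j < l].

HB.instance Definition _ := GRing.RMorphism.copy proj
  (comp_mpoly [tuple 'X_j - w 0 j *: lf u | j < l]).
HB.instance Definition _ := GRing.Linear.copy proj
  (comp_mpoly [tuple 'X_j - w 0 j *: lf u | j < l]).

Lemma projX j : proj 'X_j = 'X_j - w 0 j *: lf u.
Proof. by rewrite /proj comp_mpolyXU -tnth_nth tnth_mktuple. Qed.

Lemma proj_lf v : proj (lf v) = lf (v - pairing w v *: u).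
Proof.
rewrite [RHS]raddfB /= linearZ /= {1}/lf raddf_sum /=.
have -> : \sum_j proj (v j 0 *: 'X_j) =
    \sum_j (v j 0 *: 'X_j - (v j 0 * w 0 j) *: lf u).
  by apply: eq_bigr => j _; rewrite linearZ /= projX scalerBr scalerA.
rewrite sumrB -scaler_suml; congr (_ - _ *: _).
by rewrite /pairing mxE; apply: eq_bigr => j _; rewrite mulrC.
Qed.

(** For a variable the difference is a scalar times [lf u], and the property passes to products and
    linear combinations. Divisibility by [lf u] thereby becomes the equation [proj f = 0]. *)
Lemma divides_subproj f : divides (lf u) (f - proj f).
Proof.
elim/mpolyind: f => [|c m f _ _ IH]; first by rewrite raddf0 subrr; apply: divides0.
have -> : c *: 'X_[m] + f - proj (c *: 'X_[m] + f) =
    c%:MP * ('X_[m] - proj 'X_[m]) + (f - proj f).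
  by rewrite raddfD /= linearZ /= mulrBr !mul_mpolyC opprD addrACA.
apply: dividesD => //; apply: dividesMl.
have XM (f1 f2 : S) : divides (lf u) (f1 - proj f1) -> divides (lf u) (f2 - proj f2) ->
    divides (lf u) (f1 * f2 - proj (f1 * f2)).
  move=> d1 d2; rewrite rmorphM /=.
  have -> : f1 * f2 - proj f1 * proj f2 = (f1 - proj f1) * f2 + proj f1 * (f2 - proj f2).
    by rewrite mulrBl mulrBr addrA subrK.
  by apply: dividesD; [apply: dividesMr|apply: dividesMl].
rewrite mpolyXE_id; elim/big_ind: _ => [||i _].
- by rewrite rmorph1 subrr; apply: divides0.
- exact: XM.
elim: (m i) => [|k IHk]; first by rewrite expr0 rmorph1 subrr; apply: divides0.
rewrite exprS; apply: (XM _ _ _ IHk); rewrite projX opprB addrC subrK.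
by exists (w 0 i)%:MP; rewrite mul_mpolyC.
Qed.

Hypothesis wu1 : pairing w u = 1.

Lemma proj_self : proj (lf u) = 0.
Proof. by rewrite proj_lf wu1 scale1r subrr raddf0. Qed.

Lemma dividesE f : divides (lf u) f <-> proj f = 0.
Proof.
split=> [[g ->]|e]; first by rewrite rmorphM /= proj_self mulr0.
by have := divides_subproj f; rewrite e subr0.
Qed.

Lemma proj_idem f : proj (proj f) = proj f.
Proof.
have [g eg] := divides_subproj f.
have := congr1 proj eg; rewrite rmorphM /= proj_self mulr0 raddfB /=.
by move/subr0_eq.
Qed.

End Projection.

(** By [dividesE] the multiples of [lf u] are the kernel of a ring morphism into the domain [S]. *)
Lemma lf_prime u f g : u != 0 ->
  divides (lf u) (f * g) -> divides (lf u) f \/ divides (lf u) g.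
Proof.
move=> /pairing_exists [w wu]; rewrite !(dividesE wu) rmorphM /=.
by move/eqP; rewrite mulf_eq0 => /orP[/eqP ->|/eqP ->]; [left|right].
Qed.

Lemma lf_dvd_lf u v : u != 0 -> divides (lf u) (lf v) -> exists c, v = c *: u.
Proof.
move=> /pairing_exists [w wu]; rewrite (dividesE wu) proj_lf => /eqP.
by rewrite lf_eq0 subr_eq0 => /eqP ->; exists (pairing w v).
Qed.

Lemma lf_ndvd1 u : u != 0 -> ~ divides (lf u) 1.
Proof.
by move=> /pairing_exists [w wu]; rewrite (dividesE wu) rmorph1 => /eqP; rewrite oner_eq0.
Qed.

Lemma lf_prime_prod u (I : Type) (r : seq I) (P : pred I) (F : I -> S) : u != 0 ->
  divides (lf u) (\prod_(i <- r | P i) F i) -> exists2 i, P i & divides (lf u) (F i).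
Proof.
move=> un0; elim: r => [|i r IH]; first by rewrite big_nil => /(lf_ndvd1 un0).
by rewrite big_cons; case: ifP => // Pi /(lf_prime un0)[]; [exists i|].
Qed.

(* Gauss: linear forms are primes, so a product of them that are all prime to g
   can be cancelled. *)
Lemma prod_lf_dvd (I : Type) (r : seq I) (P : pred I) (v : I -> 'cV[K]_l) f g :
  (forall i, P i -> v i != 0) ->
  (forall i, P i -> ~ divides (lf (v i)) g) ->
  divides (\prod_(i <- r | P i) lf (v i)) (f * g) ->
  divides (\prod_(i <- r | P i) lf (v i)) f.
Proof.
move=> vn0 vg; elim: r f => [|i r IH] f; first by rewrite !big_nil => _; exists f; rewrite mulr1.
rewrite !big_cons; case: ifP => [Pi [h eh]|_ /IH //].
have /(lf_prime (vn0 i Pi))[[f' ef']|/(vg i Pi) //] : divides (lf (v i)) (f * g).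
  by rewrite eh mulrCA; apply: dividesMr; apply: dividesxx.
have ln0 : lf (v i) != 0 by rewrite lf_eq0 vn0.
have /IH [k ek] : divides (\prod_(j <- r | P j) lf (v j)) (f' * g).
  exists h; apply: (mulfI ln0); rewrite [RHS]mulrCA -eh ef'.
  by rewrite mulrA [_ * f']mulrC.
by exists k; rewrite ef' ek mulrCA mulrA mulrC mulrA mulrC mulrA.
Qed.

Lemma prod_lf_mul_dvd (I : Type) (r : seq I) (P : pred I) (v : I -> 'cV[K]_l) f g :
  (forall i, P i -> v i != 0) ->
  (forall i, P i -> ~ divides (lf (v i)) g) ->
  divides (\prod_(i <- r | P i) lf (v i)) f -> divides g f ->
  divides ((\prod_(i <- r | P i) lf (v i)) * g) f.
Proof.
move=> vn0 vg df [h eh]; rewrite {}eh in df *.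
by have [k ->] := prod_lf_dvd vn0 vg df; exists k; rewrite mulrA.
Qed.

End LinearForms.

(** * Saito's criterion *)

Section FamilyDivides.
Context {K : fieldType} {l : nat} {T : finType}.
Implicit Types (u : T -> 'cV[K]_l) (D : {set T}) (f : {mpoly K[l]}).

Definition independent_pairs u D : Prop :=
  (forall t, t \in D -> u t != 0) /\
  (forall t t' c, t \in D -> t' \in D -> u t' = c *: u t -> t' = t).

(** The defining polynomial Q of the subarrangement indexed by [D]. *)
Definition qpoly u D : {mpoly K[l]} := \prod_(t in D) lf (u t).

Lemma independent_pairsS u D D' : D' \subset D ->
  independent_pairs u D -> independent_pairs u D'.
Proof.
move=> /subsetP sD [n0 pr]; split=> [t /sD/n0 //|t t' c /sD tD /sD t'D].
exact: pr.
Qed.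

Lemma qpoly_neq0 u D : independent_pairs u D -> qpoly u D != 0.
Proof. by move=> [n0 _]; apply/prodf_neq0 => t /n0; rewrite lf_eq0. Qed.

Lemma lf_ndvd_qpoly u D t : independent_pairs u (t |: D) -> t \notin D ->
  ~ divides (lf (u t)) (qpoly u D).
Proof.
move=> [n0 pr] tD; have tI : t \in t |: D by rewrite !inE eqxx.
case/(lf_prime_prod (n0 t tI)) => t' t'D /(lf_dvd_lf (n0 t tI))[c ec].
have/pr et : u t' = c *: u t by [].
by move: tD; rewrite -et ?t'D // !inE ?t'D ?orbT.
Qed.

Lemma qpoly_divides u D f : independent_pairs u D ->
  (forall t, t \in D -> divides (lf (u t)) f) -> divides (qpoly u D) f.
Proof.
have [n] := ubnP #|D|; elim: n D => // n IH E ltE ip df.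
have [->|[t tE]] := set_0Vmem E.
  by rewrite /qpoly big_set0; exists f; rewrite mulr1.
move: ltE ip df; rewrite -(setD1K tE); set D := E :\ t.
have tD : t \notin D by rewrite !inE eqxx.
rewrite cardsU1 tD ltnS => ltD ip df; rewrite /qpoly big_setU1 //= -/(qpoly u D).
have ipD := independent_pairsS (subsetUr [set t] D) ip.
have [h eh] := IH D ltD ipD (fun t' t'D => df t' (setU1r t t'D)).
have tI : t \in t |: D by rewrite !inE eqxx.
have := df t tI; rewrite eh => /(lf_prime (ip.1 t tI))[[k ->]|].
  by exists k; rewrite mulrA.
by move/(lf_ndvd_qpoly ip tD).
Qed.

End FamilyDivides.

Section Saito.
Context {K : fieldType} {l : nat} {T : finType}.
Local Notation S := {mpoly K[l]}.
Implicit Types (u : T -> 'cV[K]_l) (D : {set T}) (theta delta : 'rV[S]_l).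

(** The partial derivatives of a linear form are constants, so the value of [theta] on [lf v] can be
    written without them; see [der_app_lf]. *)
Definition vapp theta (v : 'cV[K]_l) : S := \sum_j v j 0 *: theta 0 j.

Lemma der_app_lf theta v : der_app theta (lf v) = vapp theta v.
Proof.
by apply: eq_bigr => j _; rewrite lf_deriv mulrC mul_mpolyC.
Qed.

Lemma vapp_is_linear (v : 'cV[K]_l) : scalar (vapp ^~ v : 'rV[S]_l -> S).
Proof.
move=> c p q; rewrite /vapp mulr_sumr -big_split; apply: eq_bigr => j _ /=.
by rewrite !mxE scalerDr scalerAr.
Qed.

Lemma vappDZ (v : 'cV[K]_l) (a : S) (p q : 'rV[S]_l) :
  vapp (a *: p + q) v = a * vapp p v + vapp q v.
Proof. exact: vapp_is_linear. Qed.

Lemma vapp0 v : vapp 0 v = 0.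
Proof. by rewrite /vapp big1 // => j _; rewrite mxE scaler0. Qed.

Lemma vappD v p q : vapp (p + q) v = vapp p v + vapp q v.
Proof. by have := vappDZ v 1 p q; rewrite scale1r mul1r. Qed.

Lemma vappZ v a p : vapp (a *: p) v = a * vapp p v.
Proof. by have := vappDZ v a p 0; rewrite !addr0 vapp0 addr0. Qed.

Lemma vappB v p q : vapp (p - q) v = vapp p v - vapp q v.
Proof. by rewrite -scaleN1r addrC vappDZ mulN1r addrC. Qed.

Lemma vappEv theta v : vapp theta v = (theta *m map_mx (mpolyC l (R := K)) v) 0 0.
Proof. by rewrite mxE; apply: eq_bigr => j _; rewrite !mxE mulrC mul_mpolyC. Qed.

Lemma vapp_comb theta c v v' :
  vapp theta (c *: v + v') = c *: vapp theta v + vapp theta v'.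
Proof.
rewrite /vapp scaler_sumr -big_split; apply: eq_bigr => j _ /=.
by rewrite !mxE scalerDl scalerA.
Qed.

Definition logd u D theta : Prop :=
  forall t, t \in D -> divides (lf (u t)) (vapp theta (u t)).

Lemma euler_log u D : logd u D euler.
Proof.
move=> t _; suff -> : vapp euler (u t) = lf (u t) by apply: dividesxx.
by apply: eq_bigr => j _; rewrite mxE.
Qed.

Lemma logdS u D D' theta : D' \subset D -> logd u D theta -> logd u D' theta.
Proof. by move=> /subsetP sD lt t /sD; apply: lt. Qed.

Lemma logd0 u D : logd u D 0.
Proof. by move=> t _; rewrite vapp0; apply: divides0. Qed.

Lemma logdD u D p q : logd u D p -> logd u D q -> logd u D (p + q).
Proof. by move=> lp lq t tD; rewrite vappD; apply: dividesD; [apply: lp|apply: lq]. Qed.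

Lemma logdZ u D a p : logd u D p -> logd u D (a *: p).
Proof. by move=> lp t tD; rewrite vappZ; apply/dividesMl/lp. Qed.

Lemma logdB u D p q : logd u D p -> logd u D q -> logd u D (p - q).
Proof. by move=> lp lq; rewrite -scaleN1r; apply: logdD => //; apply: logdZ. Qed.

Lemma logd_sum u D (I : Type) (r : seq I) (P : pred I) (F : I -> 'rV[S]_l) :
  (forall i, P i -> logd u D (F i)) -> logd u D (\sum_(i <- r | P i) F i).
Proof. by move=> lF; elim/big_ind: _ => //; [exact: logd0|exact: logdD]. Qed.

Definition coefmx (theta : 'I_l -> 'rV[S]_l) : 'M[S]_l := \matrix_(i, j) theta i 0 j.

Lemma coefmx_comb (theta : 'I_l -> 'rV[S]_l) (c : 'rV[S]_l) :
  c *m coefmx theta = \sum_i c 0 i *: theta i.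
Proof.
apply/matrixP=> i j; rewrite ord1 !mxE summxE.
by apply: eq_bigr => k _; rewrite !mxE.
Qed.

(** Modulo [lf (u t)] the coefficient matrix annihilates the nonzero constant column [u t], so its
    determinant vanishes there; the forms are non-associated primes, so their product divides it. *)
Lemma saito_det_divides u D (theta : 'I_l -> 'rV[S]_l) :
  independent_pairs u D -> (forall i, logd u D (theta i)) ->
  divides (qpoly u D) (\det (coefmx theta)).
Proof.
move=> ip lt; apply: qpoly_divides => // t tD.
have [w wu] := pairing_exists (ip.1 t tD).
rewrite (dividesE wu) -det_map_mx; set M := map_mx _ _.
have M0 : M *m map_mx (mpolyC l (R := K)) (u t) = 0.
  apply/matrixP=> i j; rewrite ord1 !mxE.
  have /(dividesE wu) := lt i t tD; rewrite /vapp raddf_sum /= => e0; rewrite -[RHS]e0.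
  by apply: eq_bigr => k _; rewrite !mxE linearZ /= mulrC mul_mpolyC.
have: \adj M *m (M *m map_mx (mpolyC l (R := K)) (u t)) = 0 by rewrite M0 mulmx0.
rewrite mulmxA mul_adj_mx mul_scalar_mx => e.
apply/eqP; apply: contraT => d0; have := ip.1 t tD.
suff -> : u t = 0 by rewrite eqxx.
apply/matrixP=> i j; rewrite ord1 [RHS]mxE; have := congr1 (fun A : 'cV_l => A i 0) e.
rewrite !mxE => /eqP; rewrite mulf_eq0 (negPf d0) /= mpolyC_eq0 => /eqP //.
Qed.

Lemma cofactor_replace (M N : 'M[S]_l) i :
  (forall k j, k != i -> M k j = N k j) -> forall j, cofactor M i j = cofactor N i j.
Proof.
move=> e j; rewrite /cofactor; congr (_ * \det _); apply/matrixP=> a b.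
by rewrite !mxE e // eq_sym neq_lift.
Qed.

(** Cramer's rule: the i-th coefficient of [delta] times the determinant is the determinant with row
    i replaced by [delta], which [qpoly u D] divides because all rows are logarithmic. *)
Lemma saito_criterion u D (theta : 'I_l -> 'rV[S]_l) (c : K) :
  independent_pairs u D -> (forall i, logd u D (theta i)) -> c != 0 ->
  \det (coefmx theta) = c *: qpoly u D ->
  forall delta, logd u D delta -> exists a : 'I_l -> S, delta = \sum_i a i *: theta i.
Proof.
move=> ip lt c0 dM delta ld; set M := coefmx theta in dM.
have dn0 : \det M != 0 by rewrite dM scaler_eq0 negb_or c0 qpoly_neq0.
have da i : exists a, (delta *m \adj M) 0 i = a * \det M.
  pose N := coefmx (fun k => if k == i then delta else theta k).
  have [a ea] : divides (qpoly u D) (\det N).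
    by apply: saito_det_divides => // k; case: eqP.
  exists (c^-1 *: a); rewrite dM -scalerAl -scalerAr scalerA mulVf // scale1r -ea.
  rewrite (expand_det_row N i) mxE; apply: eq_bigr => j _.
  have eN : N i j = delta 0 j by rewrite mxE eqxx.
  have ec : cofactor M i j = cofactor N i j.
    by apply: cofactor_replace => k k' nk; rewrite !mxE (negPf nk).
  by rewrite eN -ec [\adj M j i]mxE.
have [a ea] := fin_all_exists da.
exists a; apply/rowP => j; apply: (mulfI dn0).
have := congr1 (fun A : 'rV[S]_l => A 0 j) (mulmxA delta (\adj M) M).
rewrite mul_adj_mx mul_mx_scalar [LHS]mxE => ->; rewrite mxE summxE mulr_sumr.
by apply: eq_bigr => i _; rewrite ea !mxE mulrAC mulrC.
Qed.

(** One block matrix is factored both as lower times upper triangular and as upper times lower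
    triangular. *)
Lemma det_add1_rank1 (R : comNzRingType) n (x : 'cV[R]_n) (y : 'rV[R]_n) :
  \det (1%:M + x *m y) = 1 + (y *m x) 0 0.
Proof.
pose B := block_mx (1%:M : 'M[R]_1) (- y) x (1%:M : 'M[R]_n).
transitivity (\det B).
  have -> : B = block_mx 1%:M 0 x 1%:M *m block_mx 1%:M (- y) 0 (1%:M + x *m y).
    rewrite mulmx_block !mul1mx !mul0mx !mulmx1 !addr0; congr block_mx.
    by rewrite mulmxN addrCA addNr addr0.
  by rewrite det_mulmx det_lblock det_ublock !det1 !mul1r.
have -> : B = block_mx (1%:M + y *m x) (- y) 0 1%:M *m block_mx 1%:M 0 x 1%:M.
  rewrite mulmx_block !mul1mx !mul0mx !mulmx1 !mulmx0 ?addr0 !add0r; congr block_mx.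
  by rewrite mulNmx addrK.
rewrite det_mulmx det_lblock det_ublock !det1 !mulr1 [1%:M + _]mx11_scalar det_scalar1.
by rewrite !mxE eqxx.
Qed.

Lemma qpoly_log u D theta : logd u D (qpoly u D *: theta).
Proof.
move=> t tD; rewrite vappZ; apply: dividesMr.
by rewrite /qpoly (bigD1 t) //=; apply: dividesMr; apply: dividesxx.
Qed.

(* The determinant of a generating family divides that of any l logarithmic
   derivations. If the form u t divided \det / Q, the family
   (Q / u t) (1 + (u t - 1) x y), with determinant (Q / u t)^l u t, would
   contradict this; Q times the identity then shows that \det / Q is a unit. *)
Lemma generators_det u D (theta : 'I_l -> 'rV[S]_l) :
  independent_pairs u D -> (forall i, logd u D (theta i)) ->
  (forall delta, logd u D delta -> exists a : 'I_l -> S, delta = \sum_i a i *: theta i) ->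
  exists2 c : K, c != 0 & \det (coefmx theta) = c *: qpoly u D.
Proof.
move=> ip lt gen; set M := coefmx theta; pose Q := qpoly u D.
have divM (N : 'M[S]_l) : (forall i, logd u D (row i N)) -> divides (\det M) (\det N).
  move=> lN; have /fin_all_exists[C eC] i := gen _ (lN i).
  exists (\det (\matrix_(i, j) C i j)); rewrite -det_mulmx; congr (\det _).
  apply/row_matrixP => i; rewrite eC row_mul coefmx_comb.
  by apply: eq_bigr => k _; rewrite !mxE.
have [r er] := saito_det_divides ip lt; rewrite -/M -/Q in er.
have Qn0 : Q != 0 by apply: qpoly_neq0.
have rmax t : t \in D -> ~ divides (lf (u t)) r.
  move=> tD dr; have tn0 := ip.1 t tD; have [w wu] := pairing_exists tn0.
  pose Q' := qpoly u (D :\ t).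
  have eQ : Q = lf (u t) * Q' by rewrite /Q /qpoly (big_setD1 t).
  pose x := map_mx (mpolyC l (R := K)) (u t).
  pose y := (lf (u t) - 1) *: map_mx (mpolyC l (R := K)) w.
  have wx : (map_mx (mpolyC l (R := K)) w *m x) 0 0 = 1.
    by rewrite -map_mxM mxE [(w *m u t) 0 0]wu rmorph1.
  have yx : y *m x = (lf (u t) - 1)%:M.
    by rewrite [LHS]mx11_scalar /y -scalemxAl mxE wx mulr1.
  have /divM : forall i, logd u D (row i (Q' *: (1%:M + x *m y))).
    move=> i t' t'D; rewrite linearZ vappZ /=.
    case: (eqVneq t' t) => [->|nt]; last first.
      by apply: dividesMr; rewrite /Q' /qpoly (bigD1 t') ?inE ?nt //=;
         apply: dividesMr; apply: dividesxx.
    apply: dividesMl; rewrite vappEv -row_mul mulmxDl mul1mx -mulmxA -/x.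
    rewrite yx mul_mx_scalar.
    have -> : x + (lf (u t) - 1) *: x = lf (u t) *: x by rewrite scalerBl scale1r addrC subrK.
    by rewrite !mxE mulrC; apply: dividesMl; apply: dividesxx.
  rewrite detZ det_add1_rank1 yx mxE eqxx mulr1n addrC subrK.
  rewrite er eQ => -[k ek].
  have ltn0 : lf (u t) != 0 by rewrite lf_eq0.
  have e : Q' ^+ l = k * r * Q'.
    by apply: (mulfI ltn0); rewrite mulrC ek; ring.
  have : divides (lf (u t)) (\prod_(i < l) Q').
    rewrite prodr_const card_ord e mulrAC; apply: dividesMl.
    by [].
  case/(lf_prime_prod tn0) => _ _; apply: (lf_ndvd_qpoly (D := D :\ t)).
    by rewrite setD1K.
  by rewrite !inE eqxx.
(* [r] is prime to every factor of Q, so a power of Q dividing [s * r] already divides [s]. *)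
have cancel n s : divides (Q ^+ n) (s * r) -> divides (Q ^+ n) s.
  elim: n s => [|n IH] s; first by exists s; rewrite mulr1.
  rewrite exprS => -[k ek].
  have [s' es] : divides Q s.
    apply: (prod_lf_dvd (g := r)) ip.1 rmax _.
    by exists (k * Q ^+ n); rewrite ek -mulrA [_ * Q]mulrC.
  have /IH[k' ek'] : divides (Q ^+ n) (s' * r).
    by exists k; apply: (mulfI Qn0); rewrite mulrA [_ * s']mulrC -es ek mulrCA.
  by exists k'; rewrite es ek' mulrAC mulrA.
(* The derivations Q d/dx_j have determinant Q^l, which is therefore k r Q. Cancelling [r] shows
   that Q^l divides k Q, and the two equations make [r] a unit, that is, a nonzero constant. *)
have /divM : forall i, logd u D (row i Q%:M).
  by move=> i; rewrite -scalemx1 linearZ; apply: qpoly_log.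
rewrite det_scalar er => -[k ek].
have [k' ek'] : divides (Q ^+ l) (k * Q).
  by apply: cancel; rewrite ek -mulrA [r * Q]mulrC; apply: dividesxx.
have ur : k' * r = 1.
  apply: (mulIf (expf_neq0 l Qn0)).
  by rewrite mul1r mulrAC -ek' -mulrA [Q * r]mulrC ek.
have /andP[/eqP rc ru] := mpoly_intro_unit ur.
exists r@_0%MM; first by move: ru; rewrite unitfE.
by rewrite {1}rc mul_mpolyC.
Qed.

End Saito.

(** * Deletion and Terao's polynomial *)

Section Homogeneity.
Context {K : fieldType} {l : nat}.
Local Notation S := {mpoly K[l]}.
Implicit Types (f g : S) (theta : 'rV[S]_l).

Lemma dhomog_bigprod (I : Type) (r : seq I) (P : pred I) (F : I -> S) (d : I -> nat) :
  (forall i, P i -> F i \is (d i).-homog) ->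
  \prod_(i <- r | P i) F i \is (\sum_(i <- r | P i) d i).-homog.
Proof.
move=> hF; elim/big_rec2: _ => [|i y1 y2 Pi hy]; first exact: dhomog1.
by apply: dhomogM => //; apply: hF.
Qed.

Lemma proj_homog w (u : 'cV[K]_l) d f : f \is d.-homog -> proj w u f \is d.-homog.
Proof.
move=> hf; rewrite [f]mpolyE raddf_sum /= big_seq; apply: rpred_sum => m mf.
rewrite linearZ /=; apply: rpredZ; rewrite /proj comp_mpolyX.
rewrite -(dhomog_mf hf mf) /= mdegE; apply: dhomog_bigprod => i _.
rewrite tnth_mktuple -[X in X.-homog]mul1n; apply: dhomogMn.
by apply: rpredB; [rewrite dhomogX /= mdeg1|apply/rpredZ/lf_homog].
Qed.

Lemma pihomogMr d e f g : g \is e.-homog ->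
  pihomog mdeg d (f * g) = if (e <= d)%N then pihomog mdeg (d - e) f * g else 0.
Proof.
move=> hg; set k := maxn (msize f) (d - e).+1.
have fE := pihomog_partitionE (leq_maxl (msize f) (d - e).+1).
have hfg i : pihomog mdeg i f * g \is (i + e).-homog by apply/dhomogM/hg/pihomogP.
rewrite {1}fE mulr_suml raddf_sum /=; case: leqP => [led|ltd]; last first.
  apply: big1 => i _; apply: (pihomog_ne0 _ (hfg i)).
  by rewrite neq_ltn ltn_addl ?orbT.
have lk : (d - e < k)%N by rewrite leq_max ltnSn orbT.
rewrite (bigD1 (Ordinal lk)) //= pihomog_dE ?big1 ?addr0 // => [i ni|].
  apply: (pihomog_ne0 _ (hfg i)); apply: contra ni => /eqP ed.
  by rewrite -val_eqE /= -ed addnK.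
by have := hfg (d - e)%N; rewrite subnK.
Qed.

Lemma divides_pihomog d (u : 'cV[K]_l) f :
  divides (lf u) f -> divides (lf u) (pihomog mdeg d f).
Proof.
move=> [g ->]; rewrite (pihomogMr d g (lf_homog u)); case: ifP => _; last exact: divides0.
by eexists.
Qed.

Definition hcomp d theta : 'rV[S]_l := map_mx (pihomog mdeg d) theta.

Lemma vapp_hcomp d theta v : vapp (hcomp d theta) v = pihomog mdeg d (vapp theta v).
Proof. by rewrite raddf_sum /=; apply: eq_bigr => j _; rewrite mxE linearZ. Qed.

Lemma vapp_homog d theta v : der_homog d theta -> vapp theta v \is d.-homog.
Proof. by move=> ht; apply: rpred_sum => j _; apply/rpredZ/ht. Qed.

Lemma hcomp_homog d theta : der_homog d (hcomp d theta).
Proof. by move=> i; rewrite mxE; apply: pihomogP. Qed.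

Lemma hcomp_dE d theta : der_homog d theta -> hcomp d theta = theta.
Proof. by move=> ht; apply/rowP=> j; rewrite mxE pihomog_dE. Qed.

Lemma hcomp_log (T : finType) (u : T -> 'cV[K]_l) D d theta :
  logd u D theta -> logd u D (hcomp d theta).
Proof. by move=> lt t tD; rewrite vapp_hcomp; apply/divides_pihomog/lt. Qed.

Lemma qpoly_homog (T : finType) (u : T -> 'cV[K]_l) (D : {set T}) :
  qpoly u D \is #|D|.-homog.
Proof. by rewrite -sum1_card; apply: dhomog_bigprod => t _; apply: lf_homog. Qed.

Lemma coefmx_det_homog (e : 'I_l -> nat) (theta : 'I_l -> 'rV[S]_l) :
  (forall i, der_homog (e i) (theta i)) -> \det (coefmx theta) \is (\sum_i e i).-homog.
Proof.
move=> ht; apply: rpred_sum => s _; rewrite -signr_odd mulr_sign.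
have hp : \prod_i coefmx theta i (s i) \is (\sum_i e i).-homog.
  by apply: dhomog_bigprod => i _; rewrite mxE; apply: ht.
by case: odd => //; rewrite rpredN.
Qed.

Lemma dual_vector (u v : 'cV[K]_l) : v != 0 -> (forall c, u <> c *: v) ->
  exists w, pairing w u = 1 /\ pairing w v = 0.
Proof.
move=> /pairing_exists[w2 w2v] uv.
have /pairing_exists[w3 w3u] : u - pairing w2 u *: v != 0.
  by rewrite subr_eq0; apply/eqP/uv.
have pB w w' x c : pairing (w - c *: w') x = pairing w x - c * pairing w' x.
  by rewrite /pairing mulmxBl -scalemxAl !mxE.
exists (w3 - pairing w3 v *: w2); rewrite !pB w2v mulr1 subrr; split=> //.
have := w3u; rewrite raddfB /= linearZ /= => <-.
by rewrite mulrC.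
Qed.

Definition cder (w : 'rV[K]_l) : 'rV[S]_l := map_mx (mpolyC l (R := K)) w.

Lemma vapp_cder w v : vapp (cder w) v = (pairing w v)%:MP.
Proof. by rewrite vappEv -map_mxM mxE. Qed.

Lemma homog_divides_eq0 d e f g : f \is d.-homog -> g \is e.-homog -> (e < d)%N ->
  f != 0 -> divides f g -> g = 0.
Proof.
move=> hf hg lt f0 [k ek]; apply/eqP; apply: contraT => g0.
have k0 : k != 0 by apply: contraNneq g0 => k0; rewrite ek k0 mul0r.
have := mleadM k0 f0; rewrite -ek => /(congr1 (@mdeg _)).
rewrite mdegD (dhomog_mf hg (mlead_supp g0)) (dhomog_mf hf (mlead_supp f0)) /= => e1.
by move: lt; rewrite e1 ltnNge leq_addl.
Qed.

End Homogeneity.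

Lemma sum_scaleBB (R : pzRingType) (V : lmodType R) (I : finType)
    (x y z : R) (a b c : I -> R) (v : I -> V) :
  \sum_i (x * a i - y * b i - z * c i) *: v i =
  x *: (\sum_i a i *: v i) - y *: (\sum_i b i *: v i) - z *: (\sum_i c i *: v i).
Proof.
rewrite !scaler_sumr -!sumrB; apply: eq_bigr => i _.
by rewrite !scalerBl !scalerA.
Qed.

Lemma scaleBB_commute (R : pzRingType) (V : lmodType R) (x y z : R) (v1 v2 : V) :
  x * z = z * x -> y * z = z * y ->
  x *: (z *: v1) - y *: (z *: v2) - z *: (x *: v1 - y *: v2) = 0.
Proof. by move=> e1 e2; rewrite scalerBr !scalerA e1 e2 subrr. Qed.

Section Deletion.
Context {K : fieldType} {l : nat} {T : finType}.
Local Notation S := {mpoly K[l]}.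
Variables (u : T -> 'cV[K]_l) (h : T) (w : 'rV[K]_l).
Hypothesis ip : independent_pairs u setT.
Hypothesis wh : pairing w (u h) = 1.

Local Notation D' := [set~ h].
Local Notation rho := (proj w (u h)).
Local Notation alpha := (lf (u h)).

(** The restriction of [u t] to the hyperplane of [h], extended to V so as to vanish at [w]; such
    forms are fixed by [rho]. *)
Definition restr (t : T) : 'cV[K]_l := u t - pairing w (u t) *: u h.

Lemma rho_lf t : rho (lf (u t)) = lf (restr t).
Proof. exact: proj_lf. Qed.

Lemma pairing_restr t : pairing w (restr t) = 0.
Proof. by rewrite raddfB /= linearZ /= wh mulr1 subrr. Qed.

Lemma rho_restr t : rho (lf (restr t)) = lf (restr t).
Proof. by rewrite proj_lf pairing_restr scale0r subr0. Qed.

Lemma rho_qpoly (D : {set T}) : rho (qpoly u D) = qpoly restr D.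
Proof. by rewrite rmorph_prod; apply: eq_bigr => t _; apply: rho_lf. Qed.

Lemma rho_qpoly_restr (D : {set T}) : rho (qpoly restr D) = qpoly restr D.
Proof. by rewrite rmorph_prod; apply: eq_bigr => t _; apply: rho_restr. Qed.

Lemma normal_nprop t t' c : t != t' -> u t <> c *: u t'.
Proof. by move=> nt /(ip.2 _ _ _ (in_setT _) (in_setT _)) e; rewrite e eqxx in nt. Qed.

Lemma restr_neq0 t : t != h -> restr t != 0.
Proof. by move=> th; rewrite subr_eq0; apply/eqP/normal_nprop. Qed.

Lemma alpha_neq0 : u h != 0. Proof. exact: ip.1. Qed.

(* A transversal of the fibres of L |-> L :&: H on the hyperplanes L <> H; the
   forms restr t are the restrictions to H of the defining forms. *)
Variable R : {set T}.
Hypothesis RD : R \subset D'.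
Hypothesis ipR : independent_pairs restr R.
Hypothesis coverR : forall t, t != h -> exists r, r \in R /\ exists c, restr t = c *: restr r.

(* Terao's polynomial B: theta(alpha) lies in (alpha, B) for theta in D(A'). *)
Definition terao_poly : S := qpoly restr (D' :\: R).

Lemma terao_poly_homog : terao_poly \is #|D' :\: R|.-homog.
Proof. exact: qpoly_homog. Qed.

Lemma terao_poly_neq0 : terao_poly != 0.
Proof.
apply/prodf_neq0 => t; rewrite !inE => /andP[_ th].
by rewrite lf_eq0 restr_neq0.
Qed.

(** Hyperplanes with a common trace on H form a fibre. In each fibre the product of the restricted
    forms other than that of the representative divides delta(alpha) modulo alpha; products from
    different fibres are coprime, and together they make up B. *)
Lemma terao_divides delta : logd u D' delta -> divides terao_poly (rho (vapp delta (u h))).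
Proof.
move=> ld; set a := vapp delta (u h).
have : forall t, exists r, t != h -> r \in R /\ exists c, restr t = c *: restr r.
  move=> t; case: (eqVneq t h) => [_|/coverR[r hr]]; first by exists t.
  by exists r.
move=> /fin_all_exists[rep hrep].
have hrep1 t : t != h -> rep t \in R by move=> /hrep[].
have repE t t' c : t != h -> t' != h -> restr t' = c *: restr t -> rep t' = rep t.
  move=> th t'h e; have [rR [c1 e1]] := hrep t th; have [r'R [c2 e2]] := hrep t' t'h.
  have c2n0 : c2 != 0.
    by apply: contraNneq (restr_neq0 t'h) => c0; rewrite e2 c0 scale0r.
  apply: (ipR.2 _ _ (c2^-1 * (c * c1)) rR r'R).
  by rewrite -!scalerA -e1 -e e2 scalerA mulVf // scale1r.
have Rh r : r \in R -> r != h by move/(subsetP RD); rewrite !inE.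
have repR r : r \in R -> rep r = r.
  move=> rR; have [r'R [c e]] := hrep r (Rh r rR).
  have c0 : c != 0 by apply: contraNneq (restr_neq0 (Rh r rR)) => c0; rewrite e c0 scale0r.
  by apply: (ipR.2 _ _ c^-1 rR r'R); rewrite e scalerA mulVf // scale1r.
have fibre x : x \in R ->
    divides (\prod_(t in D' :\: R | rep t == x) lf (restr t)) (rho a).
  move=> xR; have xh := Rh x xR; pose X := [set t in D' | rep t == x].
  pose b := vapp delta (u x).
  (* Replacing [u x] by [u t] = c [u x] + c' [u h] changes this 2 by 2 minor only by the factor c,
     and the minor for [u t] is a multiple of [lf (u t)] since [delta] is logarithmic. *)
  have [k ek] : divides (qpoly u X) (lf (u x) * a - alpha * b).
    apply: qpoly_divides => [|t]; first exact: independent_pairsS (subsetT _) ip.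
    rewrite !inE => /andP[th /eqP rt]; have [_ [c]] := hrep t th; rewrite rt => e.
    have c0 : c != 0 by apply: contraNneq (restr_neq0 th) => c0; rewrite e c0 scale0r.
    have [c' eu] : exists c', u t = c *: u x + c' *: u h.
      exists (pairing w (u t) - c * pairing w (u x)).
      rewrite -[LHS](subrK (pairing w (u t) *: u h)) -/(restr t) e.
      by rewrite scalerBr scalerBl scalerA -addrA [- _ + _]addrC.
    have e2 : c *: (lf (u x) * a - alpha * b) = a * lf (u t) - alpha * vapp delta (u t).
      rewrite eu vapp_comb [lf (_ + _)]raddfD /= [lf (c *: _)]linearZ [lf (c' *: _)]linearZ /= -/a -/b.
      have -> : vapp delta (c' *: u h) = c' *: a.
        by rewrite /a /vapp scaler_sumr; apply: eq_bigr => j _; rewrite mxE scalerA.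
      by rewrite -!mul_mpolyC; ring.
    rewrite -[X in divides _ X]scale1r -(mulVf c0) -scalerA e2.
    rewrite -mul_mpolyC; apply: dividesMl; apply: dividesB.
      by apply: dividesMl; apply: dividesxx.
    by apply/dividesMl/ld; rewrite !inE.
  (* Modulo alpha only [lf (restr x) * rho a] remains, and its first factor cancels the
     representative in the product over the fibre. *)
  have := congr1 rho ek; rewrite rmorphB !rmorphM /= (proj_self wh) mul0r subr0.
  rewrite rho_lf rho_qpoly => e; exists (rho k).
  have xn0 : lf (restr x) != 0 by rewrite lf_eq0 restr_neq0.
  apply: (mulfI xn0); rewrite e mulrCA; congr (_ * _).
  rewrite /qpoly (bigD1 x) ?inE ?xh ?repR ?eqxx //=; congr (_ * _).
  apply: eq_bigl => t; rewrite !inE.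
  case: (boolP (t \in R)) => [tR|tR] /=.
    by rewrite repR //; case: (t == x); case: (t == h).
  have -> : t != x by apply: contraNneq tR => ->.
  by rewrite andbT.
(* Fibres are adjoined one at a time; forms from two fibres are not proportional, hence coprime. *)
have all (Y : {set T}) : Y \subset R ->
    divides (\prod_(t in D' :\: R | rep t \in Y) lf (restr t)) (rho a).
  have [n] := ubnP #|Y|; elim: n Y => // n IH Y ltY sY.
  have [->|[x xY]] := set_0Vmem Y.
    by rewrite big_pred0 => [|t]; [exists (rho a); rewrite mulr1|rewrite in_set0 andbF].
  have xR := subsetP sY x xY.
  rewrite (bigID (fun t => rep t == x)) /=.
  rewrite (eq_bigl (fun t => (t \in D' :\: R) && (rep t == x))); last first.
    move=> t; rewrite -andbA; congr (_ && _).
    by case: eqP => [->|_]; rewrite ?xY ?andbF.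
  set g := \prod_(t in _ | _) _; set g' := \prod_(t | _) _.
  have -> : g' = \prod_(t in D' :\: R | rep t \in Y :\ x) lf (restr t).
    by apply: eq_bigl => t; rewrite !inE -!andbA [(rep t \in Y) && _]andbC.
  apply: prod_lf_mul_dvd => [t|t||].
  - by rewrite !inE => /andP[/andP[_ th] _]; apply: restr_neq0.
  - rewrite !inE => /andP[/andP[_ th] /eqP rt].
    case/(lf_prime_prod (restr_neq0 th)) => t'.
    rewrite !inE => /andP[/andP[_ t'h] /andP[rt' _]].
    move/(lf_dvd_lf (restr_neq0 th)) => [c /(repE _ _ _ th t'h)].
    by rewrite rt => e; rewrite e eqxx in rt'.
  - exact: fibre.
  apply: IH; last exact: subset_trans (subsetDl _ _) sY.
  by move: ltY; rewrite (cardsD1 x) xY.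
have := all R (subxx _); rewrite /terao_poly /qpoly.
rewrite (eq_bigl (fun t => t \in D' :\: R)) // => t.
rewrite !inE; case: (eqVneq t h) => [_|th]; first by rewrite /= andbF.
by rewrite hrep1 // andbT.
Qed.

(** Modulo alpha, theta(alpha) is a multiple of B whose degree is below that of B, hence zero. *)
Lemma log_of_low_degree e theta : logd u D' theta -> der_homog e theta ->
  (e < #|D' :\: R|)%N -> logd u setT theta.
Proof.
move=> lt ht lte t _; case: (eqVneq t h) => [->|th]; last by apply: lt; rewrite !inE.
apply/(dividesE wh); have hv := vapp_homog (u h) ht.
exact: (homog_divides_eq0 terao_poly_homog (proj_homog w (u h) hv) lte
          terao_poly_neq0 (terao_divides lt)).
Qed.

Variable theta : 'I_l -> 'rV[S]_l.
Hypothesis theta_log : forall i, logd u setT (theta i).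
Hypothesis theta_gen : forall delta, logd u setT delta ->
  exists a : 'I_l -> S, delta = \sum_i a i *: theta i.
Hypothesis theta_free : forall a : 'I_l -> S, \sum_i a i *: theta i = 0 -> forall i, a i = 0.

Lemma logd_alphaZ delta : logd u D' delta -> logd u setT (alpha *: delta).
Proof.
move=> ld t _; rewrite vappZ; case: (eqVneq t h) => [->|th].
  by apply: dividesMr; apply: dividesxx.
by apply/dividesMl/ld; rewrite !inE.
Qed.

(* The image of D(A') in S/alpha is saturated: as D(A) is free and alpha, x, g is
   a regular sequence, lifts psi1, psi2 of x f, g f can be corrected by D(A) so
   that g psi1 = x psi2, and psi1 / x is then a lift of f. *)
Lemma saturation (x : 'cV[K]_l) (w' : 'rV[K]_l) (g f : S) (psi1 psi2 : 'rV[S]_l) :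
  pairing w x = 0 -> pairing w' x = 1 -> pairing w' (u h) = 0 ->
  rho g = g -> ~ divides alpha (proj w' x g) ->
  logd u D' psi1 -> logd u D' psi2 ->
  rho (vapp psi1 (u h)) = lf x * f -> rho (vapp psi2 (u h)) = g * f ->
  exists2 phi, logd u D' phi & rho (vapp phi (u h)) = f.
Proof.
move=> wx w'x w'h rg ndg l1 l2 e1 e2; set y := lf x.
have hn0 := alpha_neq0.
have x0 : x != 0 by apply: contra_eq_neq w'x => ->; rewrite raddf0 eq_sym oner_eq0.
have yg : ~ divides y g by move/(dividesE w'x) => p0; apply: ndg; rewrite p0; apply: divides0.
have y0 : y != 0 by rewrite lf_eq0.
have a0 : alpha != 0 by rewrite lf_eq0.
have ry : rho y = y by rewrite proj_lf wx scale0r subr0.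
have pa : proj w' x alpha = alpha by rewrite proj_lf w'h scale0r subr0.
have ay : ~ divides alpha y.
  by move/(dividesE wh); rewrite ry => /eqP; rewrite (negPf y0).
have lD : logd u setT (g *: psi1 - y *: psi2).
  move=> t _; case: (eqVneq t h) => [->|th]; last first.
    by apply: (logdB (D := D')); rewrite ?inE //; apply: logdZ.
  apply/(dividesE wh); rewrite vappB !vappZ rmorphB !rmorphM /= e1 e2 ry rg.
  by rewrite mulrCA subrr.
have [H eH] := theta_gen lD.
have [p ep] := theta_gen (logd_alphaZ l1).
have [q eq] := theta_gen (logd_alphaZ l2).
have rel i : g * p i - y * q i = alpha * H i.
  apply/eqP; rewrite -subr_eq0; apply/eqP; move: i.
  apply: (theta_free (a := fun i => g * p i - y * q i - alpha * H i)).
  rewrite sum_scaleBB -ep -eq -eH scaleBB_commute //; exact: mulrC.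
(* Regularity of the sequence: modulo [y], [g * p i] equals [alpha * H i] and alpha does not divide
   [g], so alpha divides [p i]; lifting the quotient places [H i] in the ideal (g, y). *)
have split i : exists ka : S * S, H i = g * ka.1 + y * ka.2.
  have := congr1 (proj w' x) (rel i).
  rewrite rmorphB !rmorphM /= (proj_self w'x) mul0r subr0 pa => e.
  have [k0 ek0] : divides alpha (proj w' x (p i)).
    have /(lf_prime hn0)[|] // : divides alpha (proj w' x g * proj w' x (p i)).
    by exists (proj w' x (H i)); rewrite e mulrC.
  have [p2 ep2] : divides y (p i - alpha * k0).
    apply/(dividesE w'x); rewrite rmorphB rmorphM /= pa.
    by rewrite -(proj_idem w'x (p i)) ek0 rmorphM /= pa mulrC subrr.
  have epi : p i = p2 * y + alpha * k0 by rewrite -ep2 subrK.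
  have [k2 ek2] : divides alpha (g * p2 - q i).
    have /(lf_prime hn0)[|] // : divides alpha (y * (g * p2 - q i)).
    exists (H i - g * k0); apply/eqP; rewrite -subr_eq0; apply/eqP.
    have := rel i; rewrite epi => /eqP; rewrite -subr_eq0 => /eqP <-; ring.
  exists (k0, k2); apply: (mulfI a0); rewrite /= -rel epi.
  have -> : q i = g * p2 - k2 * alpha by rewrite -ek2 subKr.
  ring.
have [ka eka] := fin_all_exists split.
(* The correction by elements of D(A) changes no value on alpha modulo alpha and makes
   [g *: psi1' = y *: psi2'] exact, so that [y] divides every coefficient of [psi1']. *)
pose psi1' := psi1 - \sum_i (ka i).1 *: theta i.
pose psi2' := psi2 + \sum_i (ka i).2 *: theta i.
have e12 : g *: psi1' = y *: psi2'.
  apply/eqP; rewrite -subr_eq0 /psi1' /psi2' scalerBr scalerDr opprD addrACA eH -opprD.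
  rewrite !scaler_sumr -big_split subr_eq0; apply/eqP/eq_bigr => i _ /=.
  by rewrite eka scalerDl !scalerA.
have d12 j : divides y (psi1' 0 j).
  have /(lf_prime x0)[//|//] : divides y (psi1' 0 j * g).
  exists (psi2' 0 j); have := congr1 (fun A : 'rV[S]_l => A 0 j) e12.
  by rewrite !mxE mulrC => ->; rewrite mulrC.
have [c ec] := fin_all_exists d12.
pose phi : 'rV[S]_l := \row_j c j.
have ephi : psi1' = y *: phi by apply/rowP => j; rewrite ec !mxE mulrC.
have ephi2 : psi2' = g *: phi.
  apply/rowP => j; apply: (mulfI y0).
  have := congr1 (fun A : 'rV[S]_l => A 0 j) e12; rewrite ephi => e.
  by move: e; rewrite !mxE => <-; rewrite mulrCA.
have la (a : 'I_l -> S) : logd u setT (\sum_i a i *: theta i).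
  by apply: logd_sum => i _; apply/logdZ/theta_log.
have l1' : logd u D' psi1' by apply: logdB => //; apply/logdS/la/subsetT.
have l2' : logd u D' psi2' by apply: logdD => //; apply/logdS/la/subsetT.
exists phi => [t tD|].
  (* If [lf (u t)] did not divide the value of [phi], it would divide both [y] and [g]; being then
     proportional to [y], it would make [y] divide [g]. *)
  have tn0 : u t != 0 by apply: ip.1.
  have := l1' t tD; rewrite ephi vappZ => /(lf_prime tn0)[ty|//].
  have := l2' t tD; rewrite ephi2 vappZ => /(lf_prime tn0)[tg|//].
  have [c' ec'] := lf_dvd_lf tn0 ty; case: yg.
  have c'0 : c' != 0 by apply: contraNneq x0 => c0; rewrite ec' c0 scale0r.
  apply: divides_trans tg; exists (c'^-1)%:MP.
  by rewrite mul_mpolyC /y ec' linearZ /= scalerA mulVf // scale1r.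
apply: (mulfI y0); rewrite -e1 -{1}ry -rmorphM /= -vappZ -ephi vappB rmorphB /=.
have /(dividesE wh) -> := la (fun i => (ka i).1) h (in_setT h).
by rewrite subr0.
Qed.

(** The witness is the product of all forms except those of [x] and [h], times the derivative in a
    direction tangent to [x] on which alpha is 1. For [x] in [R] its value is B times the forms of
    the other representatives. *)
Lemma psi_exists x : x != h -> exists2 psi, logd u D' psi &
  rho (vapp psi (u h)) = qpoly restr (D' :\ x).
Proof.
move=> xh; have [p [ph px]] : exists p, pairing p (u h) = 1 /\ pairing p (u x) = 0.
  by apply: dual_vector => [|c]; [apply: ip.1|apply: normal_nprop; rewrite eq_sym].
exists (qpoly u (D' :\ x) *: cder p) => [t tD|].
  rewrite vappZ vapp_cder; case: (eqVneq t x) => [->|tx].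
    by rewrite px mpolyC0 mulr0; apply: divides0.
  apply: dividesMr; rewrite /qpoly (bigD1 t) ?inE ?tx //=; last by rewrite !inE in tD *.
  by apply: dividesMr; apply: dividesxx.
by rewrite vappZ vapp_cder ph mpolyC1 mulr1 rho_qpoly.
Qed.

Lemma terao_poly_attained : exists2 phi, logd u D' phi & rho (vapp phi (u h)) = terao_poly.
Proof.
have Rh r : r \in R -> r != h by move/(subsetP RD); rewrite !inE.
(* The surplus factor [qpoly restr (R :\: Y)] is removed one representative at a time: [psi_exists]
   settles Y = {x}, and [saturation] joins the derivations found for Y minus x and for {x}. At Y = R
   the value is B. *)
suff main (Y : {set T}) : Y \subset R -> (0 < #|Y|)%N -> exists2 psi, logd u D' psi &
    rho (vapp psi (u h)) = terao_poly * qpoly restr (R :\: Y).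
  case: (posnP #|R|) => [R0|Rpos]; last first.
    have [psi lp ep] := main R (subxx _) Rpos; exists psi => //.
    by rewrite ep setDv /qpoly big_set0 mulr1.
  (* If [R] is empty, [h] is the only hyperplane and B = 1, which a constant derivation attains. *)
  have noD t : t \notin D'.
    apply/negP => tD; have [|r [rR _]] := coverR (t := t); first by rewrite !inE in tD.
    by move/eqP: R0; rewrite cards_eq0 => /eqP R0; rewrite R0 inE in rR.
  exists (cder w) => [t tD|]; first by rewrite (negPf (noD t)) in tD.
  rewrite vapp_cder wh mpolyC1 rmorph1 /terao_poly /qpoly big1 // => t.
  by rewrite inE (negPf (noD t)) andbF.
have [n] := ubnP #|Y|; elim: n Y => // n IH Y ltY sY Ypos.
have [x xY] : exists x, x \in Y by apply/card_gt0P.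
have xR := subsetP sY x xY; have xh := Rh x xR.
have [psi lpsi epsi] := psi_exists xh.
have qsplit (D1 D2 : {set T}) : D2 \subset D1 ->
    qpoly restr D1 = qpoly restr (D1 :\: D2) * qpoly restr D2.
  move=> s; rewrite /qpoly (bigID (mem D2)) /= mulrC; congr (_ * _); apply: eq_bigl => t.
    by rewrite inE andbC.
  by rewrite andb_idl // => /(subsetP s).
have epsi2 : rho (vapp psi (u h)) = terao_poly * qpoly restr (R :\ x).
  rewrite epsi (@qsplit _ (R :\ x)); last exact: setSD.
  congr (_ * _); rewrite /terao_poly; congr (qpoly _ _); apply/setP => t.
  by rewrite !inE; case: eqP => [->|_] //=; rewrite xR.
case: (posnP #|Y :\ x|) => [Y0|Yxpos].
  have -> : Y = [set x].
    by apply/esym/eqP; rewrite eqEcard sub1set xY cards1 (cardsD1 x) xY Y0.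
  by exists psi.
have sYx : Y :\ x \subset R by apply: subset_trans (subsetDl _ _) sY.
have ltYx : (#|Y :\ x| < n)%N by move: ltY; rewrite (cardsD1 x) xY.
have [psi1 l1 e1] := IH _ ltYx sYx Yxpos.
have [w' [w'x w'h]] : exists w', pairing w' (restr x) = 1 /\ pairing w' (u h) = 0.
  apply: dual_vector => [|c e]; first exact: alpha_neq0.
  have := pairing_restr x; rewrite e linearZ /= wh mulr1 => c0.
  by move: (restr_neq0 xh); rewrite e c0 scale0r eqxx.
apply: (saturation (x := restr x) (w' := w') (g := qpoly restr (Y :\ x)) (psi1 := psi1) (psi2 := psi)) => //.
- exact: pairing_restr.
- exact: rho_qpoly_restr.
- rewrite rmorph_prod /= => /(lf_prime_prod alpha_neq0)[t].
  rewrite !inE => /andP[tx tY]; rewrite proj_lf => /(lf_dvd_lf alpha_neq0)[c ec].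
  have tR := subsetP sY t tY.
  have c0 : c = 0.
    have := congr1 (pairing w) ec.
    by rewrite raddfB /= !linearZ /= !pairing_restr mulr0 subrr wh mulr1.
  move/eqP: ec; rewrite c0 scale0r subr_eq0 => /eqP /(ipR.2 _ _ _ xR tR) e.
  by rewrite e eqxx in tx.
- rewrite e1 (@qsplit (R :\: (Y :\ x)) [set x]); last by rewrite sub1set !inE eqxx.
  rewrite mulrA mulrC {1}/qpoly big_set1; congr (_ * (_ * _)); congr (qpoly _ _).
  by apply/setP => t; rewrite !inE; case: eqP => // ->; rewrite xY.
rewrite epsi2 (@qsplit (R :\ x) (Y :\ x)); last exact: setSD.
rewrite mulrA mulrC; congr (_ * (_ * qpoly _ _)).
by apply/setP => t; rewrite !inE; case: (eqVneq t x) => [->|_] //=; rewrite xY.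
Qed.

Lemma terao_poly_attained_homog : exists phi, [/\ logd u D' phi,
  der_homog #|D' :\: R| phi & rho (vapp phi (u h)) = terao_poly].
Proof.
have [phi lp ep] := terao_poly_attained.
exists (hcomp #|D' :\: R| phi); split; [exact: hcomp_log|exact: hcomp_homog|].
have : divides alpha (vapp phi (u h) - terao_poly).
  by apply/(dividesE wh); rewrite rmorphB /= ep rho_qpoly_restr subrr.
move/(divides_pihomog #|D' :\: R|)/(dividesE wh); rewrite !raddfB /=.
rewrite (pihomog_dE terao_poly_homog) -vapp_hcomp rho_qpoly_restr.
by move/subr0_eq.
Qed.

End Deletion.

(** * Whitney's formula *)

Section Normals.
Context {K : fieldType} {l : nat}.
Implicit Types (v : 'cV[K]_l) (x : 'rV[K]_l) (L X : {vspace 'rV[K]_l}).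

Lemma pairing_lin c x y v : pairing (c *: x + y) v = c * pairing x v + pairing y v.
Proof. by rewrite /pairing mulmxDl -scalemxAl !mxE. Qed.

Lemma pairing_delta j v : pairing (delta_mx 0 j) v = v j 0.
Proof. by rewrite /pairing -rowE mxE. Qed.

Lemma same_kernel_prop v v' : v != 0 ->
  (forall x, pairing x v = 0 -> pairing x v' = 0) -> exists c, v' = c *: v.
Proof.
move=> /pairing_exists[x0 x0v] ker; exists (pairing x0 v').
apply/matrixP => j i; rewrite ord1 mxE -!pairing_delta {i}; set x := delta_mx 0 j.
have := ker (- pairing x v *: x0 + x); rewrite !pairing_lin x0v mulr1 addNr => /(_ erefl).
by move/eqP; rewrite mulNr addrC subr_eq0 => /eqP ->; rewrite mulrC.
Qed.

(** The space is projected along L onto a complementary line; a coordinate that does not vanish on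
    that line turns the projection into a form with kernel L. *)
Lemma hyperplane_normal L : (\dim L).+1 = l ->
  exists v, v != 0 /\ forall x, (x \in L) = (pairing x v == 0).
Proof.
move=> dimL; have nfull : L != fullv.
  apply/eqP => e; move: dimL; rewrite e dimvf /dim /= mul1n => e2.
  by have := ltnn l; rewrite -{2}e2 ltnSn.
have dimC : \dim (L^C) = 1%N.
  by rewrite dimv_compl dimvf /dim /= mul1n; move: dimL; lia.
pose p := daddv_pi L^C L; have capL : (L^C :&: L = 0)%VS by rewrite capvC capv_compl.
have pL x : (x \in L) = (p x == 0).
  have e : p x + daddv_pi L L^C x = x.
    by apply: daddv_pi_add => //; rewrite addvC addv_complf memvf.
  apply/idP/eqP => [xL|p0]; last by rewrite -e p0 add0r memv_pi.
  have e2 : daddv_pi L L^C x = x by apply: daddv_pi_id xL; apply: capv_compl.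
  by rewrite e2 in e; rewrite (canRL (addrK x) e) subrr.
have [b bn0 bE] : exists2 b, b != 0 & forall y, y \in L^C%VS -> exists c, y = c *: b.
  exists (vpick L^C); first by rewrite vpick0 -dimv_eq0 dimC.
  move=> y yC; suff /vlineP : y \in <[vpick L^C]>%VS by [].
  suff -> : (<[vpick L^C]> = L^C)%VS by [].
  apply/eqP; rewrite eqEdim -memvE memv_pick dim_vline dimC.
  by rewrite vpick0 -dimv_eq0 dimC.
have [j bj] : exists j, b 0 j != 0.
  apply/existsP; apply: contraNT bn0; rewrite negb_exists => /forallP h.
  by apply/eqP/rowP=> j; rewrite mxE; apply/eqP; move: (h j); rewrite negbK.
pose v : 'cV[K]_l := \col_i p (delta_mx 0 i) 0 j.
have pv x : pairing x v = p x 0 j.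
  rewrite /pairing mxE {2}[x]row_sum_delta linear_sum summxE.
  by apply: eq_bigr => i _; rewrite linearZ !mxE.
have pv0 x : (x \in L) = (pairing x v == 0).
  rewrite pL pv; apply/eqP/eqP => [->|]; first by rewrite mxE.
  have [c ->] := bE _ (memv_pi L^C L x); rewrite mxE => /eqP.
  by rewrite mulf_eq0 (negPf bj) orbF => /eqP ->; rewrite scale0r.
exists v; split=> //; apply: contraNneq nfull => v0; apply/eqP/vspaceP => x.
by rewrite memvf pv0 v0 raddf0 eqxx.
Qed.

Lemma memv_bigcap_seq x (r : seq {vspace 'rV[K]_l}) :
  (x \in \bigcap_(L <- r) L)%VS = all (fun L => x \in L) r.
Proof.
elim: r => [|L r IH]; first by rewrite big_nil memvf.
by rewrite big_cons memv_cap IH.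
Qed.

Lemma dim_rowspace m (G : 'M[K]_(m, l)) X : row_free G ->
  (forall x, (x \in X) = (x <= G)%MS) -> \dim X = m.
Proof.
move=> fG hX; pose f : 'Hom('rV[K]_m, 'rV[K]_l) := linfun (mulmxr G).
have -> : X = (f @: fullv)%VS.
  apply/vspaceP => x; rewrite hX; apply/submxP/memv_imgP.
    by move=> [y ->]; exists y; rewrite ?memvf // lfunE.
  by move=> [y _ ->]; exists y; rewrite lfunE.
rewrite limg_dim_eq ?dimvf /dim /= ?mul1n //; apply/eqP; rewrite -subv0.
apply/subvP => y; rewrite capfv memv_ker memv0 lfunE /= => /eqP e.
by apply/eqP; apply: (row_free_inj fG); rewrite e mul0mx.
Qed.

End Normals.

Section SelectedNormals.
Context {K : fieldType} {l : nat} {T : finType}.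
Variable u : T -> 'cV[K]_l.

(** Columns outside [B] are zeroed rather than deleted, so that the size of the matrix does not
    depend on [B]; its left kernel is the flat of [B]. *)
Definition selmx (B : {set T}) : 'M[K]_(l, #|T|) :=
  \matrix_(j, i) (if enum_val i \in B then u (enum_val i) j 0 else 0).

Lemma selmx_ker B x : (x *m selmx B == 0) = [forall t in B, pairing x (u t) == 0].
Proof.
have E i : (x *m selmx B) 0 i = if enum_val i \in B then pairing x (u (enum_val i)) else 0.
  have -> : (x *m selmx B) 0 i = pairing x (col i (selmx B)) by rewrite /pairing colE mulmxA -colE [RHS]mxE.
  have -> : col i (selmx B) = if enum_val i \in B then u (enum_val i) else 0.
    by apply/matrixP => a b; rewrite ord1 !mxE; case: ifP => // _; rewrite mxE.
  by case: ifP => // _; rewrite raddf0.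
apply/eqP/forall_inP => [e t tB|h].
  by have := E (enum_rank t); rewrite e mxE enum_rankK tB => <-.
by apply/rowP => i; rewrite E mxE; case: ifP => // /h /eqP.
Qed.

End SelectedNormals.

(** * Arrangements as families of linear forms *)

Section Bridge.
Context {K : fieldType} {l : nat}.
Local Notation S := {mpoly K[l]}.
Variable A : subspaces K l.
Variable u : A -> 'cV[K]_l.
Hypothesis un0 : forall t, u t != 0.
Hypothesis ker_u : forall (t : A) x, (x \in val t) = (pairing x (u t) == 0).

Lemma normals_independent : independent_pairs u setT.
Proof.
split=> [t _|t t' c _ _ e]; first exact: un0.
apply: val_inj; apply/vspaceP => x; rewrite !ker_u e linearZ /= mulf_eq0.
suff -> : c == 0 = false by [].
by apply/negbTE; apply: contraNneq (un0 t') => c0; rewrite e c0 scale0r.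
Qed.

Lemma defining_form_lf t : defining_form (lf (u t)) (val t).
Proof. by split; [exact: lf_homog|move=> x; rewrite lf_eval ker_u]. Qed.

Lemma defining_form_uniq t alpha : defining_form alpha (val t) ->
  exists2 c, c != 0 & lf (u t) = c *: alpha.
Proof.
move=> [ha ka]; rewrite (homog1_lf ha) in ka *; set v := \col_j _ in ka *.
have kv x : (pairing x v == 0) = (pairing x (u t) == 0).
  by rewrite -ker_u ka lf_eval.
have vn0 : v != 0.
  apply: contraNneq (un0 t) => v0; apply/eqP/matrixP => i j.
  rewrite ord1 -pairing_delta [RHS]mxE; apply/eqP.
  by rewrite -kv v0 raddf0.
have [|c ec] := @same_kernel_prop _ _ v (u t) vn0.
  by move=> x /eqP; rewrite kv => /eqP.
exists c; last by rewrite ec linearZ.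
by apply: contraNneq (un0 t) => c0; rewrite ec c0 scale0r.
Qed.

Lemma log_derE (B : subspaces K l) (D : {set A}) theta :
  (forall L, L \in B <-> exists2 t, t \in D & L = val t) ->
  log_der B theta <-> logd u D theta.
Proof.
move=> hB; split=> [lt t tD|lt L /hB[t tD ->] alpha /defining_form_uniq[c c0 ec]].
  have [|g eg] := lt (val t) _ _ (defining_form_lf t); first by apply/hB; exists t.
  by exists g; rewrite -eg der_app_lf.
have -> : alpha = lf (c^-1 *: u t) by rewrite linearZ /= ec scalerA mulVf // scale1r.
have [g eg] := lt t tD; exists g; rewrite der_app_lf linearZ /=.
have := vapp_comb theta c^-1 (u t) 0; rewrite addr0 => ->.
by rewrite {2}/vapp big1 ?addr0 ?eg ?scalerAr // => j _; rewrite mxE scale0r.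
Qed.

Lemma log_der_setT theta : log_der A theta <-> logd u setT theta.
Proof.
apply: log_derE => L; split=> [LA|[t _ ->]]; last exact: valP.
by exists [` LA]%fset.
Qed.

Lemma log_der_setC1 (h : A) theta :
  log_der (A `\ val h)%fset theta <-> logd u [set~ h] theta.
Proof.
apply: log_derE => L; rewrite !inE; split=> [/andP[nL LA]|[t + ->]].
  by exists [` LA]%fset => //; rewrite !inE -val_eqE.
by rewrite !inE -val_eqE => ->; apply: valP.
Qed.

Definition flat (B : {set A}) : {vspace 'rV[K]_l} := (\bigcap_(t in B) val t)%VS.

Lemma mem_flat B x : (x \in flat B) = [forall t in B, pairing x (u t) == 0].
Proof.
rewrite memvE; apply/subv_bigcapP/forall_inP => h t tB.
  by rewrite -ker_u memvE h.
by rewrite -memvE ker_u h.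
Qed.

Lemma dim_flat B : \dim (flat B) = (l - \rank (selmx u B))%N.
Proof.
rewrite -mxrank_ker; apply: (dim_rowspace (G := row_base (kermx (selmx u B)))).
  exact: row_base_free.
by move=> x; rewrite eq_row_base mem_flat -selmx_ker; apply/eqP/sub_kermxP.
Qed.

Lemma lattice_flat X : X \in intersection_lattice A <-> exists B, X = flat B.
Proof.
have flatE (C : subspaces K l) (B : {set A}) :
    (forall L, L \in C <-> exists2 t, t \in B & L = val t) ->
    (\bigcap_(L <- C) L)%VS = flat B.
  move=> hC; apply/vspaceP => x; rewrite memv_bigcap_seq mem_flat.
  apply/allP/forall_inP => h L; first by move=> LB; rewrite -ker_u; apply/h/hC; exists L.
  by move=> /hC[t tB ->]; rewrite ker_u h.
split=> [/imfsetP[C /= ] | [B ->]].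
  rewrite fpowersetE => /fsubsetP CA ->; exists [set t : A | val t \in C].
  apply: flatE => L; split=> [LC|[t]]; last by rewrite inE => tC ->.
  by exists [` CA _ LC]%fset; rewrite ?inE.
apply/imfsetP; exists [fset val t | t in B]%fset => /=.
  by rewrite fpowersetE; apply/fsubsetP => L /imfsetP[t _ ->]; apply: valP.
apply/esym/flatE => L; split=> [/imfsetP[t tB ->]|[t tB ->]]; first by exists t.
by apply/imfsetP; exists t.
Qed.

Lemma val_nfull (t : A) : val t != fullv.
Proof.
apply: contraNneq (un0 t) => e; apply/eqP/matrixP => i j.
by rewrite ord1 -pairing_delta [RHS]mxE; apply/eqP; rewrite -ker_u e memvf.
Qed.

Lemma subv_flat X (B : {set A}) : (X <= flat B)%VS = (B \subset [set t : A | (X <= val t)%VS]).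
Proof.
apply/subv_bigcapP/subsetP => h t tB; first by rewrite inE h.
by have := h t tB; rewrite inE.
Qed.

Lemma flat_set0 : flat set0 = fullv.
Proof. by rewrite /flat big_set0. Qed.

Lemma flat_eq_full B : (flat B == fullv) = (B == set0).
Proof.
apply/eqP/eqP => [e|->]; last exact: flat_set0.
apply/eqP/set0Pn => -[t tB]; move: (val_nfull t); apply/negP; rewrite negbK.
by rewrite eqEsubv subvf -e; apply: (bigcapv_inf t).
Qed.

End Bridge.

(** Adding or removing one fixed element of [E] pairs subsets of opposite sign. *)
Lemma alternating_subsets (T : finType) (R : pzRingType) (E : {set T}) : E != set0 ->
  \sum_(B : {set T} | B \subset E) (-1) ^+ #|B| = 0 :> R.
Proof.
move=> /set0Pn[t tE]; rewrite (bigID (fun B : {set T} => t \in B)) /=.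
rewrite (reindex_onto (fun B => t |: B) (fun B => B :\ t)) /=; last first.
  by move=> B /andP[_ tB]; rewrite setD1K.
rewrite -[RHS](subrr (\sum_(B : {set T} | (B \subset E) && (t \notin B)) (-1) ^+ #|B|)).
rewrite [RHS]addrC; congr (_ + _); rewrite -sumrN.
apply: congr_big => // [B|B /andP[_ tB]].
  rewrite setU11 andbT subUset sub1set tE /=; congr (_ && _).
  apply/eqP/idP => [<-|tB]; first by rewrite !inE eqxx.
  by rewrite setU1K.
have -> : #|t |: B| = #|B|.+1 by rewrite cardsU1 -(eqP tB) !inE eqxx.
by rewrite exprS mulN1r.
Qed.

Section Whitney.
Context {K : fieldType} {l : nat}.
Variable A : subspaces K l.
Variable u : A -> 'cV[K]_l.
Hypothesis un0 : forall t, u t != 0.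
Hypothesis ker_u : forall (t : A) x, (x \in val t) = (pairing x (u t) == 0).

Local Notation flat := (@flat K l A).

Lemma lattice_sum (R : nmodType) (P : pred {vspace 'rV[K]_l})
    (F : {vspace 'rV[K]_l} -> {set A} -> R) :
  \sum_(X <- intersection_lattice A | P X) \sum_(B : {set A} | flat B == X) F X B =
  \sum_(B : {set A} | P (flat B)) F (flat B) B.
Proof.
rewrite (exchange_big_dep predT) //= [RHS]big_mkcond /=; apply: eq_bigr => B _.
have fB : flat B \in intersection_lattice A.
  by apply/(lattice_flat ker_u); exists B.
rewrite big_mkcond /= (big_rem _ fB) /= eqxx andbT big1_seq ?addr0 //= => X Xr.
case: (eqVneq (flat B) X) => [e|_]; last by rewrite andbF.
by move: Xr; rewrite -e mem_rem_uniq ?fset_uniq // !inE eqxx.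
Qed.

(** Both sides satisfy the Moebius recursion: the [B] with X contained in [flat B] are all the
    subsets of the set of hyperplanes through X, which is nonempty for X proper, so their signs
    cancel. The induction is on the codimension of X. *)
Lemma mobius_flats X : X \in intersection_lattice A ->
  mobius A X = \sum_(B : {set A} | flat B == X) (-1) ^+ #|B|.
Proof.
have [n] := ubnP (l - \dim X)%N; elim: n X => // n IH X ltX XL.
case: (eqVneq X fullv) => [->|Xn].
  rewrite mobius_full (eq_bigl (pred1 set0)) ?big_pred1_eq ?cards0 // => B.
  exact: flat_eq_full ker_u _.
rewrite mobius_rec // big_seq_cond.
rewrite (eq_bigr (fun Y => \sum_(B : {set A} | flat B == Y) (-1) ^+ #|B|)); last first.
  move=> Y /andP[YL /propersubv_dim/andP[d1 d2]]; apply: IH => //.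
  by rewrite (leq_trans _ (ltnSE ltX)) // ltn_sub2l // (leq_trans d1).
rewrite -big_seq_cond lattice_sum /=.
have [B0 eB0] := (lattice_flat ker_u X).1 XL.
have : \sum_(B : {set A} | (X <= flat B)%VS) (-1) ^+ #|B| = 0 :> int.
  under eq_bigl => B do rewrite subv_flat.
  apply: alternating_subsets; apply: contraNneq Xn => e.
  rewrite eB0 (flat_eq_full un0 ker_u) -subset0 -e.
  by rewrite -subv_flat eB0 subvv.
rewrite (bigID (fun B => flat B == X)) /= => /eqP; rewrite addr_eq0 => /eqP e.
rewrite -[LHS]opprK opprK; transitivity (- \sum_(B : {set A} | (X <= flat B)%VS && (flat B != X)) (-1) ^+ #|B| : int).
  by congr (- _); apply: eq_bigl => B; rewrite /propersubv [X == _]eq_sym.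
rewrite -e; apply: eq_bigl => B; case: eqP => [->|]; rewrite ?subvv ?andbF //.
Qed.

Lemma whitney : arr_char_poly A =
  \sum_(B : {set A}) ((-1) ^+ #|B|)%:P * 'X^(l - \rank (selmx u B)).
Proof.
rewrite /arr_char_poly big_seq.
rewrite (eq_bigr (fun X => \sum_(B : {set A} | flat B == X) ((-1) ^+ #|B|)%:P * 'X^(\dim X))).
  rewrite -big_seq (lattice_sum predT (fun X B => ((-1) ^+ #|B|)%:P * 'X^(\dim X))).
  by apply: eq_bigr => B _; rewrite (dim_flat ker_u).
by move=> X XL; rewrite mobius_flats // raddf_sum mulr_suml.
Qed.

End Whitney.

(** * Counting monomials by weight *)

(** Bernoulli's inequality (1 + 1/n)^n >= 2, cleared of denominators; the auxiliary claim is used at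
    k = n. *)
Lemma expn_succ_ge (n : nat) : (0 < n)%N -> (2 * n ^ n <= n.+1 ^ n)%N.
Proof.
move=> n0; have h k : ((n + k) * n ^ k <= n * n.+1 ^ k)%N.
  elim: k => [|k IH]; first by rewrite !expn0 addn0.
  rewrite !expnS; move: IH; move: (n ^ k)%N (n.+1 ^ k)%N => x y; nia.
by have := h n; rewrite addnn -mul2n mulnAC mulnC leq_pmul2l.
Qed.

(** Each step of length [c] multiplies [f] by at least 1 + 1/E, so E steps at least double it,
    against the polynomial bound. *)
Lemma no_exponential_growth (f : nat -> nat) (E c l : nat) :
  (0 < f 0)%N -> (forall n, f n <= n.+1 ^ l)%N ->
  (forall n, E.+1 * f n <= E * f (n + c))%N -> False.
Proof.
move=> f0 fpoly fgrow.
have Epos : (0 < E)%N.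
  by case: E fgrow => // /(_ 0); rewrite mul0n leqn0 muln_eq0 /= => /eqP f00; rewrite f00 in f0.
have iter k : (E.+1 ^ k <= E ^ k * f (k * c))%N.
  elim: k => [|k IH]; first by rewrite !expn0 mul1n.
  rewrite [(k.+1 * c)%N]mulSn [(c + _)%N]addnC expnS.
  apply: leq_trans (leq_mul (leqnn _) IH) _.
  by rewrite mulnCA expnS [(E * _)%N]mulnC -[X in (_ <= X)%N]mulnA leq_mul2l fgrow orbT.
have bound m : (2 ^ m <= (E * m * c).+1 ^ l)%N.
  have h : (2 ^ m * E ^ (E * m) <= E.+1 ^ (E * m))%N.
    by case: m => [|m]; rewrite ?muln0 // !expnM -expnMn leq_exp2r // expn_succ_ge.
  have := leq_trans h (iter (E * m)%N).
  rewrite mulnC leq_pmul2l ?expn_gt0 ?Epos // => h2.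
  exact: leq_trans h2 (fpoly _).
(* At m = 2^j the bound would give 2^(2^j) <= 2^((B + j + 1) l). The choice of [i] makes both B + j
   + 1 <= 2^i and l < 2^i, so that (B + j + 1) l < 2^j. *)
set B := (E * c)%N; pose i := (B + l + 4)%N; pose j := (i + i)%N.
have pow n : (n < 2 ^ n)%N by apply: ltn_expl.
have pow3 n : (4 <= n)%N -> (3 * n < 2 ^ n)%N.
  elim: n => // n IH; rewrite leq_eqVlt => /orP[/eqP <- //|].
  by rewrite ltnS => h; have := IH h; rewrite expnS; lia.
have := bound (2 ^ j)%N; apply/negP; rewrite -ltnNge.
have h1 : ((E * 2 ^ j * c).+1 <= 2 ^ (B + j + 1))%N.
  have -> : (E * 2 ^ j * c = B * 2 ^ j)%N by rewrite mulnAC.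
  rewrite -addnA expnD; have := pow B; have := pow j; rewrite addn1 expnS.
  move: (2 ^ j)%N (2 ^ B)%N => x y; nia.
case: (posnP l) => [->|lpos].
  by rewrite expn0; apply: leq_ltn_trans (pow _); rewrite expn_gt0.
apply: (@leq_ltn_trans ((2 ^ (B + j + 1)) ^ l)%N).
  by rewrite leq_exp2r.
rewrite -expnM ltn_exp2l //.
have := pow3 i (leq_addl _ _); have := pow i.
rewrite /j expnD; set x := (2 ^ i)%N => h2 h3.
have h4 : (B + (i + i) + 1 <= x)%N by move: h3; rewrite /i; lia.
have h5 : (l < x)%N by move: h2; rewrite /i; lia.
nia.
Qed.

Section WeightedCount.
Variables (l : nat) (E : 'I_l -> nat).
Hypothesis Epos : forall i, (0 < E i)%N.

(** The degree of the monomial [a] when the i-th variable has degree [E i]; it will bound the degree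
    of the product of the powers of the [g i]. *)
Definition wt (a : 'X_{1..l}) : nat := (\sum_i a i * E i)%N.

Lemma wtD a b : wt (a + b)%MM = (wt a + wt b)%N.
Proof. by rewrite /wt -big_split; apply: eq_bigr => i _; rewrite mnmDE mulnDl. Qed.

Lemma wt0 : wt 0%MM = 0%N.
Proof. by rewrite /wt big1 // => i _; rewrite mnm0E. Qed.

Lemma wt1 i : wt U_(i)%MM = E i.
Proof.
rewrite /wt (bigD1 i) //= mnm1E eqxx mul1n big1 ?addn0 // => j nj.
by rewrite mnm1E eq_sym (negPf nj).
Qed.

Lemma mdeg_le_wt a : (mdeg a <= wt a)%N.
Proof. by rewrite mdegE; apply: leq_sum => i _; rewrite leq_pmulr. Qed.

Definition nmon (n : nat) : nat := #|{: 'X_{1..l < n.+1}}|.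
Definition wset (n : nat) : {set 'X_{1..l < n.+1}} := [set a : 'X_{1..l < n.+1} | (wt a <= n)%N].
Definition nwt (n : nat) : nat := #|wset n|.

Lemma nwt_gt0 n : (0 < nwt n)%N.
Proof. by apply/card_gt0P; exists bm0; rewrite inE /= wt0. Qed.

Lemma nwt_poly n : (nwt n <= n.+1 ^ l)%N.
Proof.
pose f (a : 'X_{1..l < n.+1}) : {ffun 'I_l -> 'I_n.+1} := [ffun i => inord (a i)].
have ale (a : 'X_{1..l < n.+1}) i : (a i < n.+1)%N.
  by apply: leq_ltn_trans (bmdeg a); rewrite mdegE (bigD1 i) //= leq_addr.
have finj : injective f.
  move=> a b /ffunP e; apply/val_inj/mnmP => i.
  by have := congr1 val (e i); rewrite !ffunE /= !inordK.
rewrite /nwt -(card_imset _ finj); apply: leq_trans (max_card _) _.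
by rewrite card_ffun !card_ord.
Qed.

Lemma bmnm_card (I : finType) (P : {set I}) (n : nat) (h : I -> 'X_{1..l}) :
  {in P &, injective h} -> (forall i, i \in P -> mdeg (h i) < n.+1)%N -> (#|P| <= nmon n)%N.
Proof.
move=> hinj hlt; pose k i : 'X_{1..l < n.+1} := insubd bm0 (h i).
have kE i : i \in P -> val (k i) = h i by move=> Pi; rewrite val_insubd hlt.
rewrite -(@card_in_imset _ _ k (mem P)) ?max_card // => i j Pi Pj e.
by apply: hinj => //; rewrite -!kE // e.
Qed.

Lemma nwt_mono m n : (m <= n)%N -> (nwt m <= nwt n)%N.
Proof.
move=> le_mn; pose k (a : 'X_{1..l < m.+1}) : 'X_{1..l < n.+1} := insubd bm0 (val a).
have kE a : val (k a) = val a.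
  by rewrite val_insubd (leq_trans (bmdeg a)).
have kinj : injective k by move=> a b e; apply: val_inj; rewrite -!kE e.
rewrite /nwt -(card_imset _ kinj); apply: subset_leq_card.
apply/subsetP => _ /imsetP[a ha ->]; rewrite !inE kE in ha *.
exact: leq_trans ha _.
Qed.

(** Coordinatewise division by [E] turns an exponent vector into a quotient and one of \prod E i
    families of remainders. Up to a shift of the bound, degree at most n thus counts \prod E i times
    as many vectors as weight at most n. *)
Let rems := {dffun forall i : 'I_l, 'I_(E i)}.

Lemma card_rems : #|{: rems}| = (\prod_i E i)%N.
Proof.
rewrite card_dep_ffun foldrE big_map enumT; apply: eq_bigr => i _.
by rewrite card_ord.
Qed.

Definition recompose (a : 'X_{1..l}) (r : rems) : 'X_{1..l} :=
  [multinom (a i * E i + r i)%N | i < l].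

Lemma recompose_inj a b r r' : recompose a r = recompose b r' -> a = b /\ r = r'.
Proof.
move=> /mnmP e; have h i : a i = b i /\ r i = r' i.
  have := e i; rewrite !mnmE => e1.
  have e2 : a i = b i.
    have := congr1 (fun k => k %/ E i)%N e1.
    by rewrite !divnMDl // !divn_small // !addn0.
  by split=> //; apply: val_inj; move: e1; rewrite e2 => /addnI.
split; first by apply/mnmP => i; case: (h i).
by apply/ffunP => i; case: (h i).
Qed.

Lemma wt_recompose a r : (wt a <= mdeg (recompose a r) <= wt a + \sum_i E i)%N.
Proof.
rewrite /wt mdegE -big_split /=; apply/andP; split; apply: leq_sum => i _.
  by rewrite mnmE leq_addr.
by rewrite mnmE leq_add2l ltnW.
Qed.

Lemma nmon_ge n : ((\prod_i E i) * nwt n <= nmon (n + \sum_i E i))%N.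
Proof.
rewrite mulnC -card_rems -cardsT /nwt -cardsX.
apply: (@bmnm_card _ _ _ (fun x => recompose (val x.1) x.2)) => [[a r] [b r'] _ _ /=|[a r]].
  by move=> /recompose_inj[/val_inj -> ->].
rewrite !inE /= => /andP[ha _]; rewrite ltnS.
by have /andP[_] := wt_recompose (val a) r; move/leq_trans; apply; rewrite leq_add2r.
Qed.

Lemma nmon_le n : (nmon n <= (\prod_i E i) * nwt n)%N.
Proof.
pose q (m : 'X_{1..l < n.+1}) : 'X_{1..l} := [multinom (val m i %/ E i)%N | i < l].
pose r (m : 'X_{1..l < n.+1}) : rems :=
  [ffun i => Ordinal (ltn_pmod (val m i) (Epos i))].
have E1 m : recompose (q m) (r m) = val m.
  by apply/mnmP => i; rewrite !mnmE ffunE /= -divn_eq.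
have qwt m : (wt (q m) <= n)%N.
  have /andP[h _] := wt_recompose (q m) (r m).
  by rewrite (leq_trans h) // E1 -ltnS bmdeg.
pose k m : 'X_{1..l < n.+1} * rems := (insubd bm0 (q m), r m).
have kE m : val (k m).1 = q m.
  by rewrite val_insubd ltnS (leq_trans (mdeg_le_wt _) (qwt m)).
have kinj : injective k.
  by move=> m m' e; apply: val_inj; rewrite -!E1 -!kE e; congr recompose; case: e.
rewrite mulnC -card_rems -cardsT /nwt -cardsX /nmon -(card_imset _ kinj).
apply: subset_leq_card; apply/subsetP => _ /imsetP[m _ ->].
by rewrite !inE kE qwt.
Qed.

(* Two weighted counts with a bounded shift are asymptotically equal, so the
   leading constants compare. *)
Lemma nwt_upper (N c : nat) :
  (forall n, N * nwt n <= nmon (n + c))%N -> (N <= \prod_i E i)%N.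
Proof.
move=> h; rewrite leqNgt; apply/negP => lt.
apply: (@no_exponential_growth nwt (\prod_i E i) c l (nwt_gt0 0) nwt_poly) => n.
apply: leq_trans (nmon_le _); apply: leq_trans (h n).
by rewrite leq_mul2r lt orbT.
Qed.

Lemma nwt_lower (N C c : nat) :
  (forall n, nmon (n + c) <= N * nwt (n + c) + C * (nwt (n + c) - nwt n))%N ->
  (\prod_i E i <= N)%N.
Proof.
move=> h; rewrite leqNgt; apply/negP => lt; set P := (\prod_i E i)%N in lt *.
pose m := (\sum_i E i + c)%N.
(* With N < P the estimates combine to (P + C) nwt(n) <= (N + C) nwt(n + m) <= (P + C - 1) nwt(n +
   m), which is the excluded growth. *)
apply: (@no_exponential_growth nwt (P + C).-1 m l (nwt_gt0 0) nwt_poly) => n.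
have h1 := nmon_ge n; have h2 := h (n + \sum_i E i)%N.
have h3 : (nmon (n + \sum_i E i) <= nmon (n + m))%N.
  rewrite {1}/nmon -cardsT; apply: (@bmnm_card _ _ _ val) => [a b _ _ /val_inj //|a _].
  apply: leq_trans (bmdeg a) _; by rewrite ltnS leq_add2l leq_addr.
have h4 : (nwt n <= nwt (n + \sum_i E i))%N by apply/nwt_mono/leq_addr.
have h5 : (nwt n <= nwt (n + m))%N by apply/nwt_mono/leq_addr.
rewrite /m addnA in h3 h5 *; rewrite -/P in h1.
move: (nwt (n + _ + c)) (nwt n) (nwt (n + _)) (nmon (n + _)) (nmon (n + _ + c)) h1 h2 h3 h4 h5.
move=> x y z a b h1 h2 h3 h4 h5.
have [P' eP] : exists P', (P + C = P'.+1)%N by exists (P + C).-1; lia.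
rewrite eP /=.
have h6 : (P * y <= N * x + C * (x - y))%N.
  apply: leq_trans (leq_trans h1 h3) (leq_trans h2 _).
  by rewrite leq_add2l leq_mul2l leq_sub2l ?orbT.
rewrite mulnBr in h6.
have h7 : (C * y <= C * x)%N by rewrite leq_mul2l h5 orbT.
have h8 : (N.+1 * x <= P * x)%N by rewrite leq_mul2r lt orbT.
have : (P'.+1 * y = P * y + C * y)%N by rewrite -eP mulnDl.
have : (P'.+1 * x = P * x + C * x)%N by rewrite -eP mulnDl.
move: h6 h7 h8; rewrite !mulSn; lia.
Qed.

End WeightedCount.

(** * Zeros of a system of Bezout type over a finite field *)

Lemma msizeM_leq (R : idomainType) n (p1 p2 : {mpoly R[n]}) :
  (msize (p1 * p2) <= (msize p1 + msize p2).-1)%N.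
Proof.
have [->|n1] := eqVneq p1 0; first by rewrite mul0r msize0.
have [->|n2] := eqVneq p2 0; first by rewrite mulr0 msize0.
by rewrite msizeM.
Qed.

Section FiniteBezout.
Variables (F : finFieldType) (l : nat).
Local Notation S := {mpoly F[l]}.
Local Notation q := #|{: F}|.
(** To be applied with [E i] = q - e_i, [Theta] the coefficient matrix of a basis of D(A), and [g]
    the coefficients of the Frobenius minus the Euler derivation in that basis. *)
Variables (E : 'I_l -> nat) (Theta : 'M[S]_l) (g : 'I_l -> S).
Hypothesis Epos : forall i, (0 < E i)%N.
Hypothesis Elt : forall i, (E i <= q)%N.
Hypothesis Theta_deg : forall i j, (msize (Theta i j) <= (q - E i).+1)%N.
Hypothesis g_deg : forall i, (msize (g i) <= (E i).+1)%N.
Hypothesis g_eq : forall j, \sum_i g i * Theta i j = 'X_j ^+ q - 'X_j.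

Implicit Types (v : {ffun 'I_l -> F}) (f : S).

Let Theta_at v : 'M[F]_l := map_mx (meval v) Theta.
Let U : {set {ffun 'I_l -> F}} := [set v : {ffun 'I_l -> F} | \det (Theta_at v) != 0].

Lemma mmap_rmorph (R1 R2 R3 : comNzRingType) n (phi : {rmorphism R2 -> R3})
    (f : R1 -> R2) (h : 'I_n -> R2) (p : {mpoly R1[n]}) :
  phi (mmap f h p) = mmap (phi \o f) (phi \o h) p.
Proof.
rewrite /mmap rmorph_sum /=; apply: eq_bigr => m _; rewrite rmorphM; congr (_ * _).
by rewrite /mmap1 rmorph_prod; apply: eq_bigr => i _; rewrite rmorphXn.
Qed.

Lemma frobenius_add (R : comNzRingType) (phi : {rmorphism F -> R}) (x y : R) :
  (x + y) ^+ q = x ^+ q + y ^+ q.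
Proof.
have [p pp pF] := finPcharP F; have pR := rmorph_pchar phi pF.
apply: exprDn_pchar; rewrite (eq_pnat _ (pcharf_eq pR)).
by have := abelem_pgroup (fin_ring_pchar_abelem pF); rewrite /pgroup cardsT.
Qed.

Let q_gt1 : (1 < q)%N. Proof. exact: finNzRing_gt1. Qed.

(* The Taylor expansion x = v + t x' along the lines through v. *)
Definition taylor v : S -> {poly S} :=
  mmap (polyC \o mpolyC l (R := F)) (fun j => (v j)%:MP%:P + 'X_j *: 'X).
HB.instance Definition _ v := GRing.RMorphism.on (taylor v).

Lemma taylorX v j : taylor v 'X_j = (v j)%:MP%:P + 'X_j *: 'X.
Proof. by rewrite /taylor mmapX mmap1U. Qed.

Lemma taylor0 v f : (taylor v f).[0] = (f.@[v])%:MP.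
Proof.
rewrite -horner_evalE /taylor mmap_rmorph /meval mmap_rmorph.
rewrite /mmap; apply: eq_bigr => m _; congr (_ * _).
  by rewrite /= horner_evalE hornerC.
by apply: mmap1_eq => j; rewrite /= horner_evalE !hornerE.
Qed.

Lemma taylor_frobenius v j :
  taylor v ('X_j ^+ q - 'X_j) = 'X_j ^+ q *: 'X^q - 'X_j *: 'X.
Proof.
pose phi : {rmorphism F -> {poly S}} := (polyC \o mpolyC l (R := F)).
rewrite rmorphB rmorphXn /= taylorX (frobenius_add phi) exprZn opprD addrACA.
by rewrite -!rmorphXn /= expf_card subrr add0r.
Qed.

(** The differential of [f] at [v], as a form in the displacement. *)
Definition linpart v f : S := (taylor v f)^`().[0].

Lemma linpart_is_additive v : zmod_morphism (linpart v).
Proof. by move=> f1 f2; rewrite /linpart rmorphB derivB hornerD hornerN. Qed.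
HB.instance Definition _ v := GRing.isZmodMorphism.Build S S (linpart v) (linpart_is_additive v).

Lemma linpartM v f1 f2 : linpart v (f1 * f2) =
  linpart v f1 * (f2.@[v])%:MP + (f1.@[v])%:MP * linpart v f2.
Proof.
rewrite -!taylor0 /linpart.
have -> : taylor v (f1 * f2) = taylor v f1 * taylor v f2 by apply: rmorphM.
by rewrite derivM hornerD hornerM hornerM.
Qed.

(** The differential of [g_eq] at a common zero of [g]: terms with an undifferentiated [g i] drop
    out, and X_j^q contributes nothing to first order. *)
Lemma linpart_eq v : (forall i, (g i).@[v] = 0) -> forall j,
  \sum_i linpart v (g i) * ((Theta i j).@[v])%:MP = - 'X_j.
Proof.
move=> gv j; have := congr1 (fun f => (taylor v f)^`().[0]) (g_eq j).
rewrite taylor_frobenius derivB !derivZ derivXn derivX !hornerE.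
rewrite hornerMn hornerXn expr0n -subn1 subn_eq0 leqNgt q_gt1 /= mul0rn mulr0 sub0r => <-.
rewrite -/(linpart v _) raddf_sum /=; apply: eq_bigr => i _.
by rewrite linpartM gv mpolyC0 mul0r addr0.
Qed.

(** Evaluation of [g_eq] gives g(v) Theta(v) = 0, so an invertible Theta(v) forces g(v) = 0.
    Conversely, at a zero of [g] a relation between the columns of Theta(v) would by [linpart_eq] be
    a linear relation between the variables. *)
Lemma regular_pointsE v : (v \in U) = [forall i, (g i).@[v] == 0].
Proof.
rewrite inE; apply/idP/forallP => [dv i|gv].
  pose gr : 'rV[F]_l := \row_i (g i).@[v].
  have g0 : gr *m Theta_at v = 0.
    apply/rowP => j; rewrite !mxE.
    have := congr1 (meval v) (g_eq j); rewrite raddf_sum /= rmorphB rmorphXn /=.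
    rewrite !mevalXU expf_card subrr => e0; rewrite -[RHS]e0; apply: eq_bigr => k _.
    by rewrite rmorphM !mxE.
  have := congr1 (fun A : 'rV_l => A 0 i) (congr1 (mulmx^~ (\adj (Theta_at v))) g0).
  rewrite -mulmxA mul_mx_adj mul_mx_scalar mul0mx !mxE => /eqP.
  by rewrite mulf_eq0 (negPf dv).
apply/negP => /eqP d0.
have /det0P[w wn0 w0] : \det (Theta_at v)^T == 0 by rewrite det_tr d0.
have lin := linpart_eq (fun i => eqP (gv i)).
have : \sum_j (w 0 j) *: 'X_j = 0 :> S.
  apply/eqP; rewrite -oppr_eq0 -sumrN; apply/eqP.
  under eq_bigr => j _ do rewrite -scalerN -lin scaler_sumr.
  rewrite exchange_big big1 //= => i _.
  have := congr1 (fun A : 'rV_l => A 0 i) w0; rewrite !mxE => wi.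
  under eq_bigr => j _ do rewrite scalerAr -mul_mpolyC -mpolyCM.
  rewrite -mulr_sumr -raddf_sum /= (_ : \sum_j _ = 0) ?mpolyC0 ?mulr0 //.
  by rewrite -[RHS]wi; apply: eq_bigr => j _; rewrite !mxE.
move=> e; case/eqP: wn0; apply/rowP => j; rewrite mxE.
have := congr1 (mcoeff U_(j)) e; rewrite raddf_sum mcoeff0 (bigD1 j) //= mcoeffZ mcoeffXU.
rewrite eqxx mulr1 big1 ?addr0 // => k nk.
by rewrite mcoeffZ mcoeffXU (negPf nk) mulr0.
Qed.

(** The indicator function of the point [v], since x^(q-1) = 1 for every nonzero x in [F]. *)
Definition lagrange v : S := \prod_j (1 - ('X_j - (v j)%:MP) ^+ q.-1).

Lemma lagrange_eval v (w : {ffun 'I_l -> F}) : (lagrange v).@[w] = (v == w)%:R.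
Proof.
rewrite /lagrange rmorph_prod /=; case: (eqVneq v w) => [<-|vw].
  rewrite big1 // => j _; rewrite rmorphB rmorphXn rmorphB /= rmorph1 mevalXU mevalC.
  by rewrite subrr expr0n -subn1 subn_eq0 leqNgt q_gt1 subr0.
have [j nj] : exists j, v j != w j.
  apply/existsP; apply: contraNT vw; rewrite negb_exists => /forallP h.
  by apply/eqP/ffunP => j; apply/eqP; move: (h j); rewrite negbK.
rewrite (bigD1 j) //= rmorphB rmorphXn rmorphB /= rmorph1 mevalXU mevalC.
have z0 : w j - v j != 0 by rewrite subr_eq0 eq_sym.
suff -> : (w j - v j) ^+ q.-1 = 1 by rewrite subrr mul0r.
apply: (mulfI z0); rewrite mulr1 -exprS prednK ?expf_card //.
exact: ltnW.
Qed.

Lemma lagrange_deg v : (msize (lagrange v) <= (l * q.-1).+1)%N.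
Proof.
have aux (a b c d : nat) : (a <= c.+1)%N -> (b <= d.+1)%N -> ((a + b).-1 <= (c + d).+1)%N.
  by lia.
have deg1 j : (msize (1 - ('X_j - (v j)%:MP) ^+ q.-1 : S) <= q.-1.+1)%N.
  have h : (msize ('X_j - (v j)%:MP : S) <= 2)%N.
    apply: leq_trans (msizeD_le _ _) _; rewrite geq_max msizeX mdeg1 msizeN msizeC.
    by case: eqP.
  apply: leq_trans (msizeD_le _ _) _; rewrite geq_max msize1 msizeN /=.
  elim: q.-1 => [|k IH]; first by rewrite expr0 msize1.
  rewrite exprS; apply: leq_trans (msizeM_leq _ _) _.
  exact: aux h IH.
have gen (r : seq 'I_l) : (msize (\prod_(j <- r) (1 - ('X_j - (v j)%:MP) ^+ q.-1 : S)) <=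
    (size r * q.-1).+1)%N.
  elim: r => [|j r IH]; first by rewrite big_nil msize1.
  rewrite big_cons; apply: leq_trans (msizeM_leq _ _) _ => /=.
  exact: aux (deg1 j) IH.
by have := gen (enum 'I_l); rewrite big_enum size_enum_ord.
Qed.

(** The sum over points is a product of one-variable sums, and such a sum minus 1 has degree below q
    but vanishes at all q elements of [F]. *)
Lemma sum_lagrange : \sum_v lagrange v = 1.
Proof.
rewrite /lagrange -(bigA_distr_bigA (fun j c => 1 - ('X_j - c%:MP) ^+ q.-1 : S)).
apply: big1 => j _; pose P : {poly F} := \sum_c (1 - ('X - c%:P) ^+ q.-1).
have P1 : P = 1.
  apply/eqP; rewrite -subr_eq0; apply: contraT => Pn0.
  have szP : (size (P - 1)%R <= q)%N.
    apply: leq_trans (size_polyD _ _) _; rewrite geq_max size_polyN size_poly1 (ltnW q_gt1) andbT.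
    apply: leq_trans (size_sum _ _ _) _; apply/bigmax_leqP => c _.
    apply: leq_trans (size_polyD _ _) _; rewrite geq_max size_polyN size_poly1 (ltnW q_gt1) /=.
    by rewrite size_exp_XsubC prednK // ltnW.
  have := max_poly_roots Pn0 (rs := enum F); rewrite enum_uniq -cardE ltnNge szP.
  apply=> //; apply/allP => x _; rewrite rootE hornerD hornerN hornerC subr_eq0.
  rewrite -horner_evalE rmorph_sum /= (bigD1 x) //= big1 ?addr0.
    rewrite horner_evalE !hornerE subrr expr0n -subn1 subn_eq0 leqNgt q_gt1.
    by rewrite subr0.
  move=> c cx; rewrite horner_evalE !hornerE.
  have z0 : x - c != 0 by rewrite subr_eq0 eq_sym.
  suff -> : (x - c) ^+ q.-1 = 1 by rewrite subrr.
  by apply: (mulfI z0); rewrite mulr1 -exprS prednK ?expf_card // ltnW.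
have := congr1 (horner_alg ('X_j : S)) P1; rewrite rmorph1 /P rmorph_sum => e; rewrite -[RHS]e.
apply: eq_bigr => c _; rewrite rmorphB rmorphXn rmorphB /= rmorph1.
by rewrite horner_algX horner_algC alg_mpolyC.
Qed.

End FiniteBezout.

(** * Dimension counts for polynomials over a finite field *)

Section SpanCounting.
Variables (F : finFieldType) (l : nat) (I : finType) (D : {set I}).
Local Notation S := {mpoly F[l]}.
Variables (gen : I -> S) (n : nat).

Inductive spanned (P : S -> Prop) : S -> Prop :=
| Spanned0 : spanned P 0
| SpannedD c x y : P x -> spanned P y -> spanned P (c *: x + y).

Lemma spanned_add P x y : spanned P x -> spanned P y -> spanned P (x + y).
Proof.
elim=> [|c x' y' Px _ IH] sy; first by rewrite add0r.
by rewrite -addrA; apply: SpannedD => //; apply: IH.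
Qed.

Lemma spanned_scale P c x : spanned P x -> spanned P (c *: x).
Proof.
elim=> [|d x' y' Px _ IH]; first by rewrite scaler0; apply: Spanned0.
by rewrite scalerDr scalerA; apply: SpannedD.
Qed.

Lemma spanned_gen P x : P x -> spanned P x.
Proof.
by move=> Px; rewrite -[x]addr0 -[x]scale1r; apply: SpannedD => //; apply: Spanned0.
Qed.

Lemma spanned_sum P (J : Type) (r : seq J) (Q : pred J) (f : J -> S) :
  (forall j, Q j -> spanned P (f j)) -> spanned P (\sum_(j <- r | Q j) f j).
Proof. by move=> h; elim/big_ind: _ => //; [exact: Spanned0|exact: spanned_add]. Qed.

Lemma spanned_map (P P' : S -> Prop) (z x : S) :
  (forall y, P y -> P' (y * z)) -> spanned P x -> spanned P' (x * z).
Proof.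
move=> h; elim=> [|d x' y' Px _ IH]; first by rewrite mul0r; apply: Spanned0.
by rewrite mulrDl -scalerAl; apply: SpannedD => //; apply: h.
Qed.

Local Notation I' := {k : I | k \in D}.
Let comb (c : {ffun I' -> F}) : S := \sum_k c k *: gen (val k).

Let card_coef : #|{: {ffun I' -> F}}| = (#|{: F}| ^ #|D|)%N.
Proof. by rewrite card_ffun card_sig; congr (_ ^ _)%N; apply: eq_card. Qed.

Let card_target : #|{: {ffun 'X_{1..l < n.+1} -> F}}| = (#|{: F}| ^ nmon l n)%N.
Proof. by rewrite card_ffun. Qed.

Let coefs (f : S) : {ffun 'X_{1..l < n.+1} -> F} := [ffun b => f@_(val b)].

(** Dimensions are compared by counting vectors: coefficient families cover all polynomials of
    degree at most [n], so the powers of q compare. *)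
Lemma span_card :
  (forall f, (msize f <= n.+1)%N -> spanned (fun x => exists2 k, k \in D & x = gen k) f) ->
  (nmon l n <= #|D|)%N.
Proof.
move=> h; have q1 : (1 < #|{: F}|)%N := finNzRing_gt1 F.
rewrite -(leq_exp2l _ _ q1) -card_target -card_coef.
pose G c := coefs (comb c).
suff surj t : t \in codom G.
  apply: leq_trans (leq_image_card G _); apply: subset_leq_card.
  by apply/subsetP => t _; apply: surj.
pose f : S := \sum_(b : 'X_{1..l < n.+1}) t b *: 'X_[val b].
have sf : (msize f <= n.+1)%N.
  apply: leq_trans (msize_sum _ _ _) _; apply/bigmax_leqP => b _.
  by apply: leq_trans (msizeZ_le _ _) _; rewrite msizeX bmdeg.
have [c ec] : exists c, f = comb c.
  elim: (h f sf) => [|d x y [k kD ->] _ [c ->]].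
    by exists [ffun=> 0]; rewrite /comb big1 // => k _; rewrite ffunE scale0r.
  exists [ffun k' => c k' + (if k' == exist _ k kD then d else 0)].
  rewrite /comb [RHS](eq_bigr (fun k' => c k' *: gen (val k') +
    (if k' == exist _ k kD then d *: gen (val k') else 0))); last first.
    by move=> k' _; rewrite ffunE scalerDl; case: eqP; rewrite ?scale0r.
  by rewrite big_split /= -big_mkcond big_pred1_eq addrC.
apply/codomP; exists c; apply/ffunP => b; rewrite /G -ec ffunE raddf_sum (bigD1 b) //=.
rewrite mcoeffZ mcoeffX eqxx mulr1 big1 ?addr0 // => b' nb.
by rewrite mcoeffZ mcoeffX (inj_eq val_inj) (negPf nb) mulr0.
Qed.

Lemma indep_card :
  (forall k, k \in D -> msize (gen k) <= n.+1)%N ->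
  (forall c : I -> F, \sum_(k in D) c k *: gen k = 0 -> forall k, k \in D -> c k = 0) ->
  (#|D| <= nmon l n)%N.
Proof.
move=> deg ind; have q1 : (1 < #|{: F}|)%N := finNzRing_gt1 F.
rewrite -(leq_exp2l _ _ q1) -card_target -card_coef.
pose G c := coefs (comb c).
have szc c : (msize (comb c) <= n.+1)%N.
  apply: leq_trans (msize_sum _ _ _) _; apply/bigmax_leqP => k _.
  by apply: leq_trans (msizeZ_le _ _) (deg _ (valP k)).
have Ginj : injective G.
  move=> c c' /ffunP e; have ecc : comb c = comb c'.
    apply/mpolyP => m; case: (ltnP (mdeg m) n.+1) => [lt|ge].
      by have := e (BMultinom lt); rewrite !ffunE.
    by rewrite !memN_msupp_eq0 //; apply: msize_mdeg_ge; apply: leq_trans ge; apply: szc.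
  pose d (k : I) : F := if insub k is Some k' then c k' - c' k' else 0.
  have dE (k : I') : d (val k) = c k - c' k by rewrite /d valK.
  have sumd : \sum_(k in D) d k *: gen k = 0.
    transitivity (\sum_(k : I') d (val k) *: gen (val k)).
      rewrite (reindex_omap (fun k : I' => val k) insub) /=; last by move=> k kD; rewrite insubT.
      apply: eq_big => [k|//]; rewrite (valP k) /=; rewrite valK.
      by rewrite eqxx.
    under eq_bigr => k _ do rewrite dE scalerBl.
    by rewrite sumrB -/(comb c) -/(comb c') ecc subrr.
  apply/ffunP => k; apply/eqP; rewrite -subr_eq0 -dE; apply/eqP.
  by apply: ind sumd _ (valP k).
exact: leq_card Ginj.
Qed.

End SpanCounting.

(** * The number of regular points is the Bezout number *)

Section RegularPoints.
Variables (F : finFieldType) (l : nat).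
Local Notation S := {mpoly F[l]}.
Local Notation q := #|{: F}|.
Variables (E : 'I_l -> nat) (Theta : 'M[S]_l) (g : 'I_l -> S).
Hypothesis Epos : forall i, (0 < E i)%N.
Hypothesis Elt : forall i, (E i <= q)%N.
Hypothesis Theta_deg : forall i j, (msize (Theta i j) <= (q - E i).+1)%N.
Hypothesis g_deg : forall i, (msize (g i) <= (E i).+1)%N.
Hypothesis g_eq : forall j, \sum_i g i * Theta i j = 'X_j ^+ q - 'X_j.

Implicit Types (v : {ffun 'I_l -> F}) (f : S) (a : 'X_{1..l}).

Let U : {set {ffun 'I_l -> F}} :=
  [set v : {ffun 'I_l -> F} | \det (map_mx (meval v) Theta) != 0].
Let n0 := (l * q.-1)%N.

Let q_gt1 : (1 < q)%N. Proof. exact: finNzRing_gt1. Qed.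

Let Uvan v i : v \in U -> (g i).@[v] = 0.
Proof. by rewrite (regular_pointsE g_eq) => /forallP/(_ i)/eqP. Qed.

Definition ingr f := exists c : 'I_l -> S, f = \sum_i c i * g i.

(** Membership in the ideal (g) with control of degrees: each [c i * g i] has degree at most [n],
    and the truncated subtraction forces [c i = 0] when [E i] exceeds [n]. *)
Definition ingr_deg (n : nat) f :=
  exists2 c : 'I_l -> S, f = \sum_i c i * g i & forall i, (msize (c i) <= n.+1 - E i)%N.

Lemma ingr_deg0 n : ingr_deg n 0.
Proof. by exists (fun=> 0) => [|i]; rewrite ?msize0 // big1 // => i _; rewrite mul0r. Qed.

Lemma ingr_degD n f1 f2 : ingr_deg n f1 -> ingr_deg n f2 -> ingr_deg n (f1 + f2).
Proof.
move=> [c1 -> s1] [c2 -> s2]; exists (fun i => c1 i + c2 i) => [|i].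
  by rewrite -big_split; apply: eq_bigr => i _; rewrite mulrDl.
by apply: leq_trans (msizeD_le _ _) _; rewrite geq_max s1 s2.
Qed.

Lemma ingr_degZ n c f : ingr_deg n f -> ingr_deg n (c *: f).
Proof.
move=> [c1 -> s1]; exists (fun i => c *: c1 i) => [|i].
  by rewrite scaler_sumr; apply: eq_bigr => i _; rewrite scalerAl.
exact: leq_trans (msizeZ_le _ _) (s1 i).
Qed.

Lemma ingr_deg_sum n (J : Type) (r : seq J) (Q : pred J) (f : J -> S) :
  (forall j, Q j -> ingr_deg n (f j)) -> ingr_deg n (\sum_(j <- r | Q j) f j).
Proof. by move=> h; elim/big_ind: _ => //; [exact: ingr_deg0|exact: ingr_degD]. Qed.

Lemma ingr_deg_mono m n f : (m <= n)%N -> ingr_deg m f -> ingr_deg n f.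
Proof.
by move=> le [c e s]; exists c => // i; apply: leq_trans (s i) _; rewrite leq_sub2r.
Qed.

Lemma ingr_deg_exists f : ingr f -> exists n, ingr_deg n f.
Proof.
move=> [c ->]; exists (\sum_i (msize (c i) + E i))%N; exists c => // i.
by rewrite leq_subRL (bigD1 i) //=; move: (\sum_(_ | _) _)%N (msize (c i)) (E i) => x y z; lia.
Qed.

Lemma ingrD f1 f2 : ingr f1 -> ingr f2 -> ingr (f1 + f2).
Proof.
move=> [c1 ->] [c2 ->]; exists (fun i => c1 i + c2 i).
by rewrite -big_split; apply: eq_bigr => i _; rewrite mulrDl.
Qed.

Lemma ingrM h f : ingr f -> ingr (h * f).
Proof.
move=> [c1 ->]; exists (fun i => h * c1 i).
by rewrite mulr_sumr; apply: eq_bigr => i _; rewrite mulrA.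
Qed.

Lemma ingr_sum (J : Type) (r : seq J) (Q : pred J) (f : J -> S) :
  (forall j, Q j -> ingr (f j)) -> ingr (\sum_(j <- r | Q j) f j).
Proof.
move=> h; elim/big_ind: _ => //; last exact: ingrD.
by exists (fun=> 0); rewrite big1 // => i _; rewrite mul0r.
Qed.

Lemma ingr_frobenius j : ingr ('X_j ^+ q - 'X_j).
Proof. by exists (fun i => Theta i j); rewrite -g_eq; apply: eq_bigr => i _; rewrite mulrC. Qed.

Lemma ingr_g i : ingr (g i).
Proof.
exists (fun k => (k == i)%:R); rewrite (bigD1 i) //= eqxx mul1r big1 ?addr0 // => k nk.
by rewrite (negPf nk) mul0r.
Qed.

(** Modulo (g), multiplication by [f] acts on [lagrange v] as the scalar f(v). For a variable this
    is (X_j - v_j)(1 - (X_j - v_j)^(q-1)) = -(X_j^q - X_j), an element of (g); sums and products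
    follow. *)
Lemma lagrange_mul v f : ingr ((f - (f.@[v])%:MP) * lagrange v).
Proof.
pose P f := ingr ((f - (f.@[v])%:MP) * lagrange v).
have PC c : P c%:MP.
  by rewrite /P mevalC subrr mul0r; exists (fun=> 0); rewrite big1 // => i _; rewrite mul0r.
have PD f1 f2 : P f1 -> P f2 -> P (f1 + f2).
  move=> h1 h2; rewrite /P mevalD mpolyCD opprD addrACA mulrDl; exact: ingrD.
have PM f1 f2 : P f1 -> P f2 -> P (f1 * f2).
  move=> h1 h2; rewrite /P mevalM mpolyCM.
  have -> : (f1 * f2 - (f1.@[v])%:MP * (f2.@[v])%:MP) * lagrange v =
     f2 * ((f1 - (f1.@[v])%:MP) * lagrange v) +
     (f1.@[v])%:MP * ((f2 - (f2.@[v])%:MP) * lagrange v) by ring.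
  by apply: ingrD; apply: ingrM.
have PX j : P 'X_j.
  rewrite /P mevalXU /lagrange (bigD1 j) //= mulrA mulrC; apply: ingrM.
  set x := 'X_j - (v j)%:MP.
  have -> : x * (1 - x ^+ q.-1) = (-1) * ('X_j ^+ q - 'X_j); last first.
    exact/ingrM/ingr_frobenius.
  rewrite mulrBr mulr1 -exprS prednK ?(ltnW q_gt1) //.
  have -> : x ^+ q = 'X_j ^+ q + (- (v j)%:MP) ^+ q.
    exact: (frobenius_add (mpolyC l (R := F))).
  by rewrite -mpolyCN -rmorphXn /= expf_card mpolyCN /x mulN1r !opprB; ring.
elim/mpolyind: f => [|c m f _ _ IH]; first by rewrite -mpolyC0; apply: (PC).
apply: (PD) => //; rewrite -mul_mpolyC; apply: (PM) => //.
rewrite mpolyXE_id; apply: (big_ind P) => [|f1 f2|i _].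
- by rewrite -mpolyC1; apply: (PC).
- exact: PM.
elim: (m i) => [|k IHk]; first by rewrite expr0 -mpolyC1; apply: (PC).
by rewrite exprS; apply: (PM).
Qed.

(** Some g_i(v) is nonzero, and g_i(v) [lagrange v] is congruent to [g i * lagrange v], which is 0
    modulo (g). *)
Lemma lagrange_singular v : v \notin U -> ingr (lagrange v).
Proof.
rewrite (regular_pointsE g_eq) negb_forall => /existsP[i gi].
have [c ec] : ingr ((g i).@[v] *: lagrange v).
  have -> : (g i).@[v] *: lagrange v =
      lagrange v * g i + (-1) * ((g i - ((g i).@[v])%:MP) * lagrange v).
    by rewrite -mul_mpolyC; ring.
  by apply: ingrD; [apply/ingrM/ingr_g|apply/ingrM/lagrange_mul].
exists (fun k => (g i).@[v]^-1 *: c k).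
rewrite -[LHS]scale1r -(mulVf gi) -scalerA ec scaler_sumr.
by apply: eq_bigr => k _; rewrite scalerAl.
Qed.

Lemma ingr_decomp f : ingr (f - \sum_(v in U) f.@[v] *: lagrange v).
Proof.
have -> : f - \sum_(v in U) f.@[v] *: lagrange v =
   \sum_(v : {ffun 'I_l -> F}) (f - (f.@[v])%:MP) * lagrange v +
   \sum_(v : {ffun 'I_l -> F} | v \notin U) (f.@[v])%:MP * lagrange v.
  have {1}-> : f = \sum_(v : {ffun 'I_l -> F})
      ((f - (f.@[v])%:MP) * lagrange v + (f.@[v])%:MP * lagrange v).
    rewrite (eq_bigr (fun v : {ffun 'I_l -> F} => f * lagrange v)).
      by rewrite -mulr_sumr sum_lagrange mulr1.
    by move=> v _; rewrite -mulrDl subrK.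
  rewrite big_split /= -addrA; congr (_ + _); apply/eqP; rewrite subr_eq addrC; apply/eqP.
  rewrite (bigID (fun v => v \in U)) /=; congr (_ + _); apply: eq_bigr => v _.
  by rewrite mul_mpolyC.
apply: ingrD; apply: ingr_sum => v vU; first exact: lagrange_mul.
by apply: ingrM; apply: lagrange_singular.
Qed.

(** Above degree [n0] = l (q - 1) some exponent is at least q, and X_j^q may be replaced by X_j;
    [Theta_deg] says that X_j^q - X_j lies in (g) without excess of degree. *)
Lemma reduce_monomial m : exists2 r, (msize r <= n0.+1)%N & ingr_deg (mdeg m) ('X_[m] - r).
Proof.
have [k] := ubnP (mdeg m); elim: k m => // k IH m ltk.
case: (leqP (mdeg m) n0) => [le|gt].
  by exists 'X_[m]; [rewrite msizeX ltnS|rewrite subrr; apply: ingr_deg0].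
have [j qj] : exists j, (q <= m j)%N.
  apply/existsP; apply: contraLR gt; rewrite negb_exists => /forallP h.
  rewrite -leqNgt mdegE /n0; apply: (@leq_trans (\sum_(j < l) q.-1)%N).
    by apply: leq_sum => j _; rewrite -ltnS prednK ?(ltnW q_gt1) // ltnNge h.
  by rewrite sum_nat_const card_ord.
have le1 (i : nat) : (i <= q)%N -> (U_(j) *+ i <= m)%MM.
  move=> iq; apply/mnm_lepP => i'; rewrite mulmnE mnm1E; case: eqP => [<-|_] //.
  by rewrite mul1n (leq_trans iq).
pose m1 := (m - U_(j) *+ q)%MM; pose m2 := (m - U_(j) *+ q.-1)%MM.
have em1 : (m1 + U_(j) *+ q = m)%MM by rewrite submK ?le1.
have em2 : (m2 + U_(j) *+ q.-1 = m)%MM by rewrite submK ?le1 ?leq_pred.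
have d1 : (mdeg m1 + q = mdeg m)%N by rewrite -[in RHS]em1 mdegD mdegMn mdeg1 mul1n.
have d2 : (mdeg m2 + q.-1 = mdeg m)%N by rewrite -[in RHS]em2 mdegD mdegMn mdeg1 mul1n.
have e12 : m2 = (m1 + U_(j))%MM.
  apply: (@addIm _ (U_(j) *+ q.-1)%MM); rewrite em2 -addmA -mulmS prednK ?em1 //.
  exact: ltnW.
have lt2 : (mdeg m2 < mdeg m)%N by move: d2 q_gt1; lia.
have [r sr er] := IH m2 (leq_trans lt2 (ltnSE ltk)).
exists r => //; have -> : 'X_[m] - r = 'X_[m1] * ('X_j ^+ q - 'X_j) + ('X_[m2] - r).
  by rewrite mulrBr mpolyXn -!mpolyXD em1 -e12 addrA subrK.
apply: ingr_degD; last exact: ingr_deg_mono (ltnW lt2) er.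
exists (fun i => 'X_[m1] * Theta i j) => [|i].
  by rewrite -g_eq mulr_sumr; apply: eq_bigr => i _; rewrite mulrCA mulrC.
apply: leq_trans (msizeM_leq _ _) _; rewrite msizeX /= -d1.
have := Theta_deg i j; have := Elt i.
by move: (msize _) (E i) (mdeg m1) q => x y z t; lia.
Qed.

(** For the monomials of degree at most [n0] the decomposition modulo (g) has no explicit degree
    bound, but they are finitely many; [n1] is the largest degree they need. *)
Lemma reduction : exists n1, forall n f, (n1 <= n)%N -> (msize f <= n.+1)%N ->
  exists c : {ffun 'I_l -> F} -> F,
    ingr_deg n (f - \sum_(v in U) c v *: lagrange v).
Proof.
have h (b : 'X_{1..l < n0.+1}) : exists n, ingr_deg n
    ('X_[val b] - \sum_(v in U) ('X_[val b]).@[v] *: lagrange v).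
  exact/ingr_deg_exists/ingr_decomp.
have [N hN] := fin_all_exists h; exists (\max_b N b)%N => n f le_n sf.
have [r hr] := fin_all_exists (fun b : 'X_{1..l < n.+1} =>
  let: ex_intro2 r s e := reduce_monomial (val b) in ex_intro _ r (conj s e)).
pose R : S := \sum_(b : 'X_{1..l < n.+1}) f@_(val b) *: r b.
have sR : (msize R <= n0.+1)%N.
  apply: leq_trans (msize_sum _ _ _) _; apply/bigmax_leqP => b _.
  by apply: leq_trans (msizeZ_le _ _) _; case: (hr b).
have fR : ingr_deg n (f - R).
  rewrite {1}(mpolywE sf) /R -sumrB; apply: ingr_deg_sum => b _.
  rewrite -scalerBr; apply: ingr_degZ; apply: ingr_deg_mono (hr b).2.
  by rewrite -ltnS bmdeg.
exists (fun v => R.@[v]).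
have -> : f - \sum_(v in U) R.@[v] *: lagrange v =
    (f - R) + (R - \sum_(v in U) R.@[v] *: lagrange v) by rewrite addrA subrK.
apply: ingr_degD => //; pose lin f := f - \sum_(v in U) f.@[v] *: lagrange v.
have -> : R - \sum_(v in U) R.@[v] *: lagrange v =
    \sum_(b : 'X_{1..l < n0.+1}) R@_(val b) *: lin 'X_[val b].
  under [RHS]eq_bigr => b _ do rewrite scalerBr.
  rewrite sumrB -(mpolywE sR); congr (_ - _).
  under [RHS]eq_bigr => b _ do rewrite scaler_sumr.
  rewrite exchange_big /=; apply: eq_bigr => v _.
  rewrite {1}(mpolywE sR) raddf_sum scaler_suml; apply: eq_bigr => b _ /=.
  by rewrite mevalZ scalerA.
apply: ingr_deg_sum => b _; apply/ingr_degZ/(ingr_deg_mono _ (hN b)).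
by apply: leq_trans le_n; apply: leq_bigmax.
Qed.

Let gpow a : S := mmap1 g a.

Lemma gpowD a b : gpow (a + b)%MM = gpow a * gpow b.
Proof. by apply: commr_mmap1_M => i x; apply: mulrC. Qed.

(* Modulo the powers of g every polynomial reduces to a combination of the
   lagrange v, so that the lagrange v * g^a almost span. *)
Lemma regular_points_lower : (\prod_i E i <= #|U|)%N.
Proof.
have [n1 red] := reduction.
(* The second kind is an error term: the expansion stops when the remaining degree is at most [n1],
   leaving a monomial of bounded degree times g^a of weight within [n1] of n. These are the boundary
   terms that [nwt_lower] tolerates. *)
pose gens n (x : S) :=
  (exists v a, [/\ v \in U, (wt E a <= n)%N & x = lagrange v * gpow a]) \/
  (exists (b : 'X_{1..l < n1.+1}) a,
     [/\ (wt E a <= n)%N, (n < wt E a + n1.+1)%N & x = 'X_[val b] * gpow a]).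
have span n f : (msize f <= n.+1)%N -> spanned (gens n) f.
  have [k] := ubnP n; elim: k n f => // k IH n f ltk sf.
  case: (leqP n n1) => [le_n|lt_n].
    rewrite [f](mpolywE sf); apply: spanned_sum => b _; apply/spanned_scale/spanned_gen.
    have lb : (mdeg (val b) < n1.+1)%N by apply: leq_trans (bmdeg b) _; rewrite ltnS.
    right; exists (BMultinom lb), 0%MM; rewrite wt0 add0n /gpow mmap11 mulr1.
    by split.
  have [c [d e sd]] := red n f (ltnW lt_n) sf.
  rewrite -[f](subrK (\sum_(v in U) c v *: lagrange v)) e.
  apply: spanned_add; last first.
    apply: spanned_sum => v vU; apply/spanned_scale/spanned_gen; left; exists v, 0%MM.
    by rewrite wt0 /gpow mmap11 mulr1.
  apply: spanned_sum => i _; case: (leqP (E i) n) => [leE|ltE]; last first.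
    have := sd i; have -> : (n.+1 - E i = 0)%N by apply/eqP; rewrite subn_eq0.
    by rewrite leqn0 msize_poly_eq0 => /eqP ->; rewrite mul0r; apply: Spanned0.
  have ltn : (n - E i < k)%N by move: ltk (Epos i) leE; lia.
  have si := sd i; rewrite subSn // in si.
  apply: spanned_map (IH _ _ ltn si) => y [] [v [a []]].
    move=> vU wa ->; left; exists v, (a + U_(i))%MM; rewrite wtD wt1 gpowD.
    by rewrite /gpow mmap1U mulrA; split=> //; move: wa leE; lia.
  move=> wa lta ->; right; exists v, (a + U_(i))%MM; rewrite wtD wt1 gpowD.
  rewrite /gpow mmap1U mulrA; split=> //; first by move: wa leE; lia.
  by move: lta leE; lia.
apply: (@nwt_lower _ _ Epos #|U| (nmon l n1) n1.+1) => n; set m := (n + n1.+1)%N.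
pose I1 := ({ffun 'I_l -> F} * 'X_{1..l < m.+1})%type.
pose I2 := ('X_{1..l < n1.+1} * 'X_{1..l < m.+1})%type.
pose gen (k : I1 + I2) : S := match k with
  | inl x => lagrange x.1 * gpow (val x.2) | inr x => 'X_[val x.1] * gpow (val x.2) end.
pose bdry : {set 'X_{1..l < m.+1}} :=
  [set a : 'X_{1..l < m.+1} | (wt E (val a) <= m)%N & (m < wt E (val a) + n1.+1)%N].
pose D : {set I1 + I2} := [set k | match k with
  | inl x => (x.1 \in U) && (x.2 \in wset E m) | inr x => x.2 \in bdry end].
have cardD : #|D| = (#|U| * nwt E m + nmon l n1 * #|bdry|)%N.
  rewrite -sum1_card big_sumType /= /nmon -cardsT -!cardsX -!sum1_card.
  by congr (_ + _)%N; apply: eq_bigl => x; rewrite !inE.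
have bdryE : (#|bdry| <= nwt E m - nwt E n)%N.
  pose low : {set 'X_{1..l < m.+1}} := [set a : 'X_{1..l < m.+1} | (wt E (val a) <= n)%N].
  have cl : (nwt E n <= #|low|)%N.
    pose k (a : 'X_{1..l < n.+1}) : 'X_{1..l < m.+1} := insubd bm0 (val a).
    have kE (a : 'X_{1..l < n.+1}) : val (k a) = val a.
      by rewrite val_insubd (leq_trans (bmdeg a)) // ltnS leq_addr.
    have kinj : injective k by move=> a b e; apply: val_inj; rewrite -!kE e.
    rewrite /nwt -(card_imset _ kinj); apply/subset_leq_card/subsetP => _ /imsetP[a ha ->].
    by rewrite !inE kE in ha *.
  have dj : bdry :&: low = set0.
    by apply/setP => a; rewrite !inE /m; apply/negP => /andP[/andP[_ h1] h2]; move: h1 h2; lia.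
  have sub : bdry :|: low \subset wset E m.
    apply/subsetP => a; rewrite !inE => /orP[/andP[] //|h1].
    by apply: leq_trans h1 _; rewrite leq_addr.
  have := subset_leq_card sub; rewrite cardsU dj cards0 subn0 -/(nwt E m).
  by move: cl; move: #|bdry| #|low| (nwt E n) (nwt E m) => *; lia.
apply: leq_trans (_ : #|D| <= _)%N; last by rewrite cardD leq_add2l leq_mul2l bdryE orbT.
apply: (span_card (gen := gen)) => f /span sf.
elim: sf => [|c x y px _ IH]; first exact: Spanned0.
apply: SpannedD IH; case: px => [] [v [a []]].
  move=> vU wa ->.
  have la : (mdeg a < m.+1)%N by rewrite ltnS (leq_trans (mdeg_le_wt Epos a)).
  move: (vU); rewrite inE => vU'.
  by exists (inl (v, BMultinom la)); rewrite //= !inE /= vU' wa.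
move=> wa lta ->.
have la : (mdeg a < m.+1)%N by rewrite ltnS (leq_trans (mdeg_le_wt Epos a)).
by exists (inr (v, BMultinom la)); rewrite //= !inE /= wa.
Qed.

Lemma msize_gpow a : (msize (gpow a) <= (wt E a).+1)%N.
Proof.
have aux (x y c d : nat) : (x <= c.+1)%N -> (y <= d.+1)%N -> ((x + y).-1 <= (c + d).+1)%N.
  by lia.
rewrite /gpow /mmap1 /wt; elim/big_rec2: _ => [|i d f _ sf]; first by rewrite msize1.
apply: leq_trans (msizeM_leq _ _) (aux _ _ _ _ _ sf).
elim: (a i) => [|k IH]; first by rewrite expr0 msize1.
by rewrite exprS mulSn; apply: leq_trans (msizeM_leq _ _) (aux _ _ _ _ (g_deg i) IH).
Qed.

(* In the local coordinates g at a regular point v the lowest order terms of a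
   polynomial relation in g give a relation between the linear parts of g. *)
Lemma regular_point_independent (n : nat) (c : {ffun 'I_l -> F} -> 'X_{1..l < n.+1} -> F) :
  \sum_(v in U) \sum_(a : 'X_{1..l < n.+1}) c v a *: (lagrange v * gpow (val a)) = 0 ->
  forall v (a : 'X_{1..l < n.+1}), v \in U -> c v a = 0.
Proof.
move=> rel v0 a0 v0U; apply/eqP; apply: contraT => nz.
have [[v a] /= /andP[vU cn0] amin] := @arg_minnP _ (v0, a0)
  (fun x => (x.1 \in U) && (c x.1 x.2 != 0)) (fun x => mdeg (val x.2)) (introT andP (conj v0U nz)).
set m := mdeg (val a) in amin.
have gv i : (g i).@[v] = 0 by apply: Uvan.
have root i : exists h, taylor v (g i) = h * 'X.
  have /factor_theorem[h eh] : root (taylor v (g i)) 0 by rewrite /root taylor0 gv mpolyC0.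
  by exists h; rewrite eh subr0.
have [h eh] := fin_all_exists root.
have h0 i : (h i).[0] = linpart v (g i).
  by rewrite /linpart eh derivM derivX mulr1 hornerD hornerM hornerX mulr0 add0r.
have tg b : taylor v (gpow b) = mmap1 h b * 'X^(mdeg b).
  rewrite /gpow /mmap1 rmorph_prod mdegE -prodrXr -big_split /=.
  apply: eq_bigr => i _; rewrite rmorphXn /= eh exprMn //.
pose lam i := linpart v (g i).
pose P : S := \sum_(b : 'X_{1..l < n.+1} | mdeg (val b) == m) c v b *: 'X_[val b].
have P0 : mmap (mpolyC l (R := F)) lam P = 0.
  (* The Taylor expansion of the relation at [v], divided by t^m. At t = 0 the points w other than
     [v] disappear because [lagrange w] vanishes at [v], and only the [b] of degree m survive. *)
  pose G : {poly S} := \sum_(w in U) \sum_(b : 'X_{1..l < n.+1})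
    (c w b)%:MP%:P * (taylor v (lagrange w) * (mmap1 h (val b) * 'X^(mdeg (val b) - m))).
  have GX : G * 'X^m = 0.
    have tZ k f : taylor v (k *: f) = k%:MP%:P * taylor v f.
      by rewrite /taylor mmapZ.
    have := congr1 (taylor v) rel; rewrite rmorph0 raddf_sum => e; rewrite -[RHS]e.
    rewrite /G mulr_suml; apply: eq_bigr => w wU; rewrite raddf_sum mulr_suml.
    apply: eq_bigr => b _; rewrite /= tZ rmorphM /= tg.
    have [->|cb] := eqVneq (c w b) 0; first by rewrite mpolyC0 polyC0 !mul0r.
    have le : (m <= mdeg (val b))%N by apply: (amin (w, b)); rewrite /= wU.
    by rewrite -!mulrA -exprD subnK.
  have G0 : G = 0 by apply/eqP; move/eqP: GX; rewrite mulf_eq0 expf_eq0 polyX_eq0 andbF orbF.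
  have := congr1 (fun p => p.[0]) G0; rewrite horner0 => e; rewrite -[RHS]e.
  rewrite -horner_evalE /G [RHS]raddf_sum /= [RHS](bigD1 v) //= [X in _ + X]big1 ?addr0; last first.
    move=> w /andP[_ wv]; rewrite raddf_sum /= big1 // => b _.
    rewrite horner_evalE !hornerM hornerC taylor0 lagrange_eval (negPf wv).
    by rewrite mpolyC0 mul0r mulr0.
  rewrite /P raddf_sum [RHS]raddf_sum /= big_mkcond /=; apply: eq_bigr => b _.
  rewrite horner_evalE !hornerM hornerC taylor0 lagrange_eval eqxx mpolyC1 mul1r hornerXn.
  case: eqP => [eb|neb].
    rewrite eb subnn expr0 mulr1 mmapZ mmapX; congr (_ * _).
    rewrite /mmap1 -horner_evalE rmorph_prod; apply: eq_bigr => i _.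
    by rewrite rmorphXn /= horner_evalE h0.
  have [->|cb] := eqVneq (c v b) 0; first by rewrite mpolyC0 mul0r.
  have le : (m <= mdeg (val b))%N by apply: (amin (v, b)); rewrite /= vU.
  rewrite expr0n; have -> : (mdeg (val b) - m == 0)%N = false.
    by apply/negbTE; rewrite subn_eq0 -ltnNge ltn_neqAle le eq_sym; apply/andP; split=> //; apply/eqP.
  by rewrite !mulr0.
have lin := linpart_eq g_eq gv.
(* Theta(v) being invertible, this linear substitution sends the linear part of [g i] to X_i, so a
   polynomial that vanishes on the linear parts is zero. *)
pose sub : {rmorphism S -> S} := mmap (mpolyC l (R := F)) (fun j => - \sum_i ((Theta i j).@[v])%:MP * 'X_i).
have subX j : sub 'X_j = - \sum_i ((Theta i j).@[v])%:MP * 'X_i.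
  exact: (etrans (mmapX _ _ _) (mmap1U _ _)).
have subC k : sub k%:MP = k%:MP by exact: mmapC.
pose ThS : 'M[S]_l := map_mx (fun f => (f.@[v])%:MP) Theta.
have detTh : \det ThS != 0.
  have -> : ThS = map_mx (mpolyC l (R := F)) (map_mx (meval v) Theta).
    by apply/matrixP => i j; rewrite !mxE.
  by rewrite det_map_mx /= mpolyC_eq0; rewrite inE in vU.
have sublam i : sub (lam i) = 'X_i.
  pose x : 'rV[S]_l := \row_i (sub (lam i) - 'X_i).
  have x0 : x *m ThS = 0.
    apply/rowP => j; rewrite !mxE.
    have := congr1 sub (lin j); rewrite raddf_sum raddfN /= => e.
    under eq_bigr => k _ do rewrite !mxE mulrBl.
    rewrite sumrB; apply/eqP; rewrite subr_eq0; apply/eqP.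
    transitivity (- sub 'X_j).
      rewrite -[RHS]e; apply: eq_bigr => k _.
      by rewrite [in RHS]rmorphM /= subC.
    rewrite subX opprK; apply: eq_bigr => k _; exact: mulrC.
  have := congr1 (fun A : 'rV[S]_l => A 0 i) (congr1 (mulmx^~ (\adj ThS)) x0).
  rewrite -mulmxA mul_mx_adj mul_mx_scalar mul0mx [RHS]mxE [LHS]mxE => /eqP.
  by rewrite mulf_eq0 (negPf detTh) /= mxE subr_eq0 => /eqP.
have Pz : P = 0.
  have := congr1 sub P0; rewrite [RHS]raddf0 => e; rewrite -[RHS]e.
  rewrite mmap_rmorph [LHS]mpolyE; apply: eq_bigr => b _ /=.
  rewrite subC mul_mpolyC; congr (_ *: _); rewrite -[LHS]mmap1_id.
  by apply: mmap1_eq => i; rewrite /= sublam.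
have := congr1 (mcoeff (val a)) Pz; rewrite mcoeff0 raddf_sum (bigD1 a) //= mcoeffZ mcoeffX eqxx.
rewrite mulr1 big1 ?addr0; first by move=> c0; rewrite c0 eqxx in cn0.
by move=> b /andP[_ ba]; rewrite mcoeffZ mcoeffX (inj_eq val_inj) (negPf ba) mulr0.
Qed.

Lemma regular_points_upper : (#|U| <= \prod_i E i)%N.
Proof.
apply: (@nwt_upper _ _ Epos #|U| n0) => n.
pose gen (x : {ffun 'I_l -> F} * 'X_{1..l < n.+1}) := lagrange x.1 * gpow (val x.2).
rewrite /nwt -cardsX; apply: (indep_card (gen := gen)) => [[v a]|c].
  rewrite !inE /= => /andP[_ wa]; apply: leq_trans (msizeM_leq _ _) _.
  have := lagrange_deg v; have := msize_gpow (val a); move: wa; rewrite -/n0.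
  by move: (msize _) (msize _) (wt _ _) n0 => x y z t; lia.
have -> : \sum_(k in setX U (wset E n)) c k *: gen k =
    \sum_(v in U) \sum_(a in wset E n) c (v, a) *: gen (v, a).
  by rewrite pair_big_dep; apply: eq_big => [[v a]|[v a] _] //; rewrite in_setX.
move=> rel [v a]; rewrite in_setX /= => /andP[vU wa].
pose c' v (a : 'X_{1..l < n.+1}) := if a \in wset E n then c (v, a) else 0.
have -> : c (v, a) = c' v a by rewrite /c' wa.
apply: regular_point_independent => //.
rewrite -[RHS]rel; apply: eq_bigr => w _; rewrite [RHS]big_mkcond; apply: eq_bigr => b _.
by rewrite /c'; case: ifP; rewrite ?scale0r.
Qed.

Lemma regular_points_card : #|U| = (\prod_i E i)%N.
Proof. by apply/eqP; rewrite eqn_leq regular_points_upper regular_points_lower. Qed.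

End RegularPoints.

(** * Free arrangements over a finite field *)

Section HomogeneousCoefficients.
Context {K : fieldType} {l : nat}.
Local Notation S := {mpoly K[l]}.

Lemma homogeneous_coefficients (I : finType) (e : I -> nat) (theta : I -> 'rV[S]_l) d
    delta (a : I -> S) :
  (forall i, der_homog (e i) (theta i)) -> der_homog d delta ->
  delta = \sum_i a i *: theta i ->
  delta = \sum_i (if (e i <= d)%N then pihomog mdeg (d - e i) (a i) else 0) *: theta i.
Proof.
move=> ht hd ed; rewrite -{1}(hcomp_dE hd) ed; apply/rowP => j; rewrite !mxE !summxE raddf_sum.
apply: eq_bigr => i _ /=; rewrite !mxE (pihomogMr _ _ (ht i j)).
by case: ifP; rewrite ?mul0r.
Qed.

Lemma msize_homog d (f : S) : f \is d.-homog -> (msize f <= d.+1)%N.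
Proof.
move=> hf; have [->|f0] := eqVneq f 0; first by rewrite msize0.
by rewrite -mlead_deg // (dhomog_mf hf (mlead_supp f0)).
Qed.

End HomogeneousCoefficients.

Section FinitePoints.
Context {F : finFieldType} {l : nat} {T : finType}.
Local Notation S := {mpoly F[l]}.
Local Notation q := #|{: F}|.
Variable u : T -> 'cV[F]_l.

Definition complement_points : {set 'rV[F]_l} :=
  [set v : 'rV[F]_l | [forall t, pairing v (u t) != 0]].

Lemma card_kernel m (M : 'M[F]_(l, m)) :
  #|[set v : 'rV[F]_l | v *m M == 0]| = (q ^ (l - \rank M))%N.
Proof.
rewrite -mxrank_ker; set G := row_base (kermx M).
have Gi : injective (fun y : 'rV[F]_(\rank (kermx M)) => y *m G).
  by apply: row_free_inj; apply: row_base_free.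
have -> : [set v : 'rV[F]_l | v *m M == 0] =
    [set y *m G | y in [set: 'rV[F]_(\rank (kermx M))]].
  apply/setP => v; rewrite inE; apply/eqP/imsetP => [vM|[y _ ->]].
    have : (v <= G)%MS by rewrite eq_row_base; apply/sub_kermxP.
    by move=> /submxP[y ->]; exists y; rewrite ?inE.
  by apply/sub_kermxP; rewrite -(eq_row_base (kermx M)) submxMl.
by rewrite card_imset // cardsT card_mx mul1n.
Qed.

Lemma card_int (I : finType) (X : {set I}) : (#|X|%:Z = \sum_i (i \in X)%:R)%R.
Proof.
rewrite -natz -sum1_card natr_sum big_mkcond /=.
by apply: eq_bigr => i _; case: ifP.
Qed.

(** Inclusion and exclusion over the hyperplanes through each point; a flat of dimension k has q^k
    points. *)
Lemma card_complement_points :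
  (#|complement_points|%:Z = \sum_(B : {set T}) (-1) ^+ #|B| * (q ^ (l - \rank (selmx u B)))%:Z)%R.
Proof.
pose z v t : int := (pairing v (u t) == 0)%:R.
have ind v : (v \in complement_points)%:R = \prod_t (- z v t + 1) :> int.
  rewrite inE; case: (boolP [forall t, _]) => [/forallP h|].
    by rewrite big1 // => t _; rewrite /z (negPf (h t)) oppr0 add0r.
  rewrite negb_forall => /existsP[t]; rewrite negbK => ht.
  by rewrite (bigD1 t) //= /z ht addNr mul0r.
rewrite card_int.
under eq_bigr => v _ do rewrite ind bigA_distr.
rewrite exchange_big /=; apply: eq_bigr => B _.
rewrite -(card_kernel (selmx u B)) card_int mulr_sumr; apply: eq_bigr => v _ /=.
rewrite -big_mkcond /= prodrN; rewrite inE selmx_ker.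
case: (boolP [forall t in B, _]) => [/forall_inP h|].
  by rewrite big1 // => t tB; rewrite /z h.
rewrite negb_forall_in => /exists_inP[t tB nt].
by rewrite (bigD1 t) //= /z (negPf nt) mul0r mulr0.
Qed.

End FinitePoints.

Section FiniteFactorization.
Context {F : finFieldType} {l : nat} {T : finType}.
Local Notation S := {mpoly F[l]}.
Local Notation q := #|{: F}|.
Variable u : T -> 'cV[F]_l.
Hypothesis ip : independent_pairs u setT.
Variables (e : 'I_l -> nat) (theta : 'I_l -> 'rV[S]_l) (c : F).
Hypothesis theta_log : forall i, logd u setT (theta i).
Hypothesis theta_homog : forall i, der_homog (e i) (theta i).
Hypothesis c_neq0 : c != 0.
Hypothesis theta_det : \det (coefmx theta) = c *: qpoly u setT.

Definition frobenius_der : 'rV[S]_l := \row_j 'X_j ^+ q.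

Lemma frobenius_log : logd u setT frobenius_der.
Proof.
move=> t _; suff -> : vapp frobenius_der (u t) = lf (u t) ^+ q.
  by rewrite -(prednK (ltnW (finNzRing_gt1 F))) exprSr; apply: dividesMl; apply: dividesxx.
have sum_frob (r : seq 'I_l) : (\sum_(j <- r) u t j 0 *: 'X_j : S) ^+ q =
    \sum_(j <- r) u t j 0 *: 'X_j ^+ q.
  elim: r => [|j r IH].
    by rewrite !big_nil expr0n eqn0Ngt (ltnW (finNzRing_gt1 F)).
  rewrite !big_cons (frobenius_add (mpolyC l (R := F))) IH exprZn expf_card //.
by rewrite /lf sum_frob; apply: eq_bigr => j _; rewrite mxE.
Qed.

(* The coefficients g of the Frobenius derivation minus the Euler derivation have
   degrees q - e i and vanish together exactly off the arrangement, where the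
   Bezout bound is attained. *)
Lemma card_complement_free : (forall i, (e i < q)%N) ->
  #|complement_points u| = (\prod_i (q - e i))%N.
Proof.
move=> eq_lt; have q1 := finNzRing_gt1 F.
have [a ea] := saito_criterion ip theta_log c_neq0 theta_det frobenius_log.
have [b eb] := saito_criterion ip theta_log c_neq0 theta_det (@euler_log _ _ _ u setT).
have {}ea := homogeneous_coefficients (d := q) theta_homog _ ea.
have {}eb := homogeneous_coefficients (d := 1%N) theta_homog _ eb.
have {}ea := ea (fun j => _); have {}eb := eb (fun j => _).
pose a' i := if (e i <= q)%N then pihomog mdeg (q - e i) (a i) else 0.
pose b' i := if (e i <= 1)%N then pihomog mdeg (1 - e i) (b i) else 0.
have g_eq j : \sum_i (a' i - b' i) * coefmx theta i j = 'X_j ^+ q - 'X_j.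
  have e1 : frobenius_der 0 j = \sum_i a' i * coefmx theta i j.
    rewrite ea; first by rewrite summxE; apply: eq_bigr => i _; rewrite !mxE.
    by move=> k; rewrite mxE -[X in X.-homog]mul1n; apply: dhomogMn; rewrite dhomogX /= mdeg1.
  have e2 : euler 0 j = \sum_i b' i * coefmx theta i j.
    rewrite eb; first by rewrite summxE; apply: eq_bigr => i _; rewrite !mxE.
    by move=> k; rewrite mxE dhomogX /= mdeg1.
  rewrite !mxE in e1 e2; rewrite e1 e2 -sumrB.
  by apply: eq_bigr => i _; rewrite mulrBl.
have E_pos i : (0 < q - e i)%N by rewrite subn_gt0.
have E_le i : (q - e i <= q)%N by rewrite leq_subr.
have Th_deg i j : (msize (coefmx theta i j) <= (q - (q - e i)).+1)%N.
  by rewrite subKn ?(ltnW (eq_lt i)) // mxE; apply/msize_homog/theta_homog.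
have g_deg i : (msize (a' i - b' i) <= (q - e i).+1)%N.
  apply: leq_trans (msizeD_le _ _) _; rewrite geq_max msizeN /a' /b'.
  rewrite (ltnW (eq_lt i)) (msize_homog (pihomogP _ _ _)) /=; case: ifP => e1; last by rewrite msize0.
  by apply: leq_trans (msize_homog (pihomogP _ _ _)) _; rewrite ltnS leq_sub2r // ltnW.
rewrite -(regular_points_card E_pos E_le Th_deg g_deg g_eq).
pose row_of (v : {ffun 'I_l -> F}) : 'rV[F]_l := \row_j v j.
have row_inj : injective row_of.
  by move=> v w /rowP h; apply/ffunP => j; have := h j; rewrite !mxE.
rewrite -(card_imset _ row_inj); apply: eq_card => v.
have vE (f : S) : f.@[[ffun j => v 0 j]] = f.@[fun j => v 0 j].
  by apply: meval_eq => j; rewrite ffunE.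
(* The determinant is a nonzero multiple of Q, so the matrix is invertible exactly off the
   hyperplanes. *)
have memE : (v \in complement_points u) = (\det (map_mx (meval [ffun j => v 0 j]) (coefmx theta)) != 0).
  rewrite det_map_mx /= theta_det vE mevalZ mulf_eq0 (negPf c_neq0) /=.
  rewrite /qpoly rmorph_prod /= inE; apply/forallP/prodf_neq0 => h t.
    by rewrite lf_eval h.
  by have := h t (in_setT t); rewrite lf_eval.
rewrite memE; apply/idP/imsetP => [h|[w]].
  exists [ffun j => v 0 j]; first by rewrite inE.
  by apply/rowP => j; rewrite mxE ffunE.
rewrite inE => h ev; suff -> : [ffun j => v 0 j] = w by [].
by apply/ffunP => j; rewrite ffunE ev mxE.
Qed.

End FiniteFactorization.

(** * Specialization to finite fields *)

Lemma classical_minimum (P : nat -> Prop) :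
  (exists n, P n) -> exists n, P n /\ forall m, (m < n)%N -> ~ P m.
Proof.
move=> [n]; have [k] := ubnP n; elim: k n => // k IH n ltk Pn.
have [[m [lt_m Pm]]|no] := boolp.EM (exists m, (m < n)%N /\ P m).
  exact: IH (leq_trans lt_m (ltnSE ltk)) Pm.
by exists n; split=> // m lt_m Pm; apply: no; exists m.
Qed.

Lemma pseudo_division (R : idomainType) (p d : {poly R}) : d != 0 ->
  exists k q r, lead_coef d ^+ k *: p = q * d + r /\ (size r < size d)%N.
Proof.
move=> d0; exists (scalp p d), (p %/ d), (p %% d); split.
  exact: Pdiv.Idomain.divp_eq.
by rewrite Pdiv.Idomain.ltn_modpN0.
Qed.

Lemma size_map_poly_leq (R S : nzRingType) (f : R -> S) (p : {poly R}) :
  (size (map_poly f p) <= size p)%N.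
Proof. exact: size_poly. Qed.

(** The top coefficients of [p] that [ev] kills are cut off, so that [ev] preserves the degree of
    what is left. *)
Lemma truncation (R : nzRingType) (K : fieldType) (ev : {rmorphism R -> K}) (p : {poly R}) :
  map_poly ev p != 0 -> exists p1 : {poly R}, [/\ size p1 = size (map_poly ev p),
    map_poly ev p1 = map_poly ev p & ev (lead_coef p1) != 0].
Proof.
move=> p0; set n := size (map_poly ev p); exists (take_poly n p).
have e1 : map_poly ev (take_poly n p) = map_poly ev p.
  apply/polyP => i; rewrite !coef_map /= coef_take_poly; case: ltnP => // le.
  by rewrite rmorph0 -(coef_map ev) nth_default.
have e2 : size (take_poly n p) = n.
  apply/eqP; rewrite eqn_leq size_take_poly /=.
  by rewrite {1}/n -e1 size_map_poly_leq.
split=> //; rewrite lead_coefE e2 -(coef_map ev) e1 -lead_coefE lead_coef_eq0 //.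
Qed.

Lemma quotient_size_lt (x y n : nat) :
  n = (x + y).-1 -> (1 < y)%N -> (y < n)%N -> (x < n)%N.
Proof. by move=> ->; lia. Qed.

(** A form of the Nullstellensatz. The kernel inclusion transports identities; the prescribed
    element [s] carries the induction on variables, in which leading coefficients and constants of
    Bezout identities must survive. *)
Definition specializable (R : idomainType) : Prop :=
  forall (K : fieldType) (ev : {rmorphism R -> K}) (s : R) (N : nat), ev s != 0 ->
  exists (F : finFieldType) (ev' : {rmorphism R -> F}),
    [/\ forall r, ev r = 0 -> ev' r = 0, ev' s != 0 & (N < #|{: F}|)%N].

(** In characteristic p that prime is kept, in characteristic 0 a prime above |s| is taken; a field
    with p^(N+1) elements is large enough. *)
Lemma specializable_int : specializable int.
Proof.
move=> K ev s N evs.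
have evE r : ev r = r%:~R by rewrite -[r in LHS]intz rmorph_int.
have from_prime p : prime p -> ~~ (p %| `|s|)%N -> (forall r, ev r = 0 -> (p %| `|r|)%N) ->
    exists (F : finFieldType) (ev' : {rmorphism int -> F}),
    [/\ forall r, ev r = 0 -> ev' r = 0, ev' s != 0 & (N < #|{: F}|)%N].
  move=> pp ps pker; have [F pF cF] := pPrimePowerField pp (ltn0Sn N).
  exists F, (intmul 1).
  have F0 r : (r%:~R == 0 :> F) = (p %| `|r|)%N.
    by case: (intP r) => [|k|k]; rewrite ?(dvdn_pcharf pF) ?rmorphN ?oppr_eq0 ?abszN //=
       ?eqxx ?dvdn0 // -?(dvdn_pcharf pF).
  split=> [r /pker r0||]; first by apply/eqP; rewrite F0.
    by rewrite F0.
  by rewrite cF (leq_trans (ltn_expl N (prime_gt1 pp))) // leq_exp2l ?prime_gt1.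
have natE r : (ev r == 0) = (`|r|%:R == 0 :> K).
  rewrite evE; case: (intP r) => [|k|k] //; by rewrite rmorphN oppr_eq0 abszN.
have [[p pK]|noch] := boolp.EM (exists p, p \in [pchar K]).
  apply: (from_prime p (pcharf_prime pK)); first by rewrite (dvdn_pcharf pK) -natE.
  by move=> r /eqP; rewrite natE -(dvdn_pcharf pK).
have ch0 n : (n%:R == 0 :> K) = (n == 0).
  case: n => [|n]; first by rewrite eqxx.
  apply/negbTE/negP => n0; have [p pK] := natf0_pchar (ltn0Sn n) n0.
  by apply: noch; exists p.
have [p lt_p pp] := prime_above `|s|.
apply: (from_prime p pp).
  have spos : (0 < `|s|)%N by rewrite lt0n -ch0 -natE.
  by apply/negP => /(dvdn_leq spos); rewrite leqNgt lt_p.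
by move=> r /eqP; rewrite natE ch0 => /eqP ->.
Qed.

Lemma finite_root_extension (F : finFieldType) (p : {poly F}) : (1 < size p)%N ->
  exists (F' : finFieldType) (i : {rmorphism F -> F'}) (b : F'), root (map_poly i p) b.
Proof.
move=> p1; have p0 : p != 0 by rewrite -size_poly_gt0 ltnW.
have [L [zs pzs _]] := FinSplittingFieldFor p0.
have szz : (1 < size (\prod_(z <- zs) ('X - z%:P))%R)%N.
  by rewrite -(eqp_size pzs) size_map_poly.
case: zs pzs szz => [|z zs] pzs; first by rewrite big_nil size_poly1.
move=> _; exists (FinFieldExtType L), (in_alg L), z.
suff : root (map_poly (in_alg L) p) z by [].
by rewrite (eqp_root pzs) big_cons rootM root_XsubC eqxx.
Qed.

Lemma specializable_poly (R : idomainType) : specializable R -> specializable {poly R}.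
Proof.
move=> HR K ev s N evs; pose ev0 : {rmorphism R -> K} := ev \o polyC.
pose a := ev 'X.
have evE p : ev p = (map_poly ev0 p).[a].
  elim/poly_ind: p => [|p c IH]; first by rewrite !rmorph0 horner0.
  rewrite !rmorphD !rmorphM /= IH map_polyX map_polyC hornerD hornerM.
  by rewrite hornerX hornerC.
have ev0E c : ev0 c = ev c%:P by [].
(* If X has transcendental image, the kernel of [ev] is described coefficientwise and X may go to
   any nonroot of the image of [s]; one exists once the field has more elements than the size of
   [s]. *)
have [[m0 [evm0 m0n0]]|transc] := boolp.EM (exists p, ev p = 0 /\ map_poly ev0 p != 0); last first.
  have sn0 : map_poly ev0 s != 0 by apply: contraNneq evs => s0; rewrite evE s0 horner0.
  have [i si] : exists i, ev0 s`_i != 0.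
    exists (size (map_poly ev0 s)).-1; rewrite -(coef_map ev0) -lead_coefE.
    by rewrite lead_coef_eq0.
  have [F [f [fker fs lt]]] := HR K ev0 s`_i (N + size s)%N si.
  have fsn0 : map_poly f s != 0.
    by apply: contraNneq fs => s0; rewrite -(coef_map f) s0 coef0.
  have [b nb] : exists b, ~~ root (map_poly f s) b.
    apply/existsP; rewrite -negb_forall; apply/negP => /forallP allr.
    have := max_poly_roots fsn0 (rs := enum F) _ (enum_uniq F).
    rewrite -cardE => h; have := h _; rewrite ltnNge => /(_ _)/negP; apply.
      by apply/allP => x _; apply: allr.
    apply: leq_trans (size_map_poly_leq f s) _; apply: leq_trans (ltnW lt).
    exact: leq_addl.
  exists F, (horner_morph (fun x => mulrC b (f x))); split.
  - move=> p evp; rewrite -[LHS]/((map_poly f p).[b]).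
    suff -> : map_poly f p = 0 by rewrite horner0.
    have p0 : map_poly ev0 p = 0.
      by apply/eqP; apply: contraT => pn0; case: transc; exists p.
    by apply/polyP => j; rewrite coef_map coef0 /=; apply: fker; rewrite -(coef_map ev0) p0 coef0.
  - exact: nb.
  - by apply: leq_ltn_trans lt; apply: leq_addr.
(* In the algebraic case a relation of least degree plays the part of a minimal polynomial of the
   image of X over the fractions of the image of [R]. *)
pose P n := exists p, [/\ ev p = 0, map_poly ev0 p != 0 & size (map_poly ev0 p) = n].
have [|n [[m [evm mn0 szm]] mmin]] := classical_minimum (P := P).
  by exists (size (map_poly ev0 m0)), m0.
have minimal p : ev p = 0 -> (size (map_poly ev0 p) < n)%N -> map_poly ev0 p = 0.
  move=> evp lt; apply/eqP; apply: contraT => pn0; case: (mmin _ lt).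
  by exists p.
have [m1 [sz1 e1 lc1]] := truncation mn0; rewrite szm in sz1.
have evm1 : ev m1 = 0 by rewrite evE e1 -evE.
have m1n0 : m1 != 0 by apply: contraNneq lc1 => ->; rewrite lead_coef0 rmorph0.
have n1 : (1 < n)%N.
  rewrite ltnNge -sz1; apply/negP => /size1_polyC m1C; move: lc1.
  by rewrite m1C lead_coefC ev0E -m1C evm1 eqxx.
have szle p : (size (map_poly ev0 p) <= size p)%N by apply: size_map_poly_leq.
(* Euclid's algorithm with pseudo-division: modulo [m1] and the kernel of [ev0], every [t] that [ev]
   does not kill divides a constant that survives. *)
have bezout t : ev t != 0 -> exists U V r, ev0 r != 0 /\
    map_poly ev0 (U * t + V * m1 - r%:P) = 0.
  have [k] := ubnP (size (map_poly ev0 t)); elim: k t => // k IH t ltk evt.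
  case: (leqP n (size (map_poly ev0 t))) => [le|lt_t].
    have [j [Q [r [eQ szr]]]] := pseudo_division t m1n0.
    have evr : ev r != 0.
      have := congr1 ev eQ; rewrite rmorphD rmorphM /= evm1 mulr0 add0r => <-.
      rewrite -mul_polyC rmorphM /= mulf_neq0 // -ev0E rmorphXn expf_neq0 //.
    have [|U [V [c [c0 eU]]]] := IH r _ evr.
      apply: leq_trans (ltnSE ltk); apply: leq_ltn_trans (szle r) _.
      by apply: leq_trans szr _; rewrite sz1.
    exists (lead_coef m1 ^+ j *: U), (V - U * Q), c; split=> //.
    rewrite -eU; congr (map_poly _ (_ - _)); rewrite -scalerAl scalerAr eQ; ring.
  have tn0 : map_poly ev0 t != 0 by apply: contraNneq evt => t0; rewrite evE t0 horner0.
  have [t1 [szt1 et1 lct1]] := truncation tn0.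
  case: (ltnP 1 (size (map_poly ev0 t))) => [gt1|le1]; last first.
    have /size1_polyC t1C : (size t1 <= 1)%N by rewrite szt1.
    exists 1, 0, t1`_0; split; first by move: lct1; rewrite t1C lead_coefC coefC.
    by rewrite mul1r mul0r addr0 rmorphB /= -t1C et1 subrr.
  have t1n0 : t1 != 0 by apply: contraNneq lct1 => ->; rewrite lead_coef0 rmorph0.
  have [j [Q [r [eQ szr]]]] := pseudo_division m1 t1n0.
  have evt1 : ev t1 = ev t by rewrite !evE et1.
  (* Otherwise minimality kills all coefficients of [Q], and a surviving multiple of [m1] has the
     same image as [r], which is too short. *)
  have evQ : ev Q != 0.
    apply/negP => /eqP evQ0; have Q0 : map_poly ev0 Q = 0.
      apply: minimal => //; apply: leq_ltn_trans (szle Q) _.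
      have [->|Qn0] := eqVneq Q 0; first by rewrite size_poly0 ltnW.
      have szQ : size (Q * t1) = n.
        have -> : Q * t1 = lead_coef t1 ^+ j *: m1 - r by rewrite eQ addrK.
        have lcn0 : lead_coef t1 ^+ j != 0 by rewrite expf_neq0 // lead_coef_eq0.
        rewrite size_polyDl size_scale // ?sz1 // size_polyN.
        by apply: leq_trans szr _; rewrite szt1 ltnW.
      have := size_mul Qn0 t1n0; rewrite szQ szt1 => szn.
      exact: quotient_size_lt szn gt1 lt_t.
    have := congr1 (map_poly ev0) eQ.
    rewrite rmorphD rmorphM /= Q0 mul0r add0r => e3.
    have : size (map_poly ev0 (lead_coef t1 ^+ j *: m1)) = n.
      rewrite -mul_polyC rmorphM /= map_polyC /= mul_polyC size_scale ?rmorphXn ?expf_neq0 //.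
      by rewrite e1 szm.
    rewrite e3 => szr2; have := szle r; rewrite szr2 leqNgt.
    by rewrite (ltn_trans szr) // szt1.
  have evr : ev r != 0.
    have := congr1 ev eQ; rewrite -mul_polyC !rmorphD !rmorphM /= evm1 mulr0 => /esym/eqP.
    rewrite addrC addr_eq0 => /eqP ->; rewrite oppr_eq0 mulf_neq0 // evt1 //.
  have [|U [V [c [c0 eU]]]] := IH r _ evr.
    apply: leq_trans (ltnSE ltk); apply: leq_ltn_trans (szle r) _.
    by rewrite -szt1.
  exists (- U * Q), (V + lead_coef t1 ^+ j *: U), c; split=> //.
  rewrite -eU.
  have -> : U * r = - U * Q * t1 + lead_coef t1 ^+ j *: U * m1.
    rewrite -scalerAl scalerAr eQ; ring.
  rewrite !(rmorphB, rmorphD, rmorphM) /= et1; ring.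
have [U [V [rho [rho0 eU]]]] := bezout s evs.
(* [R] is specialized so that two elements survive: the leading coefficient of [m1], which leaves
   [m1] a root in an extension as image of X, and the constant [rho], which keeps [s] nonzero. *)
have lr0 : ev0 (lead_coef m1 * rho) != 0 by rewrite rmorphM mulf_neq0.
have [F [f [fker flr ltN]]] := HR K ev0 _ N lr0.
have fl0 : f (lead_coef m1) != 0 by apply: contraNneq flr => e; rewrite rmorphM e mul0r.
have fr0 : f rho != 0 by apply: contraNneq flr => e; rewrite rmorphM e mulr0.
have szf : size (map_poly f m1) = n.
  by rewrite size_map_poly_id0.
have [|F' [i [b rb]]] := @finite_root_extension F (map_poly f m1); first by rewrite szf.
pose f' : {rmorphism R -> F'} := i \o f.
pose g : {rmorphism {poly R} -> F'} := horner_morph (fun x => mulrC b (f' x)).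
have gE p : g p = (map_poly f' p).[b] by [].
have f'0 c : ev0 c = 0 -> f' c = 0 by move=> /fker fc; rewrite /f' /= fc rmorph0.
have gker0 p : map_poly ev0 p = 0 -> g p = 0.
  move=> p0; rewrite gE; suff -> : map_poly f' p = 0 by rewrite horner0.
  by apply/polyP => j; rewrite coef_map coef0; apply: f'0; rewrite -(coef_map ev0) p0 coef0.
have gm1 : g m1 = 0.
  by rewrite gE map_poly_comp; apply/eqP.
have f'n0 c : f c != 0 -> f' c != 0 by move=> fc; rewrite /f' /= fmorph_eq0.
exists F', g; split.
- move=> p evp; have [j [Q [r [eQ szr]]]] := pseudo_division p m1n0.
  have evr : ev r = 0.
    have := congr1 ev eQ; rewrite -mul_polyC rmorphD !rmorphM /= evm1 evp !mulr0 add0r.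
    by move=> <-.
  have r0 : map_poly ev0 r = 0.
    by apply: minimal => //; apply: leq_ltn_trans (szle r) _; rewrite -sz1.
  have := congr1 g eQ; rewrite -mul_polyC rmorphD !rmorphM /= gm1 (gker0 r r0) mulr0 addr0.
  move/eqP; rewrite mulf_eq0 => /orP[|/eqP //].
  by rewrite horner_morphC rmorphXn expf_eq0 (negPf (f'n0 _ fl0)) andbF.
- have := gker0 _ eU; rewrite rmorphB rmorphD !rmorphM /= gm1 mulr0 addr0 horner_morphC.
  move/eqP; rewrite subr_eq0 => /eqP e; apply: contraTneq (f'n0 _ fr0) => gs0.
  by rewrite -e gs0 mulr0 eqxx.
- by apply: leq_trans ltN _; apply: leq_card (fmorph_inj i).
Qed.

(* Finitely many elements of K lie in the image of an iterated polynomial ring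
   over Z, which can then be specialized to arbitrarily large finite fields. *)
Lemma specialization (K : fieldType) (s : seq K) (N : nat) :
  exists (R : idomainType) (ev : {rmorphism R -> K}) (F : finFieldType)
    (ev' : {rmorphism R -> F}),
    [/\ forall x, x \in s -> exists r, ev r = x,
        forall r, ev r = 0 -> ev' r = 0 & (N < #|{: F}|)%N].
Proof.
have [R [HR [ev himg]]] : exists R : idomainType, specializable R /\
    exists ev : {rmorphism R -> K}, forall x, x \in s -> exists r, ev r = x.
  elim: s => [|x s [R [HR [ev IH]]]].
    by exists int; split; [exact: specializable_int|exists (intmul 1)].
  exists {poly R}; split; first exact: specializable_poly.
  exists (horner_morph (fun c => mulrC x (ev c))) => y; rewrite inE => /orP[/eqP ->|/IH[r <-]].
    by exists 'X; apply: horner_morphX.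
  by exists r%:P; apply: horner_morphC.
have [|F [ev' [h1 _ h3]]] := HR K ev 1 N; first by rewrite rmorph1 oner_eq0.
by exists R, ev, F, ev'.
Qed.

(** * Factorization of the characteristic polynomial *)

Section Push.
Variables (R : idomainType) (L : fieldType) (f : {rmorphism R -> L}) (l : nat).
Local Notation mf := (map_mpoly f).

(** Counterparts of [lf], [vapp] and [selmx] over the domain [R], whose images under both
    evaluations are compared. *)
Definition rlf (v : 'cV[R]_l) : {mpoly R[l]} := \sum_j v j 0 *: 'X_j.

Definition rapp (p : 'rV[{mpoly R[l]}]_l) (v : 'cV[R]_l) : {mpoly R[l]} :=
  \sum_j v j 0 *: p 0 j.

Definition rselmx (T : finType) (v : T -> 'cV[R]_l) (B : {set T}) : 'M[R]_(l, #|T|) :=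
  \matrix_(j, i) (if enum_val i \in B then v (enum_val i) j 0 else 0).

Lemma map_rlf v : mf (rlf v) = lf (map_mx f v).
Proof.
rewrite /rlf raddf_sum; apply: eq_bigr => j _ /=.
by rewrite map_mpolyZ map_mpolyX mxE.
Qed.

Lemma map_rapp p v : mf (rapp p v) = vapp (map_mx mf p) (map_mx f v).
Proof.
rewrite /rapp raddf_sum; apply: eq_bigr => j _ /=.
by rewrite map_mpolyZ !mxE.
Qed.

Lemma map_rselmx (T : finType) (v : T -> 'cV[R]_l) B :
  map_mx f (rselmx v B) = selmx (fun t => map_mx f (v t)) B.
Proof. by apply/matrixP => i j; rewrite !mxE; case: ifP => _; rewrite ?mxE ?rmorph0. Qed.

Lemma map_rqpoly (T : finType) (v : T -> 'cV[R]_l) :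
  mf (\prod_t rlf (v t)) = qpoly (fun t => map_mx f (v t)) setT.
Proof.
rewrite rmorph_prod; apply: eq_big => [t|t _]; first by rewrite in_setT.
exact: map_rlf.
Qed.

End Push.

Section Kernel.
Variables (R : idomainType) (K F : fieldType).
Variables (ev : {rmorphism R -> K}) (ev' : {rmorphism R -> F}).
Hypothesis ker : forall r, ev r = 0 -> ev' r = 0.

Lemma transfer_scalar x y : ev x = ev y -> ev' x = ev' y.
Proof. by move=> e; apply: subr0_eq; rewrite -rmorphB; apply: ker; rewrite rmorphB /= e subrr. Qed.

Lemma transfer_mx m n (A B : 'M[R]_(m, n)) :
  map_mx ev A = map_mx ev B -> map_mx ev' A = map_mx ev' B.
Proof.
move=> /matrixP e; apply/matrixP => i j; rewrite !mxE; apply: transfer_scalar.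
by have := e i j; rewrite !mxE.
Qed.

Lemma transfer_mpoly n (p q : {mpoly R[n]}) :
  map_mpoly ev p = map_mpoly ev q -> map_mpoly ev' p = map_mpoly ev' q.
Proof.
move=> e; apply/mpolyP => m; rewrite !mcoeff_map_mpoly; apply: transfer_scalar.
by rewrite -!mcoeff_map_mpoly e.
Qed.

End Kernel.

Section Lift.
Variables (R : idomainType) (K : fieldType) (ev : {rmorphism R -> K}) (sg : K -> R).

Lemma lift_mx m n (A : 'M[K]_(m, n)) : (forall i j, ev (sg (A i j)) = A i j) ->
  map_mx ev (map_mx sg A) = A.
Proof. by move=> h; apply/matrixP => i j; rewrite !mxE. Qed.

Definition lift_mpoly n (p : {mpoly K[n]}) : {mpoly R[n]} :=
  \sum_(m <- msupp p) sg p@_m *: 'X_[m].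

Lemma lift_mpolyK n (p : {mpoly K[n]}) : (forall m, m \in msupp p -> ev (sg p@_m) = p@_m) ->
  map_mpoly ev (lift_mpoly p) = p.
Proof.
move=> h; rewrite [RHS]mpolyE /lift_mpoly raddf_sum big_seq [RHS]big_seq.
by apply: eq_bigr => m /h e; rewrite /= map_mpolyZ map_mpolyX e.
Qed.

Lemma lift_mpoly_homog n d (p : {mpoly K[n]}) : p \is d.-homog -> lift_mpoly p \is d.-homog.
Proof.
move=> hp; rewrite /lift_mpoly big_seq; apply: rpred_sum => m mp; apply: rpredZ.
by rewrite dhomogX; apply/eqP/(dhomog_mf hp).
Qed.

End Lift.

Lemma map_mpoly_homog (R S : nzRingType) (f : {rmorphism R -> S}) n d (p : {mpoly R[n]}) :
  p \is d.-homog -> map_mpoly f p \is d.-homog.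
Proof.
move=> hp; apply/dhomogP => m; rewrite mcoeff_msupp mcoeff_map_mpoly => nz.
apply: (dhomog_mf hp); rewrite mcoeff_msupp; by apply: contraNneq nz => e; apply/eqP; rewrite -(rmorph0 f); congr (f _).
Qed.

Definition mcoefs (K : nzRingType) n (p : {mpoly K[n]}) : seq K := [seq p@_m | m <- msupp p].

Definition mxcoefs (K : Type) m n (A : 'M[K]_(m, n)) : seq K :=
  [seq A ij.1 ij.2 | ij <- enum {: 'I_m * 'I_n}].

Definition allof (K : eqType) (I : finType) (f : I -> seq K) : seq K :=
  flatten [seq f i | i <- enum I].

Lemma mem_allof (K : eqType) (I : finType) (f : I -> seq K) i x :
  x \in f i -> x \in allof f.
Proof. by move=> xf; apply/flattenP; exists (f i) => //; apply: map_f; rewrite mem_enum. Qed.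

Lemma mem_mxcoefs (K : eqType) m n (A : 'M[K]_(m, n)) i j : A i j \in mxcoefs A.
Proof. by apply/mapP; exists (i, j); rewrite ?mem_enum. Qed.

Lemma section_of_cover (R : Type) (K : eqType) (ev : R -> K) (s : seq K) (r0 : R) :
  (forall x, x \in s -> exists r, ev r = x) ->
  exists sg : K -> R, forall x, x \in s -> ev (sg x) = x.
Proof.
elim: s => [|x s IH] h; first by exists (fun=> r0).
have [|sg hsg] := IH; first by move=> y ys; apply: h; rewrite inE ys orbT.
have [r er] := h x (mem_head _ _).
exists (fun y => if y == x then r else sg y) => y; rewrite inE.
by case: eqP => [-> //|_] /= /hsg.
Qed.

(** A factorization with explicit inverses certifies the rank by equations. These survive
    specialization, whereas a kernel inclusion alone does not keep minors nonzero. *)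
Lemma rank_normal_form (K : fieldType) m n r (A : 'M[K]_(m, n)) (P P' : 'M[K]_m) (Q Q' : 'M[K]_n) :
  P *m P' = 1%:M -> Q *m Q' = 1%:M -> (r <= m)%N -> (r <= n)%N ->
  A = P *m pid_mx r *m Q -> \rank A = r.
Proof.
move=> hP hQ rm rn ->.
have Pu : P \in unitmx by case/mulmx1_unit: hP.
have Qu : Q \in unitmx by case/mulmx1_unit: hQ.
rewrite mxrankMfree ?row_free_unit //.
by rewrite -mxrank_tr trmx_mul mxrankMfree ?row_free_unit ?unitmx_tr // mxrank_tr rank_pid_mx.
Qed.

Section Factorization.
Context {K : fieldType} {l : nat} {T : finType}.
Local Notation S := {mpoly K[l]}.
Variable u : T -> 'cV[K]_l.
Hypothesis ip : independent_pairs u setT.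
Variables (e : 'I_l -> nat) (theta : 'I_l -> 'rV[S]_l) (c : K).
Hypothesis theta_log : forall i, logd u setT (theta i).
Hypothesis theta_homog : forall i, der_homog (e i) (theta i).
Hypothesis c_neq0 : c != 0.
Hypothesis theta_det : \det (coefmx theta) = c *: qpoly u setT.

Lemma whitney_values (N : nat) : exists2 q : nat, (N < q)%N &
  (\sum_(B : {set T}) (-1) ^+ #|B| * (q ^ (l - \rank (selmx u B)))%:Z =
   \prod_i (q%:Z - (e i)%:Z))%R.
Proof.
(* Every hypothesis becomes equations with finitely many coefficients: quotients [h] for being
   logarithmic, dual vectors [w] for pairwise independence, [c^-1] for [c != 0], elimination
   matrices and their inverses for ranks. *)
have h0 (it : 'I_l * T) : exists x, vapp (theta it.1) (u it.2) = x * lf (u it.2).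
  by case: it => i t; apply: theta_log.
have [h eh] := fin_all_exists h0.
have w0 (tt : T * T) : exists w : 'rV[K]_l,
    pairing w (u tt.1) = 1 /\ (tt.1 != tt.2 -> pairing w (u tt.2) = 0).
  case: tt => t t' /=.
  case: (eqVneq t t') => [<-|nt].
    by have [w0 e0] := pairing_exists (ip.1 t (in_setT t)); exists w0.
  have [|w0 [e1 e2]] := @dual_vector _ _ (u t) (u t') (ip.1 t' (in_setT t')).
    move=> d ed; have := ip.2 t' t d (in_setT _) (in_setT _) ed.
    by move=> tt; rewrite tt eqxx in nt.
  by exists w0.
have [w ew] := fin_all_exists w0.
pose P B := col_ebase (selmx u B); pose Q B := row_ebase (selmx u B).
pose s : seq K := [:: c; c^-1] ++ allof (fun t => mxcoefs (u t)) ++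
  allof (fun ij : 'I_l * 'I_l => mcoefs (theta ij.1 0 ij.2)) ++
  allof (fun it => mcoefs (h it)) ++ allof (fun tt => mxcoefs (w tt)) ++
  allof (fun B => mxcoefs (P B)) ++ allof (fun B => mxcoefs (invmx (P B))) ++
  allof (fun B => mxcoefs (Q B)) ++ allof (fun B => mxcoefs (invmx (Q B))).
have [R [ev [F [ev' [himg ker ltq]]]]] := specialization s (N + \sum_i e i)%N.
have [sg hsg] := section_of_cover (0 : R) himg.
exists #|{: F}|; first exact: leq_ltn_trans (leq_addr _ _) ltq.
have elt i : (e i < #|{: F}|)%N.
  apply: leq_ltn_trans ltq; rewrite (bigD1 i) //= addnCA; exact: leq_addr.
have sc : ev (sg c) = c by apply: hsg; rewrite !inE eqxx.
have sc' : ev (sg c^-1) = c^-1 by apply: hsg; rewrite !inE eqxx orbT.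
have su t : map_mx ev (map_mx sg (u t)) = u t.
  apply: lift_mx => i j; apply: hsg; rewrite !mem_cat.
  by rewrite (@mem_allof _ _ (fun t => mxcoefs (u t)) t) ?mem_mxcoefs // !orbT.
have sth i j : map_mpoly ev (lift_mpoly sg (theta i 0 j)) = theta i 0 j.
  apply: lift_mpolyK => m mp; apply: hsg; rewrite !mem_cat.
  rewrite (@mem_allof _ _ (fun ij : 'I_l * 'I_l => mcoefs (theta ij.1 0 ij.2)) (i, j)) ?orbT //.
  exact: map_f.
have sh it : map_mpoly ev (lift_mpoly sg (h it)) = h it.
  apply: lift_mpolyK => m mp; apply: hsg; rewrite !mem_cat.
  rewrite (@mem_allof _ _ (fun it => mcoefs (h it)) it) ?orbT //.
  exact: map_f.
have sw tt : map_mx ev (map_mx sg (w tt)) = w tt.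
  apply: lift_mx => i j; apply: hsg; rewrite !mem_cat.
  by rewrite (@mem_allof _ _ (fun tt => mxcoefs (w tt)) tt) ?mem_mxcoefs // !orbT.
have sP B : map_mx ev (map_mx sg (P B)) = P B.
  apply: lift_mx => i j; apply: hsg; rewrite !mem_cat.
  by rewrite (@mem_allof _ _ (fun B => mxcoefs (P B)) B) ?mem_mxcoefs // !orbT.
have sP' B : map_mx ev (map_mx sg (invmx (P B))) = invmx (P B).
  apply: lift_mx => i j; apply: hsg; rewrite !mem_cat.
  by rewrite (@mem_allof _ _ (fun B => mxcoefs (invmx (P B))) B) ?mem_mxcoefs // !orbT.
have sQ B : map_mx ev (map_mx sg (Q B)) = Q B.
  apply: lift_mx => i j; apply: hsg; rewrite !mem_cat.
  by rewrite (@mem_allof _ _ (fun B => mxcoefs (Q B)) B) ?mem_mxcoefs // !orbT.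
have sQ' B : map_mx ev (map_mx sg (invmx (Q B))) = invmx (Q B).
  apply: lift_mx => i j; apply: hsg; rewrite !mem_cat.
  by rewrite (@mem_allof _ _ (fun B => mxcoefs (invmx (Q B))) B) ?mem_mxcoefs // !orbT.
pose uR t := map_mx sg (u t); pose uF t := map_mx ev' (uR t).
pose thR i : 'rV[{mpoly R[l]}]_l := \row_j lift_mpoly sg (theta i 0 j).
pose thF i := map_mx (map_mpoly ev') (thR i).
pose cF := ev' (sg c).
have sthR i : map_mx (map_mpoly ev) (thR i) = theta i.
  by apply/rowP => j; rewrite !mxE sth.
have ltu : (fun t => map_mx ev (uR t)) =1 u by move=> t; apply: su.
have cF0 : cF != 0.
  have : ev' (sg c * sg c^-1) = ev' 1.
    by apply: (transfer_scalar ker); rewrite rmorphM /= sc sc' divff // rmorph1.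
  rewrite rmorphM rmorph1 /= => e1; apply/eqP => c0.
  by move/eqP: e1; rewrite -/cF c0 mul0r eq_sym oner_eq0.
have pF tt : pairing (map_mx ev' (map_mx sg (w tt))) (uF tt.1) = 1.
  have e1 : map_mx ev (map_mx sg (w tt) *m uR tt.1) = map_mx ev 1%:M.
    rewrite map_mxM sw su map_mx1; apply/matrixP => i j; rewrite !ord1.
    by rewrite [LHS](ew tt).1 mxE.
  have := transfer_mx ker e1; rewrite map_mxM map_mx1 => /matrixP/(_ 0 0).
  by rewrite /pairing => ->; rewrite mxE.
have pF0 tt : tt.1 != tt.2 -> pairing (map_mx ev' (map_mx sg (w tt))) (uF tt.2) = 0.
  move=> nt; have e1 : map_mx ev (map_mx sg (w tt) *m uR tt.2) = map_mx ev 0.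
    rewrite map_mxM sw su map_mx0; apply/matrixP => i j; rewrite !ord1.
    by rewrite [LHS]((ew tt).2 nt) mxE.
  have := transfer_mx ker e1; rewrite map_mxM map_mx0 => /matrixP/(_ 0 0).
  by rewrite /pairing => ->; rewrite mxE.
have ipF : independent_pairs uF setT.
  split=> [t _|t t' d _ _ ed].
    by apply: contra_eq_neq (pF (t, t)) => /= ->; rewrite raddf0 eq_sym oner_eq0.
  apply/eqP; apply: contraT => nt; have := pF (t', t); rewrite /= ed linearZ /=.
  by rewrite (pF0 (t', t)) // mulr0 => /esym/eqP; rewrite oner_eq0.
have logF i : logd uF setT (thF i).
  move=> t _; exists (map_mpoly ev' (lift_mpoly sg (h (i, t)))).
  rewrite -map_rapp -map_rlf -rmorphM; apply: (transfer_mpoly ker).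
  by rewrite map_rapp rmorphM /= map_rlf sthR su sh -eh.
have homF i : der_homog (e i) (thF i).
  by move=> j; rewrite !mxE; apply/map_mpoly_homog/lift_mpoly_homog/theta_homog.
have detF : \det (coefmx thF) = cF *: qpoly uF setT.
  pose M : 'M[{mpoly R[l]}]_l := \matrix_(i, j) thR i 0 j.
  have -> : coefmx thF = map_mx (map_mpoly ev') M by apply/matrixP => i j; rewrite !mxE.
  rewrite det_map_mx -map_rqpoly -map_mpolyZ; apply: (transfer_mpoly ker).
  rewrite map_mpolyZ map_rqpoly -det_map_mx sc.
  have -> : map_mx (map_mpoly ev) M = coefmx theta.
    by apply/matrixP => i j; rewrite !mxE sth.
  rewrite theta_det; congr (_ *: _); apply: eq_bigr => t _.
  by rewrite su.
have rankF B : \rank (selmx uF B) = \rank (selmx u B).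
  have hP : map_mx ev' (map_mx sg (P B)) *m map_mx ev' (map_mx sg (invmx (P B))) = 1%:M.
    rewrite -map_mxM -(map_mx1 ev'); apply: (transfer_mx ker).
    by rewrite map_mxM sP sP' map_mx1 mulmxV ?col_ebase_unit.
  have hQ : map_mx ev' (map_mx sg (Q B)) *m map_mx ev' (map_mx sg (invmx (Q B))) = 1%:M.
    rewrite -map_mxM -(map_mx1 ev'); apply: (transfer_mx ker).
    by rewrite map_mxM sQ sQ' map_mx1 mulmxV ?row_ebase_unit.
  apply: (rank_normal_form hP hQ); [exact: rank_leq_row|exact: rank_leq_col|].
  rewrite -map_rselmx -(map_pid_mx ev') -!map_mxM; apply: (transfer_mx ker).
  rewrite map_rselmx !map_mxM map_pid_mx sP sQ mulmx_ebase.
  by apply/matrixP => i j; rewrite [LHS]mxE [RHS]mxE su.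
have := card_complement_points uF; rewrite (card_complement_free ipF logF homF cF0 detF elt).
under [X in _ = X -> _]eq_bigr => B _ do rewrite rankF.
move=> <-; rewrite -natz natr_prod; apply: eq_bigr => i _.
by rewrite natz -subzn // ltnW.
Qed.

Lemma poly_eq_on_large (p1 p2 : {poly int}) :
  (forall N : nat, exists2 q : nat, (N < q)%N & p1.[q%:Z] = p2.[q%:Z]) -> p1 = p2.
Proof.
move=> hp; apply/eqP; rewrite -subr_eq0; apply: contraT => n0.
have [rs [urs szrs allrs]] : exists rs : seq nat, [/\ uniq rs, size rs = size (p1 - p2) &
    all (fun q => root (p1 - p2) q%:Z) rs].
  elim: (size (p1 - p2)) => [|k [rs [urs <- ars]]]; first by exists [::].
  have [q ltq eq] := hp (\sum_(x <- rs) x)%N.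
  exists (q :: rs) => /=; rewrite urs ars !andbT; split=> //.
    apply/negP => qrs; move: ltq; rewrite (big_rem _ qrs) /=.
    by rewrite ltnNge leq_addr.
  by rewrite rootE hornerD hornerN eq subrr.
have := max_poly_roots n0 (rs := map Posz rs); rewrite all_map size_map szrs ltnn.
by apply=> //; rewrite map_inj_uniq // => x y [].
Qed.

Lemma free_whitney :
  \sum_(B : {set T}) ((-1) ^+ #|B|)%:P * 'X^(l - \rank (selmx u B)) =
  \prod_i ('X - ((e i)%:Z)%:P) :> {poly int}.
Proof.
apply: poly_eq_on_large => N; have [q ltq eq] := whitney_values N; exists q => //.
rewrite horner_sum horner_prod; move: eq.
under [X in _ -> _ = X]eq_bigr => i _ do rewrite !hornerE.
move=> <-; apply: eq_bigr => B _; rewrite hornerM hornerC hornerXn.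
by rewrite -!natz natrX.
Qed.

End Factorization.

(** * Resolution of the deletion *)

Section RestrictionTransversal.
Context {K : fieldType} {l : nat}.
Variable A : subspaces K l.
Variable u : A -> 'cV[K]_l.
Hypothesis un0 : forall t, u t != 0.
Hypothesis ker_u : forall (t : A) x, (x \in val t) = (pairing x (u t) == 0).
Variables (h : A) (w : 'rV[K]_l).
Hypothesis wh : pairing w (u h) = 1.

Let ip := normals_independent un0 ker_u.
Let trace (t : A) : {vspace 'rV[K]_l} := (val t :&: val h)%VS.

Lemma mem_trace t x : (x \in trace t) = (pairing x (u h) == 0) && (pairing x (restr u h w t) == 0).
Proof.
rewrite memv_cap !ker_u andbC; case: eqP => //= e.
by rewrite raddfB /= linearZ /= e mulr0 subr0.
Qed.

Lemma trace_restr t t' : t != h -> trace t = trace t' ->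
  exists c, restr u h w t' = c *: restr u h w t.
Proof.
move=> th et; apply: same_kernel_prop; first exact: restr_neq0.
move=> x xt; pose y := - pairing x (u h) *: w + x.
have yE v : pairing y v = - pairing x (u h) * pairing w v + pairing x v by apply: pairing_lin.
have : y \in trace t.
  by rewrite mem_trace !yE wh pairing_restr // xt mulr0 mulr1 addNr addr0 eqxx.
by rewrite et mem_trace => /andP[_]; rewrite yE pairing_restr // mulr0 add0r => /eqP.
Qed.

Lemma restr_trace t t' c : t' != h ->
  restr u h w t' = c *: restr u h w t -> trace t = trace t'.
Proof.
move=> t'h e; apply/vspaceP => x; rewrite !mem_trace e linearZ /= mulf_eq0.
suff -> : c == 0 = false by [].
apply/negbTE/eqP => c0; have := restr_neq0 w ip t'h.
by rewrite e c0 scale0r eqxx.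
Qed.

Lemma restriction_transversal : exists R : {set A},
  [/\ R \subset [set~ h], independent_pairs (restr u h w) R,
      forall t, t != h -> exists r, r \in R /\ exists c, restr u h w t = c *: restr u h w r
    & #|R| = #|` restriction A (val h)|].
Proof.
(* [pk] depends on the trace alone; [R] collects the elements picked for their own trace, one in
   each fibre. *)
pose pk (X : {vspace 'rV[K]_l}) := [pick t | (t != h) && (trace t == X)].
pose R := [set t : A | (t != h) && (pk (trace t) == Some t)].
have Rh r : r \in R -> r != h by rewrite inE => /andP[].
have Rinj : {in R &, injective trace}.
  move=> r r'; rewrite !inE => /andP[_ /eqP e] /andP[_ /eqP e'] et.
  by move: e; rewrite et e' => -[].
have cover t : t != h -> exists2 r, r \in R & trace r = trace t.
  move=> th; have : pk (trace t) = pk (trace t) by [].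
  rewrite {1}/pk; case: pickP => [r /andP[rh /eqP er] e|/(_ t)]; last by rewrite th eqxx.
  by exists r => //; rewrite inE rh er -e eqxx.
exists R; split.
- by apply/subsetP => r /Rh; rewrite !inE.
- split=> [r /Rh|r r' c rR r'R e]; first exact: restr_neq0.
  by apply: Rinj => //; apply/esym/(restr_trace (Rh _ r'R) e).
- move=> t th; have [r rR er] := cover t th; exists r; split=> //.
  by apply: trace_restr => //; apply: Rh.
have -> : restriction A (val h) = [fset trace t | t in R]%fset.
  apply/fsetP => X; apply/imfsetP/imfsetP => /= [[L]|[t tR ->]].
    rewrite !inE => /andP[nL LA] ->; have [|r rR er] := cover [` LA]%fset.
      by rewrite -val_eqE.
    by exists r.
  exists (val t) => //; rewrite !inE (valP t) andbT val_eqE.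
  exact: Rh.
by rewrite card_in_imfset /=; [rewrite -cardE|move=> r r' rR r'R; apply: Rinj].
Qed.

End RestrictionTransversal.

Section Resolution.
Context {K : fieldType} {l : nat} {T : finType}.
Local Notation S := {mpoly K[l]}.
Variables (u : T -> 'cV[K]_l) (h : T) (w : 'rV[K]_l) (R : {set T}).
Hypothesis ip : independent_pairs u setT.
Hypothesis wh : pairing w (u h) = 1.
Hypothesis RD : R \subset [set~ h].
Hypothesis ipR : independent_pairs (restr u h w) R.
Hypothesis coverR : forall t, t != h ->
  exists r, r \in R /\ exists c, restr u h w t = c *: restr u h w r.
Variables (e : 'I_l -> nat) (theta : 'I_l -> 'rV[S]_l).
Hypothesis theta_log : forall i, logd u setT (theta i).
Hypothesis theta_homog : forall i, der_homog (e i) (theta i).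
Hypothesis theta_gen : forall delta, logd u setT delta ->
  exists a : 'I_l -> S, delta = \sum_i a i *: theta i.
Hypothesis theta_free : forall a : 'I_l -> S, \sum_i a i *: theta i = 0 -> forall i, a i = 0.
Local Notation d := #|[set~ h] :\: R|.
Hypothesis e_lt : forall i, (e i < d)%N.

Lemma deletion_resolution : exists (phi : 'rV[S]_l) (f : 'I_l -> S),
  [/\ [/\ logd u [set~ h] phi & der_homog d phi],
      forall i m, m \in msupp (f i) -> (mdeg m + e i)%N = d.+1,
      forall i, (f i)@_0%MM = 0,
      forall delta, logd u [set~ h] delta ->
        exists (g : S) (c : 'I_l -> S), delta = g *: phi + \sum_i c i *: theta i
    & forall (g : S) (c : 'I_l -> S), g *: phi + \sum_i c i *: theta i = 0 <->
        exists k : S, g = k * lf (u h) /\ forall i, c i = k * f i].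
Proof.
have [phi [lphi hphi ephi]] := terao_poly_attained_homog ip wh RD ipR coverR
  theta_log theta_gen theta_free.
have B0 := terao_poly_neq0 h w ip R.
have [p ep] := theta_gen (logd_alphaZ lphi).
have ha : der_homog d.+1 (lf (u h) *: phi).
  by move=> j; rewrite mxE; have := dhomogM (lf_homog (u h)) (hphi j); rewrite add1n.
(* By [e_lt] the degree [d.+1 - e i] is positive: the subtraction is exact and the relation is
   minimal. *)
pose q i := pihomog mdeg (d.+1 - e i) (p i).
have {}ep : lf (u h) *: phi = \sum_i q i *: theta i.
  rewrite [LHS](homogeneous_coefficients theta_homog ha ep); apply: eq_bigr => i _.
  by rewrite leqW // ltnW.
have qh i : q i \is (d.+1 - e i).-homog by apply: pihomogP.
have rl delta : logd u setT delta -> proj w (u h) (vapp delta (u h)) = 0.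
  by move=> ld; apply/(dividesE wh)/ld/in_setT.
have ls (c : 'I_l -> S) : logd u setT (\sum_i c i *: theta i).
  by apply: logd_sum => i _; apply/logdZ/theta_log.
exists phi, (fun i => - q i); split=> [//|i m|i|delta ld|g c].
- rewrite (perm_mem (msuppN _)) => /(dhomog_mf (qh i)) /= ->.
  by rewrite subnK // leqW // ltnW.
- rewrite mcoeffN (@dhomog_nemf_coeff _ _ mdeg _ _ _ (qh i)) ?oppr0 //=.
  by rewrite mdeg0 eq_sym -lt0n subn_gt0 ltnS ltnW.
(* delta(alpha) is [g] times B modulo alpha, so subtracting [g *: phi] leaves an element of D(A). *)
- have [g0 eg0] := terao_divides ip wh RD ipR coverR ld.
  pose g := proj w (u h) g0.
  have lD : logd u setT (delta - g *: phi).
    move=> t _; case: (eqVneq t h) => [->|th]; last first.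
      by apply: (logdB (D := [set~ h])) => //; [apply: logdZ|rewrite !inE].
    apply/(dividesE wh); rewrite vappB vappZ rmorphB rmorphM /= ephi (proj_idem wh).
    have := congr1 (proj w (u h)) eg0.
    by rewrite (proj_idem wh) rmorphM /= rho_qpoly_restr // => ->; rewrite subrr.
  have [c ec] := theta_gen lD; exists g, c.
  by rewrite -ec addrC subrK.
- split=> [rel|[k [-> ck]]]; last first.
    rewrite -scalerA ep scaler_sumr -big_split big1 //= => i _.
    by rewrite ck scalerA -scalerDl mulrN addrN scale0r.
  (* Evaluated on alpha and reduced modulo alpha, the relation says that B kills [g]; so alpha
     divides [g], and freeness determines the other coefficients. *)
  have : proj w (u h) g = 0.
    have := congr1 (fun x => proj w (u h) (vapp x (u h))) rel.
    rewrite vappD vappZ vapp0 rmorphD rmorphM /= ephi (rl _ (ls c)) raddf0 addr0.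
    by move/eqP; rewrite mulf_eq0 (negPf B0) orbF => /eqP.
  move/(dividesE wh) => [k ek]; exists k; split=> // i.
  apply/eqP; rewrite mulrN -addr_eq0 addrC; apply/eqP; move: i.
  apply: (theta_free (a := fun i => k * q i + c i)).
  rewrite -[RHS]rel ek -scalerA ep scaler_sumr -big_split; apply: eq_bigr => i _ /=.
  by rewrite scalerDl scalerA.
Qed.

End Resolution.

(** * Uniqueness of exponents and level *)

Section Uniqueness.
Context {K : fieldType} {l : nat}.
Local Notation S := {mpoly K[l]}.

(* The constant terms of the two change-of-generators matrices are inverse to
   each other, and Leibniz' formula matches the degrees. *)
Lemma minimal_generators_degrees n (U V : 'I_n -> 'rV[S]_l) (a b : 'I_n -> nat) :
  (forall j, der_homog (a j) (U j)) -> (forall k, der_homog (b k) (V k)) ->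
  (forall j, exists c : 'I_n -> S, U j = \sum_k c k *: V k) ->
  (forall k, exists c : 'I_n -> S, V k = \sum_j c j *: U j) ->
  (forall c : 'I_n -> S, \sum_j c j *: U j = 0 -> forall j, (c j)@_0%MM = 0) ->
  exists s : 'S_n, forall j, a j = b (s j).
Proof.
move=> hU hV /fin_all_exists[P0 eP0] /fin_all_exists[Q eQ] minU.
(* With homogeneous coefficients, a nonzero constant term of [P j k] forces [a j = b k]. *)
pose P j k := if (b k <= a j)%N then pihomog mdeg (a j - b k) (P0 j k) else 0.
have eP j : U j = \sum_k P j k *: V k by apply: homogeneous_coefficients hV (hU j) (eP0 j).
pose Pm : 'M[K]_n := \matrix_(j, k) (P j k)@_0%MM.
pose Qm : 'M[K]_n := \matrix_(k, j) (Q k j)@_0%MM.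
have PQ : Pm *m Qm = 1%:M.
  apply/matrixP => j i; rewrite !mxE.
  have rel : \sum_i (\sum_k P j k * Q k i - (j == i)%:R) *: U i = 0.
    under eq_bigr => i' _ do rewrite scalerBl scaler_suml.
    rewrite sumrB; have -> : \sum_i (j == i)%:R *: U i = U j.
      rewrite (bigD1 j) //= eqxx scale1r big1 ?addr0 // => i' ni.
      by rewrite eq_sym (negPf ni) scale0r.
    rewrite exchange_big /= (eP j); apply/eqP; rewrite subr_eq0; apply/eqP.
    apply: eq_bigr => k _; rewrite eQ scaler_sumr; apply: eq_bigr => i' _.
    by rewrite scalerA.
  have := minU _ rel i; rewrite mcoeffB => /eqP; rewrite subr_eq0 => /eqP.
  rewrite raddf_sum /= => e; transitivity ((j == i)%:R : {mpoly K[l]})@_0%MM.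
    rewrite -e; apply: eq_bigr => k _; rewrite !mxE.
    by rewrite -(rmorphM (mcoeff 0%MM)).
  by case: eqP => _; rewrite ?mcoeff0 // mcoeff1 eqxx.
have dP : \det Pm != 0 by have [] := mulmx1_unit PQ; rewrite unitmxE unitfE.
have [s hs] : exists s : 'S_n, \prod_i Pm i (s i) != 0.
  apply/existsP; apply: contraNT dP; rewrite negb_exists => /forallP z.
  rewrite /determinant big1 // => s _; move: (z s); rewrite negbK => /eqP ->.
  by rewrite mulr0.
exists s => j; move/prodf_neq0: hs => /(_ j isT); rewrite mxE /P.
case: leqP => [le|lt]; last by rewrite mcoeff0 eqxx.
rewrite -mcoeff_msupp => /(dhomog_mf (pihomogP _ _ _)) /=; rewrite mdeg0 => /esym/eqP.
by rewrite subn_eq0 => le'; apply/eqP; rewrite eqn_leq le le'.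
Qed.

Lemma det0_of_relation (W : 'I_l -> 'rV[S]_l) (r : 'I_l -> S) i :
  r i != 0 -> \sum_j r j *: W j = 0 -> \det (coefmx W) = 0.
Proof.
move=> ri rel; apply/eqP/det0P; exists (\row_j r j).
  by apply: contraNneq ri => /rowP/(_ i); rewrite !mxE => ->.
by rewrite coefmx_comb -[RHS]rel; apply: eq_bigr => j _; rewrite mxE.
Qed.

(* If lev <> d then d is one of the e' and lev < d, so that the coefficient of the
   generator of degree d in the relation is a constant, hence 0 by minimality.
   The remaining l generators satisfy a relation but generate all the theta i,
   whose degrees are below d: this forces det theta = 0. *)
Lemma resolution_unique (A : subspaces K l) (e e' : l.-tuple nat) (d lev : nat)
    (theta theta' : 'I_l -> 'rV[S]_l) (phi phi' : 'rV[S]_l) (alpha alpha' : S)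
    (f f' : 'I_l -> S) :
  pog_resolution A e d theta phi alpha f -> pog_resolution A e' lev theta' phi' alpha' f' ->
  (forall i, (tnth e i < d)%N) -> \det (coefmx theta) != 0 ->
  perm_eq e e' /\ lev = d.
Proof.
move=> r1 r2 e_lt det0.
pose gens (th : 'I_l -> 'rV[S]_l) (ph : 'rV[S]_l) (i : 'I_l.+1) :=
  if unlift ord0 i is Some j then th j else ph.
pose coe (g : S) (c : 'I_l -> S) (i : 'I_l.+1) := if unlift ord0 i is Some j then c j else g.
have sumE th ph g c : \sum_i coe g c i *: gens th ph i = g *: ph + \sum_i c i *: th i.
  rewrite big_ord_recl /coe /gens unlift_none; congr (_ + _).
  by apply: eq_bigr => i _; rewrite liftK.
have coeE (c : 'I_l.+1 -> S) : c =1 coe (c ord0) (fun i => c (lift ord0 i)).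
  by move=> i; rewrite /coe; case: unliftP => [j|] ->.
pose t1 : l.+1.-tuple nat := [tuple of d :: e].
pose t2 : l.+1.-tuple nat := [tuple of lev :: e'].
have tE (x : nat) (y : l.-tuple nat) (i : 'I_l.+1) :
    tnth [tuple of x :: y] i = if unlift ord0 i is Some j then tnth y j else x.
  by case: unliftP => [j|] ->; rewrite ?tnthS ?tnth0.
have gens_homog A' e1 d1 th ph al ff (r : @pog_resolution K l A' e1 d1 th ph al ff) i :
    der_homog (tnth [tuple of d1 :: e1] i) (gens th ph i).
  rewrite tE /gens; case: (unlift ord0 i) => [j|]; first exact: pog_theta_homog r j.
  exact: pog_phi_homog r.
have gens_log A' e1 d1 th ph al ff (r : @pog_resolution K l A' e1 d1 th ph al ff) i :
    log_der A' (gens th ph i).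
  rewrite /gens; case: (unlift ord0 i) => [j|]; first exact: pog_theta_log r j.
  exact: pog_phi_log r.
have gens_gen A' e1 d1 th ph al ff (r : @pog_resolution K l A' e1 d1 th ph al ff) delta :
    log_der A' delta -> exists c : 'I_l.+1 -> S, delta = \sum_i c i *: gens th ph i.
  by move=> /(pog_generate r)[g [c ->]]; exists (coe g c); rewrite sumE.
have h1 := gens_homog _ _ _ _ _ _ _ r1; have h2 := gens_homog _ _ _ _ _ _ _ r2.
have a0 : alpha@_0%MM = 0 by apply: (@dhomog_nemf_coeff _ _ mdeg _ _ _ (pog_alpha_homog r1)); rewrite /= mdeg0.
have [s hs] : exists s : 'S_l.+1, forall j, tnth t1 j = tnth t2 (s j).
  apply: (minimal_generators_degrees h1 h2) => [j|j|c].
  - by apply: gens_gen r2 _ _; apply: gens_log r1 _.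
  - by apply: gens_gen r1 _ _; apply: gens_log r2 _.
  under eq_bigr => i _ do rewrite coeE.
  rewrite sumE => /(pog_exact r1)[k [ck cf]] j.
  have : (coe (c ord0) (fun i => c (lift ord0 i)) j)@_0%MM = 0.
    have kM (x : S) : x@_0%MM = 0 -> (k * x)@_0%MM = 0.
      by move=> x0; rewrite (rmorphM (mcoeff 0%MM)) /= x0 mulr0.
    rewrite /coe; case: (unlift ord0 j) => [i|]; last by rewrite ck kM.
    by rewrite cf kM // (pog_minimal r1).
  by rewrite -coeE.
have pe : perm_eq t1 t2.
  apply/tuple_permP; exists s; rewrite -[LHS]map_tnth_enum.
  by apply: eq_map => i; apply: hs.
suff ld : lev = d by split=> //; move: pe; rewrite /= ld perm_cons.
apply/eqP; apply: contraT => nld.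
have /= lev_in : lev \in (d :: e : seq nat) by rewrite (perm_mem pe) mem_head.
have lev_lt : (lev < d)%N.
  by move: lev_in; rewrite inE (negPf nld) => /tnthP[i ->]; apply: e_lt.
have : d \in (lev :: e' : seq nat) by rewrite -(perm_mem pe) mem_head.
rewrite inE eq_sym (negPf nld) => /tnthP[k ek].
have fk0 : f' k = 0.
  apply/mpolyP => m; rewrite mcoeff0; apply/eqP; apply: contraT; rewrite -mcoeff_msupp => mk.
  have := pog_f_homog r2 mk; rewrite -ek => em.
  have m0 : mdeg m == 0%N by move: em lev_lt; lia.
  move: mk; rewrite mdeg_eq0 in m0; rewrite (eqP m0) mcoeff_msupp (pog_minimal r2).
  by rewrite eqxx.
pose W j := if j == k then phi' else theta' j.
pose r j := if j == k then alpha' else f' j.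
have rel : \sum_j r j *: W j = 0.
  have : alpha' *: phi' + \sum_i f' i *: theta' i = 0.
    by apply/(pog_exact r2); exists 1; split=> [|i]; rewrite mul1r.
  rewrite (bigD1 k) //= fk0 scale0r add0r => e0; rewrite -[RHS]e0 (bigD1 k) //=.
  rewrite /r /W eqxx; congr (_ + _); apply: eq_bigr => j /negPf nj.
  by rewrite nj.
have [i ri] : exists i, r i != 0.
  have [a'0|[i fi]] := pog_injective r2; first by exists k; rewrite /r eqxx.
  by exists i; rewrite /r; case: (eqVneq i k) => [ik|_] //; rewrite ik fk0 eqxx in fi.
have W0 := det0_of_relation ri rel.
have thW i' : exists c : 'I_l -> S, theta i' = \sum_j c j *: W j.
  have [c ec] := gens_gen _ _ _ _ _ _ _ r2 _ (pog_theta_log r1 i').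
  pose c' i := if (tnth t2 i <= tnth e i')%N
    then pihomog mdeg (tnth e i' - tnth t2 i) (c i) else 0.
  have ec' : theta i' = \sum_i c' i *: gens theta' phi' i.
    exact: homogeneous_coefficients h2 (pog_theta_homog r1 i') ec.
  have ck : c' (lift ord0 k) = 0.
    by rewrite /c' tE liftK -ek leqNgt e_lt.
  exists (fun j => if j == k then c' ord0 else c' (lift ord0 j)).
  rewrite ec' big_ord_recl {1}/gens unlift_none /= [RHS](bigD1 k) //= /W eqxx; congr (_ + _).
  rewrite (bigD1 k) //= ck scale0r add0r; apply: eq_bigr => j /negPf nj.
  by rewrite nj /gens liftK.
have [C eC] := fin_all_exists thW.
case/eqP: det0; have -> : coefmx theta = (\matrix_(i, j) C i j) *m coefmx W.
  apply/row_matrixP => i'; rewrite row_mul coefmx_comb; transitivity (theta i').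
    by apply/rowP => j; rewrite !mxE.
  by rewrite eC; apply: eq_bigr => j _; rewrite !mxE.
by rewrite det_mulmx W0 mulr0.
Qed.

End Uniqueness.

(** * Addition and deletion *)

Section Arrangements.
Context {K : fieldType} {l : nat}.
Local Notation S := {mpoly K[l]}.
Implicit Types (A : subspaces K l).

Lemma arrangement_normals A : arrangement A -> exists u : A -> 'cV[K]_l,
  (forall t, u t != 0) /\ (forall (t : A) x, (x \in val t) = (pairing x (u t) == 0)).
Proof.
move=> arr; have h (t : A) : exists v : 'cV[K]_l,
    v != 0 /\ forall x, (x \in val t) = (pairing x v == 0).
  exact: hyperplane_normal (arr _ (valP t)).
have [u hu] := fin_all_exists h.
by exists u; split=> t; case: (hu t).
Qed.

(** In Whitney's formula the power l - 1 comes from subsets of rank 1, which are the singletons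
    because the hyperplanes are distinct. *)
Lemma arr_char_poly_coef A : arrangement A -> (0 < l)%N ->
  (arr_char_poly A)`_l.-1 = - (#|` A|%:Z).
Proof.
move=> arr lpos; have [u [un0 ker_u]] := arrangement_normals arr.
rewrite (whitney un0 ker_u) coef_sum.
have dimV (B : {set A}) : (l - \rank (selmx u B))%N = \dim (flat B).
  by rewrite (dim_flat ker_u).
have dimval (t : A) : \dim (val t) = l.-1 by rewrite -[LHS]/((\dim (val t)).+1.-1) arr // (valP t).
have flat1 t : flat [set t] = val t by rewrite /flat big_set1.
transitivity (\sum_(B : {set A} | #|B| == 1%N) (-1 : int)).
  rewrite [RHS]big_mkcond; apply: eq_bigr => B _; rewrite coefCM coefXn dimV.
  case: (eqVneq #|B| 1%N) => [B1|nB1].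
    move/eqP/cards1P: (B1) => [t ->]; rewrite flat1 dimval eqxx mulr1 cards1.
    by rewrite expr1.
  case: eqP => [ed|_]; last by rewrite mulr0.
  have [B0|[t tB]] := set_0Vmem B.
    move: ed; rewrite B0 flat_set0 dimvf /dim /= mul1n.
    move=> el; suff: (l.-1 < l)%N by rewrite el ltnn.
    by rewrite ltn_predL.
  have sub t' : t' \in B -> flat B = val t'.
    move=> t'B; apply/eqP; rewrite eqEdim dimval -ed leqnn andbT.
    exact: (bigcapv_inf t').
  case/eqP: nB1; apply/eqP/cards1P; exists t; apply/setP => t'; rewrite inE.
  apply/idP/eqP => [t'B|-> //]; apply: val_inj.
  by rewrite -(sub _ tB) -(sub _ t'B).
rewrite sumr_const mulNrn; congr (- _).
have := card_draws {: A} 1; rewrite cardsE bin1 cardfE => ->.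
by rewrite natz.
Qed.

Section Free.
Variables (A : subspaces K l) (u : A -> 'cV[K]_l).
Hypothesis un0 : forall t, u t != 0.
Hypothesis ker_u : forall (t : A) x, (x \in val t) = (pairing x (u t) == 0).

Definition log_basis (e : 'I_l -> nat) (theta : 'I_l -> 'rV[S]_l) : Prop :=
  [/\ forall i, logd u setT (theta i),
      forall i, der_homog (e i) (theta i),
      forall delta, logd u setT delta ->
        exists a : 'I_l -> S, delta = \sum_i a i *: theta i
    & forall a : 'I_l -> S, \sum_i a i *: theta i = 0 -> forall i, a i = 0].

Lemma free_log_basis (e : l.-tuple nat) :
  free_with_exponents A e <-> exists theta, log_basis (tnth e) theta.
Proof.
split=> -[theta [h1 h2 h3 h4]]; exists theta; split=> //.
- by move=> i; apply/(log_der_setT un0 ker_u).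
- by move=> delta /(log_der_setT un0 ker_u)/h3.
- by move=> i; apply/(log_der_setT un0 ker_u).
- by move=> delta /(log_der_setT un0 ker_u)/h3.
Qed.

Lemma log_basis_det e theta : log_basis e theta ->
  exists2 c : K, c != 0 & \det (coefmx theta) = c *: qpoly u setT.
Proof. by move=> [h1 h2 h3 h4]; apply: generators_det (normals_independent un0 ker_u) h1 h3. Qed.

Lemma log_basis_char_poly e theta : log_basis e theta ->
  arr_char_poly A = \prod_i ('X - ((e i)%:Z)%:P).
Proof.
move=> lb; have [c c0 dc] := log_basis_det lb; case: lb => h1 h2 _ _.
by rewrite (whitney un0 ker_u) (free_whitney (normals_independent un0 ker_u) h1 h2 c0 dc).
Qed.

Hypothesis ess : essential A.

(** Such a derivation is a constant vector lying in every hyperplane, and essentiality makes it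
    zero. *)
Lemma no_constant_log_der theta : logd u setT theta -> der_homog 0 theta -> theta = 0.
Proof.
move=> lt ht; pose x : 'rV[K]_l := \row_j (theta 0 j)@_0%MM.
have thE : theta = cder x.
  apply/rowP => j; rewrite !mxE; apply/mpolyP => m; rewrite mcoeffC.
  case: eqP => [->|/eqP m0]; first by rewrite mulr1.
  by rewrite mulr0 (@dhomog_nemf_coeff _ _ mdeg _ _ _ (ht j)) // mdeg_eq0.
suff x0 : x = 0 by rewrite thE x0 /cder map_mx0.
have : x \in (\bigcap_(L <- A) L)%VS.
  rewrite memv_bigcap_seq; apply/allP => L LA.
  have := lt [` LA]%fset (in_setT _); rewrite thE vapp_cder => dv.
  rewrite (ker_u [` LA]%fset) -(mpolyC_eq0 l).
  have [w wt] := pairing_exists (un0 [` LA]%fset).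
  have /(dividesE wt) := dv.
  by rewrite /proj comp_mpolyC => ->.
by rewrite ess memv0 => /eqP.
Qed.

(** The resolution must contain the Euler derivation. All degrees are positive by essentiality, so
    its expansion, of degree 1, has a nonzero constant coefficient at some basis element of degree
    1, which can be exchanged for it. *)
Lemma log_basis_euler e theta : (0 < l)%N -> log_basis e theta ->
  exists theta' i, log_basis e theta' /\ theta' i = euler.
Proof.
move=> lpos [h1 h2 h3 h4].
have e_pos i : (0 < e i)%N.
  rewrite lt0n; apply/negP => /eqP e0; have hi := h2 i; rewrite e0 in hi.
  have t0 := no_constant_log_der (h1 i) hi.
  have := h4 (fun k => (k == i)%:R).
  rewrite (bigD1 i) //= t0 scaler0 add0r big1 => [/(_ erefl i)|k nk].
    by move/eqP; rewrite eqxx oner_eq0.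
  by rewrite (negPf nk) scale0r.
have [a ea] := h3 _ (@euler_log _ _ _ u setT).
have hE : der_homog 1 (euler : 'rV[S]_l) by move=> j; rewrite mxE dhomogX /= mdeg1.
have {}ea := homogeneous_coefficients h2 hE ea.
pose b i := if (e i <= 1)%N then pihomog mdeg (1 - e i) (a i) else 0.
have {}ea : (euler : 'rV[S]_l) = \sum_i b i *: theta i by exact: ea.
have E0 : (euler : 'rV[S]_l) != 0.
  apply/eqP => /rowP/(_ (Ordinal lpos)); rewrite !mxE => /(congr1 (mcoeff U_(Ordinal lpos))).
  by rewrite mcoeffXU eqxx mcoeff0 => /eqP; rewrite oner_eq0.
have [i bi] : exists i, b i != 0.
  apply/existsP; apply: contraNT E0; rewrite negb_exists => /forallP z.
  rewrite ea big1 // => i _; move: (z i); rewrite negbK => /eqP ->.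
  by rewrite scale0r.
have ei : e i = 1%N.
  by apply/eqP; rewrite eqn_leq e_pos andbT; apply: contraNT bi => ne; rewrite /b (negPf ne).
have [k k0 bk] : exists2 k, k != 0 & b i = k%:MP.
  move: bi; rewrite /b ei leqnn subnn => bi; apply/msize_poly1P.
  by rewrite eqn_leq (msize_homog (pihomogP _ _ _)) lt0n msize_poly_eq0.
pose theta' j := if j == i then euler else theta j.
exists theta', i; split; last by rewrite /theta' eqxx.
have sumE (c : 'I_l -> S) : \sum_j c j *: theta' j =
    \sum_j (c i * b j + (if j == i then 0 else c j)) *: theta j.
  under [RHS]eq_bigr => j _ do rewrite scalerDl -scalerA.
  rewrite big_split /= -scaler_sumr -ea (bigD1 i) //= /theta' eqxx; congr (_ + _).
  rewrite [RHS](bigD1 i) //= eqxx scale0r add0r; apply: eq_bigr => j nj.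
  by rewrite (negPf nj).
split=> [j|j|delta /h3[c ec]|c rel].
- by rewrite /theta'; case: eqP => // _; exact: euler_log.
- by rewrite /theta'; case: eqP => // ->; rewrite ei.
- pose c' j := if j == i then k^-1 *: c i else c j - (k^-1 *: c i) * b j.
  exists c'; rewrite sumE ec; apply: eq_bigr => j _; congr (_ *: _).
  rewrite /c' eqxx; case: eqP => [->|_]; last by rewrite addrC subrK.
  by rewrite bk addr0 mulrC mul_mpolyC scalerA divff // scale1r.
rewrite sumE in rel; have z := h4 _ rel.
have ci : c i = 0.
  have := z i; rewrite eqxx addr0 => /eqP; rewrite mulf_eq0 (negPf bi) orbF.
  by move/eqP.
move=> j; case: (eqVneq j i) => [->//|nj].
by have := z j; rewrite (negPf nj) ci mul0r add0r.
Qed.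

End Free.

End Arrangements.

Lemma prod_XsubC_sum (R : comNzRingType) n (x : 'I_n -> R) : (0 < n)%N ->
  (\prod_i ('X - (x i)%:P))`_n.-1 = - \sum_i x i.
Proof.
move=> n0; have := @coefPn_prod_XsubC R [seq x i | i <- index_enum 'I_n].
rewrite size_map -[index_enum _]enumT size_enum_ord => /(_ (lt0n_neq0 n0)).
by rewrite enumT !big_map.
Qed.

Lemma exponents_of_char_poly (R : numFieldType) l (p : {poly int}) (e : l.-tuple nat)
    (d : l.-tuple R) :
  p = \prod_i ('X - ((tnth e i)%:Z)%:P) ->
  map_poly (intr : int -> R) p = \prod_i ('X - (tnth d i)%:P) ->
  perm_eq [seq n%:R | n <- e] d.
Proof.
move=> -> eq; apply: prod_XsubC_eq; rewrite big_map !big_tuple -eq rmorph_prod.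
by apply: eq_bigr => i _; rewrite /= rmorphB /= map_polyX map_polyC.
Qed.

Section AdditionDeletion.
Context {K : fieldType} {l : nat}.
Local Notation S := {mpoly K[l]}.
Variables (A : subspaces K l) (u : A -> 'cV[K]_l).
Hypothesis un0 : forall t, u t != 0.
Hypothesis ker_u : forall (t : A) x, (x \in val t) = (pairing x (u t) == 0).
Variables (h : A) (w : 'rV[K]_l) (R : {set A}).
Hypothesis wh : pairing w (u h) = 1.
Hypothesis RD : R \subset [set~ h].
Hypothesis ipR : independent_pairs (restr u h w) R.
Hypothesis coverR : forall t, t != h ->
  exists r, r \in R /\ exists c, restr u h w t = c *: restr u h w r.
Local Notation d := #|[set~ h] :\: R|.
Variable e : l.-tuple nat.
Hypothesis e_lt : forall i, (tnth e i < d)%N.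

Let ip := normals_independent un0 ker_u.

Lemma free_resolution : essential A -> (0 < l)%N -> free_with_exponents A e ->
  exists theta phi f, pog_resolution (A `\ val h)%fset e d theta phi (lf (u h)) f /\
    \det (coefmx theta) != 0.
Proof.
move=> ess lpos /(free_log_basis un0 ker_u)[theta0 lb0].
have [theta [i0 [lb theta_i0]]] := log_basis_euler un0 ker_u ess lpos lb0.
have [c c0 dc] := log_basis_det un0 ker_u lb; case: (lb) => h1 h2 h3 h4.
have [phi [f [[lphi hphi] fh f0 gen ex]]] :=
  deletion_resolution ip wh RD ipR coverR h1 h2 h3 h4 e_lt.
exists theta, phi, f; split; last by rewrite dc scaler_eq0 negb_or c0 qpoly_neq0.
split=> //.
- by move=> i; apply/(log_der_setC1 un0 ker_u)/(logdS (subsetT _)).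
- exact/(log_der_setC1 un0 ker_u).
- by exists i0.
- exact: lf_homog.
- by move=> delta /(log_der_setC1 un0 ker_u)/gen.
- by left; rewrite lf_eq0.
Qed.

Lemma resolution_free lev theta phi alpha f :
  pog_resolution (A `\ val h)%fset e lev theta phi alpha f -> alpha != 0 ->
  (\sum_i tnth e i)%N = #|` A| -> free_with_exponents A e.
Proof.
case=> lth hth _ _ _ _ _ _ _ ex _ alpha0 sum_e.
have lT i : logd u setT (theta i).
  apply: (log_of_low_degree ip wh RD ipR coverR _ (hth i) (e_lt i)).
  exact/(log_der_setC1 un0 ker_u).
(* A relation that omits [phi] is a multiple of the basic one with [k * alpha = 0], and [alpha] is
   nonzero. *)
have free (c : 'I_l -> S) : \sum_i c i *: theta i = 0 -> forall i, c i = 0.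
  move=> rel; have [|k [k0 ck] i] := (ex 0 c).1; first by rewrite scale0r add0r.
  move/esym/eqP: k0; rewrite mulf_eq0 (negPf alpha0) orbF => /eqP k0.
  by rewrite ck k0 mul0r.
have det0 : \det (coefmx theta) != 0.
  apply/det0P => -[c /negP c0]; rewrite coefmx_comb => /free cz; apply: c0.
  by apply/eqP/rowP => i; rewrite cz mxE.
(* The determinant is a nonzero multiple of Q and both have degree |A|, so the quotient is a
   constant. *)
have [g eg] := saito_det_divides ip lT.
have [g0 Q0] : g != 0 /\ qpoly u setT != 0.
  by apply/andP; rewrite -negb_or -mulf_eq0 -eg.
have homog_size (p : S) n : p \is n.-homog -> p != 0 -> msize p = n.+1.
  by move=> hp p0; rewrite -mlead_deg // (dhomog_mf hp (mlead_supp p0)).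
have [c c0 gc] : exists2 c, c != 0 & g = c%:MP.
  apply/msize_poly1P; have := homog_size _ _ (coefmx_det_homog hth) det0.
  rewrite sum_e eg msizeM // (homog_size _ _ (qpoly_homog u setT) Q0) cardsT cardfE.
  by rewrite addnS /= -[RHS]add1n => /eqP; rewrite eqn_add2r.
apply/(free_log_basis un0 ker_u); exists theta; split=> //.
by apply: (saito_criterion ip lT c0); rewrite eg gc mul_mpolyC.
Qed.

End AdditionDeletion.

Theorem theorem1p8 (K : fieldType) (R : realType) (l : nat)
    (A : {fset {vspace 'rV[K]_l}}) (H : {vspace 'rV[K]_l}) (d : l.-tuple R)
    (A_arr : arrangement A) (A_ess : essential A) (HA : H \in A)
    (chiA : map_poly (intr : int -> R) (arr_char_poly A) =
            \prod_(i < l) ('X - (tnth d i)%:P))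
    (d_lt : forall i : 'I_l, tnth d i <
            #|` (A `\ H)%fset|%:R - #|` restriction A H|%:R) :
  (is_free A <->
     exists (e : l.-tuple nat) (lev : nat),
       perm_eq [seq n%:R | n <- e] d /\
       strictly_plus_one_generated (A `\ H)%fset e lev) /\
  (is_free A ->
     forall (e e' : l.-tuple nat) (lev : nat),
       free_with_exponents A e ->
       plus_one_generated (A `\ H)%fset e' lev ->
       perm_eq e e' /\
       lev%:R = #|` (A `\ H)%fset|%:R - #|` restriction A H|%:R :> R).
Proof.
have lpos : (0 < l)%N by rewrite -(A_arr H HA).
have [u [un0 ker_u]] := arrangement_normals A_arr.
pose h : A := [` HA]%fset; have [w wh] := pairing_exists (un0 h).
have [T [TD ipT coverT card_T]] := restriction_transversal un0 ker_u wh.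
have levE : #|` (A `\ H)%fset|%:R - #|` restriction A H|%:R = #|[set~ h] :\: T|%:R :> R.
  have -> : #|` (A `\ H)%fset| = #|[set~ h]|.
    by rewrite cardsC1 -cardfE (cardfsD1 H A) HA.
  rewrite -card_T cardsD (setIidPr TD) natrB //; exact: subset_leq_card.
rewrite levE in d_lt *.
have exp_lt (e : l.-tuple nat) : perm_eq [seq n%:R | n <- e] d ->
    forall i, (tnth e i < #|[set~ h] :\: T|)%N.
  move=> /perm_mem ed i; rewrite -(ltr_nat R).
  have : (tnth e i)%:R \in (d : seq R) by rewrite -ed; apply/map_f/mem_tnth.
  by move=> /tnthP[j ->].
(* Unique factorization identifies the exponents with the roots, which carries the bound on the d_i
   over to them. *)
have free_exp e : free_with_exponents A e -> perm_eq [seq n%:R | n <- e] d.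
  move=> /(free_log_basis un0 ker_u)[theta lb].
  exact: exponents_of_char_poly (log_basis_char_poly un0 ker_u lb) chiA.
have free_res e : free_with_exponents A e -> exists theta phi f,
    pog_resolution (A `\ H)%fset e #|[set~ h] :\: T| theta phi (lf (u h)) f /\
    \det (coefmx theta) != 0.
  move=> fe; have e_lt := exp_lt e (free_exp e fe).
  exact: (free_resolution un0 ker_u wh TD ipT coverT e_lt A_ess lpos fe).
split; [split=> [[e fe]|[e [lev [ed [theta [phi [alpha [f [res alpha0]]]]]]]]]|].
- have [theta [phi [f [res _]]]] := free_res e fe.
  exists e, #|[set~ h] :\: T|; split; first exact: free_exp.
  by exists theta, phi, (lf (u h)), f; rewrite lf_eq0.
- exists e; apply: (resolution_free un0 ker_u wh TD ipT coverT (exp_lt e ed) res alpha0).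
  apply/eqP; rewrite -(eqr_nat R) natr_sum; apply/eqP.
  have sum_d : \sum_i tnth d i = #|` A|%:R.
    have := congr1 (fun p : {poly R} => - p`_l.-1) chiA.
    rewrite coef_map arr_char_poly_coef //= rmorphN opprK /= -pmulrn => ->.
    by rewrite prod_XsubC_sum // opprK.
  rewrite -sum_d -(big_tuple _ _ d xpredT id) -(perm_big _ ed) big_map big_tuple.
  exact: eq_bigr.
(* The given resolution is arbitrary; it is compared with the one built from a basis of D(A), whose
   level is known. *)
move=> _ e e' lev fe [theta' [phi' [alpha' [f' res']]]].
have [theta [phi [f [res det0]]]] := free_res e fe.
by have [ee' ->] := resolution_unique res res' (exp_lt e (free_exp e fe)) det0.
Qed.
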